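(* Let $(K_n)_{n\in\mathbb{N}}$ be a sequence of number fields (subfields of $\overline{\mathbb{Q}}$) such that the sequence $([K_n:\mathbb{Q}])_n$ is bounded. Assume there is a rational prime $p$ such that for every $n$ there is a unique prime ideal $\mathfrak{p}_n$ of $\mathcal{O}_{K_n}$ lying above $p$. Let $L\subset\overline{\mathbb{Q}}$ be the compositum of all the Hilbert class fields $H(K_n)$. Then $L$ has property (B).
   Context: $\mathrm{h}$ denotes the absolute logarithmic Weil height on $\overline{\mathbb{Q}}$, and $\mu_\infty$ the set of roots of unity in $\overline{\mathbb{Q}}$. A field $L\subset\overline{\mathbb{Q}}$ has property (B) if there exists a real $T_0>0$ such that every $\alpha\in L^*$ with $\mathrm{h}(\alpha)\le T_0$ is a root of unity. $H(K)$ denotes the Hilbert class field of the number field $K$ (maximal abelian extension of $K$ unramified at all places). *)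

(* Defs.v *)
(* Qbar is modelled by mathcomp's algC (algebraic complex
   numbers); subfields of Qbar are Prop-valued predicates on algC. *)
From HB Require Import structures.
From mathcomp Require Import all_boot all_order all_algebra all_field.
Set Implicit Arguments. Unset Strict Implicit. Unset Printing Implicit Defensive.
Import Order.TTheory GRing.Theory Num.Theory.
Local Open Scope ring_scope.

Definition is_subfield (F : algC -> Prop) : Prop :=
  [/\ F 0, F 1,
      (forall x y, F x -> F y -> F (x - y)),
      (forall x y, F x -> F y -> F (x * y)) &
      (forall x, F x -> F x^-1)].

Definition dimQ_le (F : algC -> Prop) (d : nat) : Prop :=
  forall (m : nat) (x : 'I_m -> algC),
    (forall i, F (x i)) ->
    (forall c : 'I_m -> rat, \sum_(i < m) ratr (c i) * x i = 0 ->
        forall i, c i = 0) ->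
    (m <= d)%N.

Definition ring_of_integers (F : algC -> Prop) (x : algC) : Prop :=
  F x /\ x \in Aint.

Definition is_prime_ideal (F : algC -> Prop) (P : algC -> Prop) : Prop :=
  (forall x, P x -> ring_of_integers F x) /\
  [/\ P 0,
      (forall x y, P x -> P y -> P (x + y)),
      (forall a x, ring_of_integers F a -> P x -> P (a * x)),
      ~ P 1 &
      (forall x y, ring_of_integers F x -> ring_of_integers F y ->
          P (x * y) -> P x \/ P y)].

Definition ideal_sq (Q : algC -> Prop) (z : algC) : Prop :=
  exists (m : nat) (a b : 'I_m -> algC),
    (forall i, Q (a i)) /\ (forall i, Q (b i)) /\ z = \sum_(i < m) a i * b i.

Definition fixes (K : algC -> Prop) (s : {rmorphism algC -> algC}) : Prop :=
  forall x, K x -> s x = x.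

(* M/K is a finite abelian (Galois) extension.  Embeddings of M over K into
   Qbar are the restrictions of automorphisms of Qbar = algC fixing K. *)
Definition finite_abelian_ext (K M : algC -> Prop) : Prop :=
  [/\ is_subfield M,
      (forall x, K x -> M x),
      (exists d, dimQ_le M d),
      (forall s : {rmorphism algC -> algC}, fixes K s ->
          forall x, M x -> M (s x)) &
      (forall s t : {rmorphism algC -> algC}, fixes K s -> fixes K t ->
          forall x, M x -> s (t x) = t (s x))].

(* M/K unramified at all finite places: for every nonzero prime Q of O_M,
   with P = Q ∩ O_K, the ramification index e(Q|P) is 1, i.e. Q^2 does not
   divide P O_M, i.e. P is not contained in Q^2. *)
Definition unramified_finite (K M : algC -> Prop) : Prop :=
  forall Q, is_prime_ideal M Q -> (exists q, Q q /\ q <> 0) ->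
    exists x, K x /\ Q x /\ ~ ideal_sq Q x.

(* M/K unramified at all infinite places: every real place of K stays real,
   i.e. every embedding of M sending K into the reals sends M into the reals. *)
Definition unramified_infinite (K M : algC -> Prop) : Prop :=
  forall s : {rmorphism algC -> algC},
    (forall x, K x -> s x \is Num.real) -> forall x, M x -> s x \is Num.real.

Definition abelian_unramified_ext (K M : algC -> Prop) : Prop :=
  [/\ finite_abelian_ext K M, unramified_finite K M & unramified_infinite K M].

Definition is_Hilbert_class_field (K H : algC -> Prop) : Prop :=
  abelian_unramified_ext K H /\
  forall M, abelian_unramified_ext K M -> forall x, M x -> H x.

Definition compositum (H : nat -> algC -> Prop) (x : algC) : Prop :=
  forall F, is_subfield F -> (forall n y, H n y -> F y) -> F x.

Definition minQpoly (x : algC) : {poly rat} := sval (minCpolyP x).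

(* leading coefficient a_d of the primitive integer minimal polynomial
   = lcm of the denominators of the monic rational minimal polynomial *)
Definition minZlead (x : algC) : nat :=
  \big[lcmn/1%N]_(c <- minQpoly x) `|denq c|%N.

Definition conjugates (x : algC) : seq algC :=
  sval (closed_field_poly_normal (minCpoly x)).

Definition alg_degree (x : algC) : nat := (size (minCpoly x)).-1.

Definition mahler (x : algC) : algC :=
  (minZlead x)%:R * \prod_(z <- conjugates x) Num.max 1 `|z|.

Definition mult_height (x : algC) : algC := (alg_degree x).-root (mahler x).

Definition root_of_unity (x : algC) : Prop := exists n, (0 < n)%N /\ x ^+ n = 1.

(* Property (B): exists T0 > 0 with h(x) <= T0 => root of unity on L^*.
   Stated multiplicatively with C = exp(T0) > 1. *)
Definition property_B (L : algC -> Prop) : Prop :=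
  exists C : algC, 1 < C /\
    forall x, L x -> x != 0 -> mult_height x <= C -> root_of_unity x.

(* Main.v *)
From HB Require Import structures.
From mathcomp Require Import all_boot all_order all_fingroup all_algebra all_solvable all_field.
From mathcomp Require Import boolp classical_sets.
From mathcomp Require Import ring lra zify.
Require Import Defs.
Set Implicit Arguments. Unset Strict Implicit. Unset Printing Implicit Defensive.

(** Everything follows from a congruence x^b = x^a mod p^2, with a < b depending
    only on p and on the degree bound d, valid for the x in L that are integral at
    a prime P above p, whatever P.  Such an x is a root of unity, or x^b - x^a is
    nonzero and its norm, which is the resultant of two integer polynomials up to
    denominators, is divisible by a power of p^2 that forces the Mahler measure of
    x to be exponentially large in the degree of x; the exponent 2 serves to beat
    |x^b - x^a| <= 2 max(1, |x|)^b at the archimedean places, even when p = 2.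

    The congruence holds because the completions of the H(K_n) at P lie in one
    finite extension of Q_p.  Indeed their ramification index over Q_p is that of
    K_n, and their residue fields lie in the field with p^(d!) elements: let G, U
    and W be the Galois groups of a Galois number field over Q, K_n and H(K_n).
    Since H(K_n) / K_n is unramified, the transfer G -> U / W kills every inertia
    group and every complex conjugation; its kernel is all of G because Q has no
    unramified extension (Minkowski).  As p has a single prime above it in K_n,
    the transfer of a Frobenius element at P acts on H(K_n) as y |-> y^(p^[K_n : Q])
    modulo P, so that the residue field of H(K_n) lies in the one with p^[K_n : Q]
    elements.

    Up to P-adic approximation, a uniformizer of K_n at P is a root of an Eisenstein
    polynomial of degree at most d whose coefficients, being truncated sums of
    Teichmueller digits, lie in a finite set independent of n; this yields the
    common finite extension. *)

Import Order.TTheory GRing.Theory Num.Theory.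
Local Open Scope ring_scope.

(** * Algebraic integers *)

(** No completion is formed: a prime P of the ring of all algebraic integers yields a valuation ring
    of [algC], and P-adic statements are divisibilities in it, so that one prime serves all the
    H(K_n) at once. Every P above p must be treated with the same a and b, because the norm involves
    all conjugates of x, and t x at P behaves like x at the prime pulled back along t. An element
    that is not integral at P is handled through its inverse.

    Transfer plays the part of the Artin map. By class field theory, the prime of K_n above p has a
    power equal to the principal ideal (p), which bounds the order of its Frobenius in H(K_n);
    transfer gives the same bound, at the price of Minkowski's theorem, which rests here on the
    unimodularity of the trace form.

    Digits stand in for Krasner's lemma: at the uniformizer, the derivative of the Eisenstein
    polynomial has at most the valuation of p^(d+1), even under wild ramification, and this keeps
    Newton's approximations in one fixed number field. *)

Lemma Aint_integralP (x : algC) : x \in Aint <-> integralOver (intr : int -> algC) x.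
Proof.
split=> [Ax | [p mon_p px0]].
  have /floorpP[q Dq]: minCpoly x \is a polyOver Num.int by [].
  exists q; last by rewrite -Dq root_minCpoly.
  have := minCpoly_monic x; rewrite Dq !monicE lead_coef_map_inj //; last exact: intr_inj.
  by rewrite -(rmorph1 (intr : {rmorphism int -> algC})) => /eqP/intr_inj->.
apply: root_monic_Aint px0 _ _; first exact: monic_map.
by apply/polyOverP=> i; rewrite coef_map /= intr_int.
Qed.

Lemma root_monic_polyOver_Aint (p : {poly algC}) x :
  p \is monic -> p \is a polyOver Aint -> root p x -> x \in Aint.
Proof.
move=> mon_p /allP Ap px0; apply/Aint_integralP/(integral_root_monic mon_p px0).
by move=> y /Ap /= /Aint_integralP.
Qed.

(** With c the leading coefficient and n + 1 the degree of [f], c x is a root of [g] = c^n f(X / c),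
    which is monic with integral coefficients. *)
Lemma Aint_lead_coef_root (f : {poly algC}) x :
  f \is a polyOver Aint -> root f x -> lead_coef f * x \in Aint.
Proof.
move=> /polyOverP Af fx0; set c := lead_coef f.
have [f0 | nz_f] := eqVneq f 0; first by rewrite /c f0 lead_coef0 mul0r.
have sz_f : (1 < size f)%N by apply: root_size_gt1 fx0.
set n := (size f).-2; have Dn : size f = n.+2 by rewrite /n; case: (size f) sz_f => [|[|]].
pose h := \poly_(i < n.+1) (f`_i * c ^+ (n - i)); pose g : {poly algC} := 'X^(n.+1) + h.
have sz_g : (size h < size ('X^(n.+1) : {poly algC})%R)%N.
  by rewrite size_polyXn ltnS size_poly.
apply: (@root_monic_polyOver_Aint g).
- by rewrite monicE lead_coefDl // lead_coefXn.
- rewrite rpredD //; first by apply/polyOverP=> i; rewrite coefXn; case: eqP.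
  by apply/polyOverP=> i; rewrite coef_poly; case: ifP; rewrite // rpredM ?rpredX // /c lead_coefE.
have ->: root g (c * x) = (c ^+ n * f.[x] == 0).
  rewrite /root hornerD hornerXn horner_poly (horner_coef f) Dn.
  congr (_ == _); rewrite [in RHS]big_ord_recr /= mulrDr addrC; congr (_ + _).
    rewrite mulr_sumr; apply: eq_bigr => i _.
    have -> : c ^+ n = c ^+ (n - i) * c ^+ i by rewrite -exprD subnK // -ltnS.
    rewrite exprMn; ring.
  have -> : f`_n.+1 = c by rewrite /c lead_coefE Dn.
  by rewrite exprMn exprS; ring.
by rewrite (rootP fx0) mulr0.
Qed.

(** Although [x] need not be integral, c x is, with c the leading coefficient. Removing the term c
    X^m from [q] turns [f] into f - c X^(m+1) + c x X^m, which is still integral, whence an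
    induction on the size of [q]. *)
Lemma polyOver_Aint_factor (f q : {poly algC}) x :
  f = q * ('X - x%:P) -> f \is a polyOver Aint -> q \is a polyOver Aint.
Proof.
have [n] := ubnP (size q); elim: n => // n IHn in f q *; rewrite ltnS => sz_q Df Af.
have [-> | nz_q] := eqVneq q 0; first exact: rpred0.
set c := lead_coef q; set m := (size q).-1.
have Dm : size q = m.+1 by rewrite prednK // size_poly_gt0.
have lf : lead_coef f = c by rewrite Df lead_coef_Mmonic ?monicXsubC.
have cA : c \in Aint by rewrite -lf lead_coefE (polyOverP Af).
have cxA : c * x \in Aint.
  by rewrite -lf Aint_lead_coef_root // Df rootM root_XsubC eqxx orbT.
pose q1 : {poly algC} := q - c *: 'X^m.
have -> : q = q1 + c *: 'X^m by rewrite subrK.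
have AXm : 'X^m \is a polyOver Aint by rewrite rpredX ?polyOverX.
have AZ (a : algC) (h : {poly algC}) : a \in Aint -> h \is a polyOver Aint -> a *: h \is a polyOver Aint.
  by move=> Aa /polyOverP Ah; apply/polyOverP=> i; rewrite coefZ rpredM.
rewrite rpredD ?AZ //.
apply: (IHn (f - c *: 'X^(m.+1) + (c * x) *: 'X^m)) => //.
- apply: leq_trans sz_q; rewrite Dm ltnS; apply/leq_sizeP=> i.
  rewrite leq_eqVlt coefB coefZ coefXn => /orP[/eqP<- | lt_m_i].
    by rewrite eqxx mulr1 /c lead_coefE Dm subrr.
  by rewrite gtn_eqF // mulr0 subr0 nth_default // Dm.
- rewrite Df /q1 exprS -!mul_polyC polyCM; ring.
- by rewrite rpredD ?rpredB ?AZ // rpredX ?polyOverX.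
Qed.

(** The roots in [t] are divided out one at a time; what remains has the desired product as constant
    coefficient, up to sign. This controls the denominator of any subfamily of conjugates, in
    particular of those that are not integral at a given prime. *)
Lemma Aint_lead_coef_prod (c : algC) (s t : seq algC) :
  c *: \prod_(z <- s ++ t) ('X - z%:P) \is a polyOver Aint ->
  c * \prod_(z <- s) z \in Aint.
Proof.
elim: t => [|z t IHt] Af; last first.
  apply: IHt; apply: (polyOver_Aint_factor (x := z)) Af.
  by rewrite !big_cat /= big_cons -!mul_polyC; ring.
rewrite cats0 in Af; have /polyOverP/(_ 0%N) := Af.
rewrite coefZ -horner_coef0 horner_prod.
have -> : \prod_(z <- s) ('X - z%:P).[0] = (-1) ^+ size s * \prod_(z <- s) z.
  elim: s {Af} => [|z s IHs]; first by rewrite !big_nil mulr1.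
  by rewrite !big_cons IHs !hornerE /= exprS; ring.
by rewrite mulrCA -signr_odd; case: odd; rewrite ?expr0 ?mul1r // expr1 mulN1r rpredN.
Qed.

(** * Prime ideals of the ring of algebraic integers and their valuation rings *)

Section SubfieldTheory.
Variables (F : algC -> Prop) (sfF : is_subfield F).

Lemma subfield0 : F 0. Proof. by case: sfF. Qed.
Lemma subfield1 : F 1. Proof. by case: sfF. Qed.
Lemma subfieldB x y : F x -> F y -> F (x - y). Proof. by case: sfF => _ _ FB _ _; apply: FB. Qed.
Lemma subfieldN x : F x -> F (- x).
Proof. by rewrite -sub0r; apply: subfieldB; apply: subfield0. Qed.
Lemma subfieldD x y : F x -> F y -> F (x + y).
Proof. by move=> Fx Fy; rewrite -[y]opprK; apply/subfieldB/subfieldN. Qed.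
Lemma subfieldM x y : F x -> F y -> F (x * y). Proof. by case: sfF => _ _ _ FM _; apply: FM. Qed.
Lemma subfieldV x : F x -> F x^-1. Proof. by case: sfF => _ _ _ _ FV; apply: FV. Qed.
Lemma subfield_div x y : F x -> F y -> F (x / y).
Proof. by move=> Fx Fy; apply/subfieldM/subfieldV. Qed.
Lemma subfieldX x n : F x -> F (x ^+ n).
Proof. by move=> Fx; elim: n => [|n IHn]; rewrite ?exprS; [apply: subfield1 | apply: subfieldM]. Qed.
Lemma subfield_sum (I : Type) (r : seq I) (Q : pred I) (f : I -> algC) :
  (forall i, Q i -> F (f i)) -> F (\sum_(i <- r | Q i) f i).
Proof. move=> Ff; apply: big_ind => //; [exact: subfield0 | exact: subfieldD]. Qed.
Lemma subfield_nat n : F n%:R.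
Proof. by elim: n => [|n IHn]; rewrite ?mulrSr; [apply: subfield0 | apply/subfieldD/subfield1]. Qed.
Lemma subfield_int (n : int) : F n%:~R.
Proof. by case: n => n; [|rewrite NegzE mulrNz; apply: subfieldN]; apply: subfield_nat. Qed.
Lemma subfield_rat (q : rat) : F (ratr q).
Proof. by apply: subfield_div; apply: subfield_int. Qed.

End SubfieldTheory.

Lemma subfield_algC : is_subfield (fun=> True). Proof. by split. Qed.

(** Primes of the ring of all algebraic integers: each of them restricts to every number field and
    is moved by every automorphism of [algC]. The zero ideal is allowed here and excluded later by
    [P p%:R]. *)
Record prime_ideal (P : algC -> Prop) : Prop := PrimeIdeal {
  prime_ideal_Aint : forall x, P x -> x \in Aint;
  prime_ideal0 : P 0;
  prime_idealD : forall x y, P x -> P y -> P (x + y);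
  prime_idealM : forall a x, a \in Aint -> P x -> P (a * x);
  prime_ideal1 : ~ P 1;
  prime_ideal_prime : forall x y, x \in Aint -> y \in Aint -> P (x * y) -> P x \/ P y
}.

Definition in_ideal (S : algC -> Prop) (z : algC) : Prop :=
  exists2 s : seq (algC * algC),
    (forall u, u \in s -> u.1 \in Aint /\ S u.2) & z = \sum_(u <- s) u.1 * u.2.

Section Ideal.
Variable S : algC -> Prop.

Lemma in_idealD x y : in_ideal S x -> in_ideal S y -> in_ideal S (x + y).
Proof.
move=> [s Ps ->] [t Pt ->]; exists (s ++ t); last by rewrite big_cat.
by move=> u; rewrite mem_cat => /orP[/Ps | /Pt].
Qed.

Lemma in_idealM a x : a \in Aint -> in_ideal S x -> in_ideal S (a * x).
Proof.
move=> Aa [s Ps ->]; exists [seq (a * u.1, u.2) | u <- s].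
  by move=> _ /mapP[u /Ps[Au Su] ->]; rewrite rpredM.
by rewrite big_map mulr_sumr; apply: eq_bigr => u _; rewrite mulrA.
Qed.

Lemma in_ideal0 : in_ideal S 0.
Proof. by exists [::]; rewrite ?big_nil. Qed.

Lemma in_ideal_gen x : S x -> in_ideal S x.
Proof.
move=> Sx; exists [:: (1, x)]; last by rewrite big_seq1 mul1r.
by move=> u; rewrite inE => /eqP->.
Qed.

Lemma in_idealS (T : algC -> Prop) x : (forall y, S y -> T y) -> in_ideal S x -> in_ideal T x.
Proof. by move=> sST [s Ps ->]; exists s => // u /Ps[? /sST]. Qed.

Lemma in_ideal_Aint x : (forall y, S y -> y \in Aint) -> in_ideal S x -> x \in Aint.
Proof.
by move=> AS [s Ps ->]; rewrite big_seq rpred_sum // => u /Ps[Au /AS]; apply: rpredM.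
Qed.

Lemma in_ideal_split (T : algC -> Prop) x z :
    (forall y, T y -> y = x \/ S y) -> in_ideal T z ->
  exists a u, [/\ a \in Aint, in_ideal S u & z = a * x + u].
Proof.
move=> sT [s Ps ->]; elim: s Ps => [|[b y] s IHs] Ps.
  by exists 0, 0; rewrite big_nil mul0r addr0; split=> //; apply: in_ideal0.
have [u us | a [u [Aa Iu Du]]] := IHs; first by apply: Ps; rewrite inE us orbT.
have [/= Ab /sT] := Ps _ (mem_head _ _); rewrite big_cons Du /= => -[-> | Sy].
  by exists (b + a), u; rewrite rpredD // mulrDl addrA.
exists a, (b * y + u); split=> //; last by rewrite addrCA.
by apply/in_idealD/Iu/in_idealM/in_ideal_gen.
Qed.

End Ideal.

Lemma prime_ideal_exists (S : algC -> Prop) :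
    (forall x, S x -> x \in Aint) -> ~ in_ideal S 1 ->
  exists2 P, prime_ideal P & forall x, S x -> P x.
Proof.
move=> AS S'1.
pose good (A : set algC) := (forall x, A x -> x \in Aint) /\ ~ in_ideal (fun x => A x \/ S x) 1.
have [| A [[AA A'1] maxA]] := @Zorn_bigcup algC good.
  move=> F goodF totF; split=> [x [X FX Xx] | [s Ps D1]]; first by case: (goodF X FX) => /(_ x Xx).
  (* The expression of 1 involves finitely many elements, hence a single member [X] of the chain;
     the empty [X] covers the case where none of them comes from the chain. *)
  have [X FX XP] : exists2 X : set algC, F X \/ (forall x, ~ X x) &
     forall u, u \in s -> u.1 \in Aint /\ (X u.2 \/ S u.2).
    elim: {D1} s Ps => [|v s IHs] Ps; first by exists (fun=> False); [right => x [] |].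
    have [u us | X FX XP] := IHs; first by apply: Ps; rewrite inE us orbT.
    have [Av [[Y FY Yv] | Sv]] := Ps _ (mem_head _ _); last first.
      by exists X => // u; rewrite inE => /predU1P[-> | /XP] //; split=> //; right.
    case: FX => [FX | X0]; last first.
      exists Y; first by left.
      move=> u; rewrite inE => /predU1P[-> | /XP[Au [/X0|]]] //; first by split=> //; left.
      by split=> //; right.
    have [sXY | sYX] := totF X Y FX FY; [exists Y | exists X]; first by left.
    - move=> u; rewrite inE => /predU1P[-> | /XP[Au [/sXY|]]]; first by split=> //; left.
        by split=> //; left.
      by split=> //; right.
    - by left.
    - by move=> u; rewrite inE => /predU1P[-> | /XP] //; split=> //; left; apply: sYX.
  have X1 : in_ideal (fun x => X x \/ S x) 1 by exists s.
  case: FX => [/goodF[_] | X0]; first by apply.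
  by apply/S'1/(in_idealS _ X1) => y [/X0|].
pose P := in_ideal (fun x => A x \/ S x).
have AP x : P x -> x \in Aint by apply: in_ideal_Aint => y [/AA | /AS].
have maxP x : x \in Aint -> ~ P x -> exists a u, [/\ a \in Aint, P u & 1 = a * x + u].
  move=> Ax P'x; pose B y := y = x \/ A y.
  have /maxA goodB : (A `<` B)%classic.
    split=> [y Ay | sBA]; first by right.
    by apply/P'x/in_ideal_gen; left; apply: sBA; left.
  have /contrapT B1: ~ ~ in_ideal (fun y => B y \/ S y) 1.
    by move=> B'1; apply: goodB; split=> // y [-> // | /AA].
  by apply: in_ideal_split B1 => y [[-> | Ay] | Sy]; [left | right; left | right; right].
exists P; last by move=> x Sx; apply: in_ideal_gen; right.
split=> //; [exact: in_ideal0 | exact: in_idealD | exact: in_idealM |].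
move=> x y Ax Ay Pxy; have [Px | P'x] := pselect (P x); first by left.
have [Py | P'y] := pselect (P y); first by right.
have [[a [u [Aa Pu Du]]] [b [v [Ab Pv Dv]]]] := (maxP x Ax P'x, maxP y Ay P'y).
case: A'1; have -> : 1 = (a * b) * (x * y) + ((b * y + v) * u + (a * x) * v).
  transitivity ((a * x + u) * (b * y + v)); [by rewrite -Du -Dv mulr1 | ring].
have PM c z : c \in Aint -> P z -> P (c * z) by exact: in_idealM.
have PD z w : P z -> P w -> P (z + w) by exact: in_idealD.
by apply/PD; last apply/PD; apply/PM; rewrite // ?rpredM // -Dv.
Qed.

Lemma zcontents_in_ideal (P : algC -> Prop) (f : {poly int}) :
  prime_ideal P -> (forall i, P (f`_i)%:~R) -> P (zcontents f)%:~R.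
Proof.
move=> prP Pf; have PM n x : P x -> P (n%:~R * x).
  by apply: prime_idealM; rewrite ?Aint_int.
rewrite /zcontents intrM; apply/PM.
apply: (big_ind (fun n : nat => P (n%:Z)%:~R)) => [|x y Px Py|i _].
- exact: prime_ideal0.
- have [u [v]] := Bezoutz x y; rewrite /gcdz !absz_nat => <-.
  by rewrite intrD !intrM; apply: prime_idealD => //; apply/PM.
- by rewrite abszE normrEsign intrM; apply/PM; apply: Pf.
Qed.

(* With g the primitive integral multiple of the minimal polynomial of [x] and
   q = g / (X - x), some coefficient of g = X q - x q is outside [P], hence so
   is one of [q`_j] and [q`_j * x] for some j. *)
Lemma prime_ideal_fraction (P F : algC -> Prop) (x : algC) :
    prime_ideal P -> is_subfield F -> F x ->
  exists a b, [/\ F a /\ a \in Aint, F b /\ b \in Aint, a = b * x & ~ (P a /\ P b)].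
Proof.
move=> prP sfF Fx.
have [g0 nz_g0 g0x] : exists2 g : {poly int}, g != 0 & root (map_poly intr g) x.
  have [q [Dq mon_q] _] := minCpolyP x.
  have [g [c nz_c Dg]] := rat_poly_scale q; exists g.
    by apply: contraTneq mon_q => g0; rewrite Dg g0 rmorph0 scaler0 monicE lead_coef0 eq_sym oner_eq0.
  have := root_minCpoly x; rewrite Dq Dg map_polyZ rootZ ?fmorph_eq0 ?invr_eq0 ?intr_eq0 //=.
  by rewrite -map_poly_comp; congr (root _ _); apply: eq_map_poly => b; rewrite /= rmorph_int.
pose g := zprimitive g0; pose f : {poly algC} := map_poly intr g.
have fx : root f x.
  move: g0x; rewrite [g0]zpolyEprim map_polyZ rootZ //.
  by rewrite intr_eq0 zcontents_eq0.
have [i P'fi] : exists i, ~ P f`_i.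
  apply/existsNP => Pf; apply: (prime_ideal1 prP).
  have -> : 1 = (zcontents g)%:~R :> algC by rewrite zcontents_primitive nz_g0.
  by apply: zcontents_in_ideal => // i; have:= Pf i; rewrite coef_map.
have Af : f \is a polyOver Aint by apply/polyOverP=> j; rewrite coef_map /= Aint_int.
have [q Df] := factor_theorem _ _ fx.
have /polyOverP Aq := polyOver_Aint_factor Df Af.
have fE j : f`_j.+1 = q`_j - q`_j.+1 * x by rewrite Df mulrBr coefB coefMX coefMC.
have f0E : f`_0 = - (q`_0 * x) by rewrite Df mulrBr coefB coefMX coefMC sub0r.
have Fq j : F q`_j.
  have [k] := ubnP (size q - j); elim: k j => // k IHk j; rewrite ltnS => le_k.
  have [le_q_j | lt_j_q] := leqP (size q) j.
    by rewrite nth_default //; apply: subfield0.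
  have -> : q`_j = f`_j.+1 + q`_j.+1 * x by rewrite fE subrK.
  apply/(subfieldD sfF)/(subfieldM sfF) => //; last by apply: IHk; lia.
  by rewrite coef_map; apply: subfield_int.
have Aqx j : q`_j * x \in Aint.
  case: j => [|j]; first by rewrite -rpredN -f0E (polyOverP Af).
  by rewrite -rpredN -(rpredDl _ (Aq j)) -fE (polyOverP Af).
have PN := prime_idealM prP (a := -1).
have [j P'j] : exists j, ~ (P (q`_j * x) /\ P q`_j).
  apply/existsNP => Pq; apply: P'fi; case: i => [|i].
    by rewrite f0E -mulN1r; apply/PN; [rewrite rpredN | case: (Pq 0%N)].
  rewrite fE -mulN1r; apply: (prime_idealD prP); first by case: (Pq i).
  by apply/PN; [rewrite rpredN | case: (Pq i.+1)].
by exists (q`_j * x), q`_j; split=> //; split=> //; apply: subfieldM.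
Qed.

(** The localization at [P], a valuation ring of [algC] by [vO_total], with maximal ideal [vM P].
    For c nonzero, [vO P (x / c)] is the divisibility of x by c at [P], and [vO P ((x - y) / c)] a
    congruence modulo c. *)
Definition vO (P : algC -> Prop) (x : algC) : Prop :=
  exists a b, [/\ a \in Aint, b \in Aint, ~ P b & x = a / b].

Definition vM (P : algC -> Prop) (x : algC) : Prop :=
  exists a b, [/\ P a, b \in Aint, ~ P b & x = a / b].

Section ValuationRing.
Variables (P : algC -> Prop) (prP : prime_ideal P).

Lemma prime_ideal_neq0 b : ~ P b -> b != 0.
Proof. by move=> P'b; apply/eqP=> b0; case: P'b; rewrite b0; apply: (prime_ideal0 prP). Qed.

Lemma prime_idealN x : P x -> P (- x).
Proof. by rewrite -mulN1r; apply: (prime_idealM prP); rewrite ?rpredN. Qed.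

Lemma prime_idealB x y : P x -> P y -> P (x - y).
Proof. by move=> Px Py; apply: (prime_idealD prP) => //; apply: prime_idealN. Qed.

Lemma prime_idealMr x a : a \in Aint -> P x -> P (x * a).
Proof. by rewrite mulrC; apply: (prime_idealM prP). Qed.

Lemma prime_ideal'M a b : a \in Aint -> b \in Aint -> ~ P a -> ~ P b -> ~ P (a * b).
Proof. by move=> Aa Ab P'a P'b /(prime_ideal_prime prP Aa Ab)[]. Qed.

Lemma prime_ideal_root x n : x \in Aint -> P (x ^+ n) -> P x.
Proof.
move=> Ax; elim: n => [/(prime_ideal1 prP) // | n IHn].
by rewrite exprS => /(prime_ideal_prime prP)[] //; rewrite rpredX.
Qed.

Lemma vO_Aint x : x \in Aint -> vO P x.
Proof. by exists x, 1; split=> //; [exact: (prime_ideal1 prP) | rewrite divr1]. Qed.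

Lemma vO0 : vO P 0. Proof. exact: vO_Aint. Qed.
Lemma vO1 : vO P 1. Proof. exact: vO_Aint. Qed.
Lemma vO_nat n : vO P n%:R. Proof. by apply/vO_Aint/rpred_nat. Qed.
Lemma vO_int n : vO P n%:~R. Proof. by apply/vO_Aint/Aint_int. Qed.

Lemma vOD x y : vO P x -> vO P y -> vO P (x + y).
Proof.
move=> [a [b [Aa Ab P'b ->]]] [c [d [Ac Ad P'd ->]]].
exists (a * d + c * b), (b * d); rewrite rpredD ?rpredM //; split=> //.
  exact: prime_ideal'M.
by rewrite addf_div ?prime_ideal_neq0.
Qed.

Lemma vOM x y : vO P x -> vO P y -> vO P (x * y).
Proof.
move=> [a [b [Aa Ab P'b ->]]] [c [d [Ac Ad P'd ->]]].
exists (a * c), (b * d); rewrite !rpredM //; split=> //; first exact: prime_ideal'M.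
by rewrite mulf_div.
Qed.

Lemma vON x : vO P x -> vO P (- x).
Proof. by rewrite -mulN1r; apply/vOM/vO_Aint; rewrite rpredN. Qed.

Lemma vOB x y : vO P x -> vO P y -> vO P (x - y).
Proof. by move=> Ox Oy; apply/vOD/vON. Qed.

Lemma vOX x n : vO P x -> vO P (x ^+ n).
Proof. by move=> Ox; elim: n => [|n IHn]; rewrite ?exprS; [apply: vO1 | apply: vOM]. Qed.

Lemma vO_sum (I : Type) (r : seq I) (Q : pred I) (f : I -> algC) :
  (forall i, Q i -> vO P (f i)) -> vO P (\sum_(i <- r | Q i) f i).
Proof. move=> Of; apply: big_ind => //; [exact: vO0 | exact: vOD]. Qed.

Lemma vO_prod (I : Type) (r : seq I) (Q : pred I) (f : I -> algC) :
  (forall i, Q i -> vO P (f i)) -> vO P (\prod_(i <- r | Q i) f i).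
Proof. move=> Of; apply: big_ind => //; [exact: vO1 | exact: vOM]. Qed.

Lemma vM_O x : vM P x -> vO P x.
Proof. by move=> [a [b [/(prime_ideal_Aint prP)]]]; exists a, b. Qed.

Lemma vM_ideal x : P x -> vM P x.
Proof. by exists x, 1; split=> //; [exact: (prime_ideal1 prP) | rewrite divr1]. Qed.

Lemma vM0 : vM P 0. Proof. exact/vM_ideal/(prime_ideal0 prP). Qed.

Lemma vMD x y : vM P x -> vM P y -> vM P (x + y).
Proof.
move=> [a [b [Pa Ab P'b ->]]] [c [d [Pc Ad P'd ->]]].
exists (a * d + c * b), (b * d); rewrite rpredM //; split=> //.
- by apply: (prime_idealD prP) => //; apply: prime_idealMr.
- exact: prime_ideal'M.
by rewrite addf_div ?prime_ideal_neq0.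
Qed.

Lemma vMMl x y : vO P x -> vM P y -> vM P (x * y).
Proof.
move=> [a [b [Aa Ab P'b ->]]] [c [d [Pc Ad P'd ->]]].
exists (a * c), (b * d); rewrite rpredM //; split=> //.
- exact: (prime_idealM prP).
- exact: prime_ideal'M.
by rewrite mulf_div.
Qed.

Lemma vMMr x y : vM P x -> vO P y -> vM P (x * y).
Proof. by move=> *; rewrite mulrC; apply: vMMl. Qed.

Lemma vMN x : vM P x -> vM P (- x).
Proof. by rewrite -mulN1r; apply/vMMl/vO_Aint; rewrite rpredN. Qed.

Lemma vMB x y : vM P x -> vM P y -> vM P (x - y).
Proof. by move=> Ox Oy; apply/vMD/vMN. Qed.

Lemma vM_sum (I : Type) (r : seq I) (Q : pred I) (f : I -> algC) :
  (forall i, Q i -> vM P (f i)) -> vM P (\sum_(i <- r | Q i) f i).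
Proof. move=> Of; apply: big_ind => //; [exact: vM0 | exact: vMD]. Qed.

Lemma vM_Aint x : vM P x -> x \in Aint -> P x.
Proof.
move=> [a [b [Pa Ab P'b Dx]]] Ax.
have: P (x * b) by rewrite Dx divfK // prime_ideal_neq0.
by case/(prime_ideal_prime prP).
Qed.

Lemma vM1 : ~ vM P 1.
Proof. by move=> /vM_Aint P1; apply: (prime_ideal1 prP); apply: P1. Qed.

Lemma vMX x n : (0 < n)%N -> vM P x -> vM P (x ^+ n).
Proof.
case: n => // n _ Mx; elim: n => [|n IHn]; rewrite // exprS.
by apply/vMMl/IHn/vM_O.
Qed.

Lemma vM_neq0 x : ~ vM P x -> x != 0.
Proof. by move=> M'x; apply/eqP=> x0; apply: M'x; rewrite x0; apply: vM0. Qed.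

Lemma vO_total x : vO P x \/ vM P x^-1.
Proof.
have [a [b [[_ Aa] [_ Ab] Dab P'ab]]] := prime_ideal_fraction (x := x) prP subfield_algC I.
have [Pb | P'b] := pselect (P b).
  have P'a : ~ P a by move=> Pa; apply: P'ab.
  right; exists b, a; split=> //; rewrite Dab invfM mulVKf //.
  by apply: contraTneq (prime_ideal_neq0 P'a) => b0; rewrite Dab b0 mul0r eqxx.
by left; exists a, b; split=> //; rewrite Dab mulrC mulKf ?prime_ideal_neq0.
Qed.

Lemma vO_unitV x : ~ vM P x -> vO P x^-1.
Proof. by case: (vO_total x^-1); rewrite ?invrK. Qed.

Lemma vM_V x : x != 0 -> vM P x -> ~ vO P x^-1.
Proof. by move=> nz_x Mx OxV; apply: vM1; rewrite -(mulfV nz_x); apply: vMMr. Qed.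

Lemma vM_prime x y : vM P (x * y) -> vM P x \/ vM P y.
Proof.
move=> Mxy; have [Mx | /[dup] M'x /vO_unitV OxV] := pselect (vM P x); [by left | right].
by rewrite -(mulKf (vM_neq0 M'x) y); apply: vMMl.
Qed.

Lemma vM_rootX x n : vM P (x ^+ n) -> vM P x.
Proof. by elim: n => [/vM1 // | n IHn]; rewrite exprS => /vM_prime[]. Qed.

Lemma vM_prod_seq (I : eqType) (r : seq I) (f : I -> algC) :
  vM P (\prod_(i <- r) f i) -> exists2 i, i \in r & vM P (f i).
Proof.
elim: r => [|i r IHr]; first by rewrite big_nil => /vM1.
rewrite big_cons => /vM_prime[Mi | /IHr[j rj Mj]]; first by exists i; rewrite ?mem_head.
by exists j; rewrite // inE rj orbT.
Qed.

Lemma vO_rootX x n : (0 < n)%N -> vO P (x ^+ n) -> vO P x.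
Proof.
move=> n_gt0 Oxn; have [-> | nz_x] := eqVneq x 0; first exact: vO0.
have [// | /(vMX n_gt0) Mx] := vO_total x.
by case: vM1; rewrite -(mulVf (expf_neq0 n nz_x)) -exprVn; apply: vMMr.
Qed.

Lemma vO_fraction (F : algC -> Prop) x : is_subfield F -> F x -> vO P x ->
  exists a b, [/\ F a /\ a \in Aint, F b /\ b \in Aint, ~ P b & x = a / b].
Proof.
move=> sfF Fx Ox; have [a [b [Fa Fb Dab P'ab]]] := prime_ideal_fraction prP sfF Fx.
have P'b : ~ P b.
  move=> Pb; apply: P'ab; split=> //; apply: vM_Aint; last by case: Fa.
  by rewrite Dab mulrC; apply/vMMl/vM_ideal.
by exists a, b; split=> //; rewrite Dab mulrC mulKf ?prime_ideal_neq0.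
Qed.

Lemma vO_div_trans (a b c : algC) : b != 0 -> vO P (a / b) -> vO P (b / c) -> vO P (a / c).
Proof. by move=> nz_b Oab Obc; have -> : a / c = (a / b) * (b / c); [rewrite mulrA divfK | apply: vOM]. Qed.

Lemma vO_divM a b c d : vO P (a / c) -> vO P (b / d) -> vO P ((a * b) / (c * d)).
Proof. by move=> Oac Obd; rewrite -mulf_div; apply: vOM. Qed.

Lemma vO_divD a b c : vO P (a / c) -> vO P (b / c) -> vO P ((a + b) / c).
Proof. by move=> Oac Obc; rewrite mulrDl; apply: vOD. Qed.

Lemma vO_divB a b c : vO P (a / c) -> vO P (b / c) -> vO P ((a - b) / c).
Proof. by move=> Oac Obc; rewrite mulrBl; apply: vOB. Qed.

Lemma vO_divMl a b c : vO P a -> vO P (b / c) -> vO P ((a * b) / c).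
Proof. by move=> Oa Obc; rewrite -mulrA; apply: vOM. Qed.

End ValuationRing.

Section Comap.
Variables (P : algC -> Prop) (prP : prime_ideal P) (s : {rmorphism algC -> algC}).

Lemma prime_ideal_comap : prime_ideal (fun x => P (s x)).
Proof.
split=> [x | | x y | a x | | x y]; rewrite ?rmorph0 ?rmorph1 ?rmorphD ?rmorphM /=.
- by move/(prime_ideal_Aint prP); rewrite Aint_aut.
- exact: (prime_ideal0 prP).
- exact: (prime_idealD prP).
- by rewrite -(Aint_aut s a); apply: (prime_idealM prP).
- exact: (prime_ideal1 prP).
- by rewrite -(Aint_aut s x) -(Aint_aut s y); apply: (prime_ideal_prime prP).
Qed.

Lemma vO_comap x : vO (fun x => P (s x)) x -> vO P (s x).
Proof.
by move=> [a [b [Aa Ab P'b ->]]]; exists (s a), (s b); rewrite fmorph_div !Aint_aut.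
Qed.

End Comap.

(** Remainders modulo a monic integral polynomial of degree n form finitely many classes modulo the
    integer, so two powers of [a] agree. This is behind both the finite order of residues and the
    rank one property of the valuation. *)
Lemma Aint_pow_congruence (a : algC) (N : nat) : a \in Aint -> (0 < N)%N ->
  exists i j, (i < j)%N /\ (a ^+ j - a ^+ i) / N%:R \in Aint.
Proof.
case: N => // N Aa _.
have /floorpP[f Df]: minCpoly a \is a polyOver Num.int by [].
have mon_f : f \is monic.
  have := minCpoly_monic a; rewrite Df !monicE lead_coef_map_inj //; last exact: intr_inj.
  by rewrite -(rmorph1 (intr : {rmorphism int -> algC})) => /eqP/intr_inj->.
pose n := (size f).-1; pose r k := Pdiv.CommonRing.rmodp 'X^k f.
have sz_r k : (size (r k) <= n)%N.
  by rewrite -ltnS prednK ?Pdiv.CommonRing.ltn_rmodp ?monic_neq0 // size_poly_gt0 monic_neq0.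
have rE k : a ^+ k = (map_poly intr (r k)).[a].
  have := Pdiv.RingMonic.rdivp_eq mon_f 'X^k; rewrite -/(r k) => /(congr1 (fun q => (map_poly intr q).[a])).
  rewrite map_polyXn hornerXn => ->.
  by rewrite rmorphD rmorphM /= -Df hornerD hornerM (rootP (root_minCpoly a)) mulr0 add0r.
pose h (k : 'I_(N.+1 ^ n).+1) := [ffun t : 'I_n => inord `|((r k)`_t %% N.+1)%Z|%N : 'I_N.+1].
have /injectivePn[i [j ne_ij hij]] : ~~ injectiveb h.
  apply/negP=> /injectiveP/leq_card; rewrite card_ffun !card_ord; lia.
wlog lt_ij : i j ne_ij hij / (i < j)%N.
  by move=> IH; case: (ltngtP i j) => [|/(IH j i)|/ord_inj/eqP]; [exact: IH | rewrite eq_sym; exact | rewrite (negPf ne_ij)].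
exists i, j; split=> //.
rewrite !rE -hornerN -hornerD -rmorphB /= (horner_coef_wide a (n := n)); last first.
  rewrite size_map_inj_poly ?rmorph0 //; last exact: intr_inj.
  by rewrite (leq_trans (size_polyD _ _)) // size_polyN geq_max !sz_r.
rewrite mulr_suml rpred_sum // => t _.
suffices /dvdzP[q Dq] : (N.+1 %| (r j - r i)`_t)%Z.
  rewrite coef_map /= Dq intrM [X in X / _]mulrAC mulfK ?pnatr_eq0 //.
  by rewrite rpredM ?Aint_int ?rpredX.
rewrite coefB -eqz_mod_dvd eqz_mod_dvd -eqz_mod_dvd.
have /ffunP/(_ t) := hij; rewrite !ffunE => /(congr1 val) /=.
have lt_mod k : (`|((r k)`_t %% N.+1)%Z|%N < N.+1)%N.
  by rewrite -ltz_nat gez0_abs ?modz_ge0 // ltz_pmod.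
rewrite !inordK // => /(congr1 Posz); rewrite !gez0_abs ?modz_ge0 // => /esym eq_r.
by rewrite eqz_mod_dvd -eqz_mod_dvd; apply/eqP.
Qed.

Lemma Aint_nat_multiple (b : algC) : b \in Aint -> b != 0 ->
  exists c n, [/\ c \in Aint, (0 < n)%N & c * b = n%:R].
Proof.
move=> Ab nz_b.
have /floorpP[f Df]: minCpoly b \is a polyOver Num.int by [].
have nz_f : f != 0 by apply: contraTneq (minCpoly_monic b) => f0; rewrite Df f0 rmorph0 monicE lead_coef0 eq_sym oner_eq0.
have [m [g nz_g0 Dg]] := multiplicity_XsubC f 0.
rewrite nz_f /= in nz_g0.
have gb : root (map_poly intr g) b.
  have := root_minCpoly b; rewrite Df Dg rmorphM rmorphXn /= map_polyXsubC rootM.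
  case/orP=> //; rewrite polyC0 subr0 /root hornerXn expf_eq0 (negPf nz_b) andbF //.
have [q Dq] := factor_theorem _ _ gb.
have Ag : map_poly intr g \is a polyOver Aint by apply/polyOverP=> i; rewrite coef_map Aint_int.
have /polyOverP Aq := polyOver_Aint_factor Dq Ag.
have Dg0 : (g`_0)%:~R = - (q`_0 * b).
  by rewrite -(coef_map (intr : {rmorphism int -> algC})) /= Dq mulrBr coefB coefMX coefMC sub0r.
exists (- (sgz g`_0)%:~R * q`_0), (absz g`_0); split.
- by rewrite rpredM ?rpredN ?Aint_int.
- by rewrite absz_gt0 -horner_coef0.
rewrite -mulrA mulNr -mulrN -Dg0 -intrM -[RHS]/((absz g`_0)%:~R).
by rewrite abszEsg.
Qed.

Section ResidueChar.
Variables (P : algC -> Prop) (prP : prime_ideal P) (p : nat).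
Hypotheses (pr_p : prime p) (Pp : P p%:R).

Lemma prime_ideal_nat n : P n%:R <-> (p %| n)%N.
Proof.
split=> [Pn | /dvdnP[m ->]]; last by rewrite natrM; apply: (prime_idealM prP); rewrite ?rpred_nat.
apply: contraT; rewrite -prime_coprime // => /(coprimeP _ (prime_gt0 pr_p))[[u v] /= Duv].
case: (prime_ideal1 prP); rewrite -[1]/(1%:R) -Duv natrB; last by rewrite ltnW // -subn_gt0 Duv.
by rewrite !natrM; apply: (prime_idealB prP); apply: (prime_idealM prP); rewrite ?rpred_nat.
Qed.

Lemma vM_p : vM P p%:R. Proof. exact: vM_ideal. Qed.

Lemma p_neq0 : p%:R != 0 :> algC. Proof. by rewrite pnatr_eq0 -lt0n prime_gt0. Qed.

Lemma vM_nat n : vM P n%:R <-> (p %| n)%N.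
Proof.
by split=> [/vM_Aint Pn | /prime_ideal_nat/(vM_ideal prP)//]; apply/prime_ideal_nat/Pn; rewrite ?rpred_nat.
Qed.

Lemma vM_int (c : int) : vM P c%:~R <-> (p %| c)%Z.
Proof.
rewrite -[(p %| c)%Z]/(p %| `|c|)%N -vM_nat -[`|c|%N%:R]/(`|c|%N%:~R) abszE normrEsign intrM.
rewrite rmorphXn rmorphN rmorph1; case: (c < 0); rewrite ?expr0 ?mul1r // expr1 mulN1r.
by split=> /(vMN prP); rewrite ?opprK.
Qed.

Lemma residue_finite_order a : a \in Aint -> ~ P a -> exists2 t, (0 < t)%N & P (a ^+ t - 1).
Proof.
move=> Aa P'a; have [i [j [lt_ij Aij]]] := Aint_pow_congruence Aa (prime_gt0 pr_p).
exists (j - i)%N; first by rewrite subn_gt0.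
have: P (a ^+ i * (a ^+ (j - i) - 1)).
  rewrite mulrBr mulr1 -exprD subnKC ?(ltnW lt_ij) //.
  by rewrite -(divfK p_neq0 (_ - _)); apply: (prime_idealM prP).
case/(prime_ideal_prime prP) => //; rewrite ?rpredB ?rpredX //.
by move/(prime_ideal_root prP Aa).
Qed.

(** The valuation has rank one: p divides a^j - a^i = a^i (a^(j-i) - 1), where the second factor is
    a unit because [a] is in P. *)
Lemma vM_nilpotent_mod_p x : vM P x -> exists2 k, (0 < k)%N & vO P (x ^+ k / p%:R).
Proof.
move=> [a [b [Pa Ab P'b ->]]]; have Aa := prime_ideal_Aint prP Pa.
have [i [j [lt_ij Aij]]] := Aint_pow_congruence Aa (prime_gt0 pr_p).
exists i.+1 => //.
have vO_a : vO P (a ^+ i / p%:R).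
  have u1 : ~ vM P (a ^+ (j - i) - 1).
    move=> M1; apply: (vM1 prP); rewrite -(subKr (a ^+ (j - i)) 1).
    by apply: (vMB prP) => //; apply: (vMX prP); [rewrite subn_gt0 | apply: vM_ideal].
  have -> : a ^+ i / p%:R = (a ^+ (j - i) - 1)^-1 * ((a ^+ j - a ^+ i) / p%:R).
    have nz1 := vM_neq0 prP u1.
    have -> : a ^+ j - a ^+ i = (a ^+ (j - i) - 1) * a ^+ i.
      by rewrite mulrBl mul1r -exprD subnK // ltnW.
    by rewrite -mulrA mulKf.
  by apply: (vOM prP); [apply: vO_unitV | apply: vO_Aint].
rewrite expr_div_n exprS mulrAC -[a * _ / _]mulrA.
apply: (vOM prP); first by apply: (vOM prP) => //; apply: vO_Aint.
rewrite -exprVn; apply: (vOX prP); apply: (vO_unitV prP) => Mb.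
by apply: P'b; apply: (vM_Aint prP).
Qed.

Lemma vO_archimedean x : exists j, vO P (p%:R ^+ j * x).
Proof.
have [Ox | [c [d [Pc Ad P'd Dx]]]] := vO_total prP x; first by exists 0%N; rewrite mul1r.
have [x0 | nz_x] := eqVneq x 0; first by exists 0%N; rewrite x0 mulr0; apply: vO0.
have nz_c : c != 0.
  by apply: contraNneq nz_x => c0; rewrite -invr_eq0 Dx c0 mul0r.
have [b [n [Ab n_gt0 Db]]] := Aint_nat_multiple (prime_ideal_Aint prP Pc) nz_c.
have [m p'm Dn] := pfactor_coprime pr_p n_gt0.
have P'm : ~ P m%:R by move/prime_ideal_nat; apply/negP; rewrite -prime_coprime.
exists (logn p n); exists (d * b), m%:R; rewrite rpredM ?rpred_nat //; split=> //.
have nz_n : n%:R != 0 :> algC by rewrite pnatr_eq0 -lt0n.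
have -> : x = (d * b) / n%:R.
  have nz_b : b != 0 by apply: contraNneq nz_n => b0; rewrite -Db b0 mul0r.
  by rewrite -[x]invrK Dx invf_div -Db [b * c]mulrC -mulf_div divff // mulr1.
have -> : n%:R = m%:R * p%:R ^+ logn p n :> algC by rewrite {1}Dn natrM natrX.
by rewrite mulrCA invfM; congr (_ * _); rewrite mulrCA divff ?mulr1 // expf_neq0 ?p_neq0.
Qed.

Lemma vO_separated z : z != 0 -> exists j, ~ vO P (z / p%:R ^+ j).
Proof.
move=> nz_z; have [j Oj] := vO_archimedean z^-1; exists j.+1 => Ozj.
apply: (@vM_V P prP p%:R p_neq0 vM_p).
have -> : p%:R^-1 = (p%:R ^+ j * z^-1) * (z / p%:R ^+ j.+1); last exact: vOM.
by rewrite mulrA mulfVK // exprS invfM mulrCA divff ?mulr1 // expf_neq0 ?p_neq0.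
Qed.

End ResidueChar.

(** * Unramified extensions *)

Section Congruences.
Variables (P : algC -> Prop) (prP : prime_ideal P) (p : nat).
Hypotheses (pr_p : prime p) (Pp : P p%:R).

Lemma vO_expB_div x y c n : vO P x -> vO P y -> vO P ((x - y) / c) ->
  vO P ((x ^+ n - y ^+ n) / c).
Proof.
move=> Ox Oy Oxy; rewrite subrXX mulrAC; apply: (vOM prP) => //.
by apply: (vO_sum prP) => i _; apply: (vOM prP); apply: (vOX prP).
Qed.

(** The cofactor of x - y in x^p - y^p is congruent to p y^(p-1) modulo c, hence divisible by
    [pi]. *)
Lemma vO_expp_congr (pi c x y : algC) :
    c != 0 -> vO P (p%:R / pi) -> vO P (c / pi) -> vO P x -> vO P y ->
  vO P ((x - y) / c) -> vO P ((x ^+ p - y ^+ p) / (c * pi)).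
Proof.
move=> nz_c Op Oc Ox Oy Oxy; rewrite subrXX; apply: (vO_divM prP) => //.
have -> : \sum_(i < p) x ^+ (p.-1 - i) * y ^+ i =
    \sum_(i < p) y ^+ i * (x ^+ (p.-1 - i) - y ^+ (p.-1 - i)) + p%:R * y ^+ p.-1.
  rewrite -[p in p%:R]card_ord -sum1_card natr_sum mulr_suml -big_split /=.
  apply: eq_bigr => i _; rewrite mulrBr -exprD subnKC ?mul1r; first by rewrite subrK mulrC.
  by rewrite -ltnS prednK ?prime_gt0.
apply: (vO_divD prP); last by rewrite mulrAC; apply: (vOM prP) => //; apply: (vOX prP).
rewrite mulr_suml; apply: (vO_sum prP) => i _.
apply: (vO_divMl prP); first exact: (vOX prP).
by apply: (vO_div_trans prP nz_c) => //; apply: vO_expB_div.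
Qed.

Lemma vO_exp_ppow_congr (pi x y : algC) N :
    pi != 0 -> vO P (p%:R / pi) -> vO P pi -> vO P x -> vO P y ->
  vO P ((x - y) / pi) -> vO P ((x ^+ (p ^ N) - y ^+ (p ^ N)) / pi ^+ N.+1).
Proof.
move=> nz_pi Op Opi Ox Oy Oxy; elim: N => [|N IHN]; first by rewrite !expr1.
rewrite expnSr !exprM [pi ^+ _.+1]exprSr; apply: vO_expp_congr => //.
- by rewrite expf_neq0.
- by rewrite exprS mulrC mulKf //; apply: (vOX prP).
- exact: (vOX prP).
- exact: (vOX prP).
Qed.

Lemma vM_expp_sub1 u : vO P u -> vM P (u ^+ p - 1) -> vM P (u - 1).
Proof.
move=> Ou Mu; apply: (vM_rootX prP (n := p)); set v := u - 1.
have Ov : vO P v by apply: vOB => //; apply: vO1.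
have key q : (v + 1) ^+ q.+1 = 1 + \sum_(i < q) v ^+ i.+1 *+ 'C(q.+1, i.+1) + v ^+ q.+1.
  rewrite exprD1n big_ord_recl big_ord_recr /= expr0 bin0 /bump /= add1n binn.
  by rewrite !mulr1n addrA.
have -> : v ^+ p = u ^+ p - 1 - \sum_(i < p.-1) v ^+ i.+1 *+ 'C(p, i.+1).
  by have := key p.-1; rewrite prednK ?prime_gt0 // subrK => ->; ring.
apply: (vMB prP) => //; apply: (vM_sum prP) => i _.
rewrite -mulr_natr; apply: (vMMl prP); first exact: (vOX prP).
by apply/(vM_nat prP pr_p Pp)/prime_dvd_bin => //; have := ltn_ord i; lia.
Qed.

Lemma vM_expXM_sub1 u m n : vO P u -> vM P (u ^+ m - 1) -> vM P (u ^+ (m * n) - 1).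
Proof.
move=> Ou Mu; rewrite exprM subrX1; apply: (vMMr prP) => //.
by apply: (vO_sum prP) => i _; rewrite -exprM; apply: (vOX prP).
Qed.

Lemma residue_unit_order y : vO P y -> ~ vM P y ->
  exists t, [/\ (0 < t)%N, coprime p t & vM P (y ^+ t - 1)].
Proof.
move=> Oy M'y.
have [t0 t0_gt0 Mt0] : exists2 t, (0 < t)%N & vM P (y ^+ t - 1).
  have [a [b [[_ Aa] [_ Ab] P'b Dy]]] := vO_fraction prP subfield_algC I Oy.
  have P'a : ~ P a by move=> Pa; apply: M'y; exists a, b.
  have [ta ta_gt0 Pta] := residue_finite_order prP pr_p Pp Aa P'a.
  have [tb tb_gt0 Ptb] := residue_finite_order prP pr_p Pp Ab P'b.
  exists (ta * tb)%N; first by rewrite muln_gt0 ta_gt0.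
  exists (a ^+ (ta * tb) - b ^+ (ta * tb)), (b ^+ (ta * tb)); rewrite rpredX //.
  split=> //; last by rewrite Dy expr_div_n mulrBl divff ?expf_neq0 ?(prime_ideal_neq0 prP).
    apply: (vM_Aint prP); last by rewrite rpredB ?rpredX.
    have -> : a ^+ (ta * tb) - b ^+ (ta * tb) = (a ^+ (ta * tb) - 1) - (b ^+ (tb * ta) - 1).
      by rewrite [(tb * ta)%N]mulnC; ring.
    by apply: (vMB prP); apply: vM_expXM_sub1; try exact: vO_Aint; apply: vM_ideal.
  by move/(prime_ideal_root prP Ab).
have [m cop_pm Dt0] := pfactor_coprime pr_p t0_gt0.
exists m; split=> //; first by move: t0_gt0; rewrite Dt0 muln_gt0 => /andP[].
move: Mt0; rewrite Dt0; elim: (logn p t0) => [|r IHr]; first by rewrite muln1.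
rewrite expnSr mulnA exprM => /vM_expp_sub1 Mr; apply/IHr/Mr.
exact: vOX.
Qed.

(** The residues of F form a perfect ring: a unit y has an order t prime to p modulo P, and y^u is
    the root when u inverts p^N modulo t. *)
Lemma residue_ppow_root (F : algC -> Prop) y N : is_subfield F -> F y -> vO P y ->
  exists w, [/\ F w, vO P w & vM P (w ^+ (p ^ N) - y)].
Proof.
move=> sfF Fy Oy; have [My | M'y] := pselect (vM P y).
  exists 0; split; [exact: subfield0 | exact: vO0 |].
  by rewrite expr0n expn_eq0 eqn0Ngt prime_gt0 // sub0r; apply: (vMN prP).
have [t [t_gt0 cop_pt Mt]] := residue_unit_order Oy M'y.
have pN_gt0 : (0 < p ^ N)%N by rewrite expn_gt0 prime_gt0.
have /(coprimeP _ pN_gt0)[[u v] /= Duv] : coprime (p ^ N) t by rewrite coprimeXl.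
exists (y ^+ u); split; [exact: subfieldX | exact: vOX |].
have -> : y ^+ u ^+ (p ^ N) - y = y * (y ^+ (t * v) - 1).
  rewrite -exprM mulrBr mulr1 -exprS; congr (y ^+ _ - y); lia.
by apply: (vMMl prP) => //; apply: vM_expXM_sub1.
Qed.

End Congruences.

(** With Q the trace of P on H, unramifiedness provides [pi] in K that lies in Q but not in Q^2. If
    some nonunit y were not divisible by [pi], then pi = y (pi / y) would be a product of two
    nonunits of H, which would put [pi] in Q^2. *)
Lemma unramified_uniformizer (P K H : algC -> Prop) (p : nat) :
    prime_ideal P -> prime p -> P p%:R -> is_subfield H -> (forall x, K x -> H x) ->
    unramified_finite K H ->
  exists pi, [/\ K pi, pi != 0, vM P pi & forall y, H y -> vM P y -> vO P (y / pi)].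
Proof.
move=> prP pr_p Pp sfH sKH unrKH; pose Q x := H x /\ P x.
have [||pi [Kpi [[_ Ppi] sq'pi]]] := unrKH Q.
- split=> [x [Hx /(prime_ideal_Aint prP)] | ] //; split.
  + by split; [exact: subfield0 | exact: prime_ideal0].
  + by move=> x y [Hx Px] [Hy Py]; split; [exact: subfieldD | exact: prime_idealD].
  + by move=> a x [Ha Aa] [Hx Px]; split; [exact: subfieldM | exact: prime_idealM].
  + by case=> _ /(prime_ideal1 prP).
  by move=> x y [Hx Ax] [Hy Ay] [_ /(prime_ideal_prime prP Ax Ay)[]]; [left | right].
- by exists p%:R; split; [split; [exact: subfield_nat | ] | apply/eqP/p_neq0].
have nz_pi : pi != 0.
  apply: contra_notN sq'pi => /eqP->; exists 0%N, (fun=> 0), (fun=> 0).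
  by rewrite big_ord0; split=> [[] //|]; split=> [[]|].
exists pi; split=> //; first exact: vM_ideal.
move=> y Hy My; have [-> | nz_y] := eqVneq y 0; first by rewrite mul0r; apply: vO0.
case: (vO_total prP (y / pi)) => //; rewrite invf_div => Mz; case: sq'pi.
have Hpi := sKH _ Kpi.
have [a [b [[Ha Aa] [Hb Ab] P'b Dy]]] := vO_fraction prP sfH Hy (vM_O prP My).
have [c [d [[Hc Ac] [Hd Ad] P'd Dz]]] := vO_fraction prP sfH (subfield_div sfH Hpi Hy) (vM_O prP Mz).
have nz_b := prime_ideal_neq0 prP P'b; have nz_d := prime_ideal_neq0 prP P'd.
have Pa : P a by apply: (vM_Aint prP) => //; rewrite -(divfK nz_b a) -Dy; apply: (vMMr prP) => //; apply: vO_Aint.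
have Pc : P c by apply: (vM_Aint prP) => //; rewrite -(divfK nz_d c) -Dz; apply: (vMMr prP) => //; apply: vO_Aint.
have Dpi : pi * (b * d) = a * c.
  have -> : a = y * b by rewrite Dy divfK.
  have -> : c = pi / y * d by rewrite Dz divfK.
  by field.
have Abd : b * d \in Aint by rewrite rpredM.
have [t t_gt0 Pt] := residue_finite_order prP pr_p Pp Abd (prime_ideal'M prP Ab Ad P'b P'd).
(* Clearing denominators leaves pi (b d) = a c with b d outside P. As (b d)^t = 1 modulo P, the sum
   a c (b d)^(t-1) + pi (1 - (b d)^t) = pi consists of two products of elements of Q. *)
exists 2, (fun i : 'I_2 => if i == 0 then a else pi),
  (fun i : 'I_2 => if i == 0 then c * (b * d) ^+ t.-1 else 1 - (b * d) ^+ t).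
split=> [i|]; first by case: ifP.
split=> [i|]; last first.
  rewrite !big_ord_recl big_ord0 /= addr0 mulrA -Dpi -mulrA -exprS prednK //; ring.
have Hbdt : H ((b * d) ^+ t) by apply/(subfieldX sfH)/(subfieldM sfH).
case: ifP => _; split.
- by apply/(subfieldM sfH)/(subfieldX sfH)/(subfieldM sfH).
- by apply: (prime_idealMr prP); rewrite ?rpredX.
- by apply/(subfieldB sfH) => //; apply: subfield1.
- by rewrite -opprB; apply: (prime_idealN prP).
Qed.

Section Inertia.
Variables (P K H : algC -> Prop) (p : nat).
Hypotheses (prP : prime_ideal P) (pr_p : prime p) (Pp : P p%:R).
Hypotheses (sfH : is_subfield H) (sKH : forall x, K x -> H x) (unrKH : unramified_finite K H).

(** The uniformizer [pi] is fixed by [s]. Write y = w^q + pi y1 with q = p^N: the power w^q moves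
    only modulo pi^(N+1), and y1 falls under the induction. So s y - y is divisible by every power
    of [pi] and vanishes. *)
Lemma unramified_inertia_trivial (s : {rmorphism algC -> algC}) :
    fixes K s -> (forall x, H x -> H (s x)) ->
    (forall a, H a -> a \in Aint -> P (s a - a)) ->
  forall x, H x -> s x = x.
Proof.
move=> sK sH sP; have [pi [Kpi nz_pi Mpi unif]] := unramified_uniformizer prP pr_p Pp sfH sKH unrKH.
have s_inert y : H y -> vO P y -> vO P (s y) /\ vM P (s y - y).
  move=> Hy Oy; have [a [b [[Ha Aa] [Hb Ab] P'b Dy]]] := vO_fraction prP sfH Hy Oy.
  have P'sb : ~ P (s b).
    by move=> Psb; apply: P'b; rewrite -[b](subKr (s b)); apply: (prime_idealB prP) => //; apply: sP.
  have nz_b := prime_ideal_neq0 prP P'b; have nz_sb := prime_ideal_neq0 prP P'sb.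
  split; first by exists (s a), (s b); rewrite !Aint_aut Dy fmorph_div.
  exists ((s a - a) * b - a * (s b - b)), (b * s b); split.
  - by apply: (prime_idealB prP); [apply: (prime_idealMr prP) | apply: (prime_idealM prP)] => //; apply: sP.
  - by rewrite rpredM ?Aint_aut.
  - by apply: prime_ideal'M; rewrite ?Aint_aut.
  - by rewrite Dy fmorph_div; field; rewrite nz_b nz_sb.
have Op : vO P (p%:R / pi) by apply: unif; [apply: subfield_nat | apply: vM_ideal].
have Hpi := sKH Kpi; have Opi := vM_O prP Mpi.
have claim N y : H y -> vO P y -> vO P ((s y - y) / pi ^+ N).
  elim: N y => [|N IHN] y Hy Oy.
    by rewrite divr1; apply: (vM_O prP); case: (s_inert y).
  have [w [Hw Ow Mw]] := residue_ppow_root prP pr_p Pp N sfH Hy Oy.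
  set q := (p ^ N)%N in Mw.
  have Hwq : H (w ^+ q) by apply: subfieldX.
  pose y1 := (y - w ^+ q) / pi.
  have Hy1 : H y1 by apply/(subfield_div sfH) => //; apply: subfieldB.
  have Oy1 : vO P y1.
    apply: unif; first by apply/(subfieldB sfH).
    by rewrite -opprB; apply: (vMN prP).
  have Dy : y = w ^+ q + pi * y1 by rewrite mulrC divfK // addrC subrK.
  have -> : s y - y = (s w ^+ q - w ^+ q) + pi * (s y1 - y1).
    by rewrite {1 2}Dy rmorphD rmorphXn rmorphM /= (sK pi) //; ring.
  have [Osw Msw] := s_inert w Hw Ow.
  apply: (vO_divD prP).
    apply: (vO_exp_ppow_congr prP pr_p) => //.
    by apply: unif => //; apply/(subfieldB sfH) => //; apply: sH.
  by rewrite exprS; apply: (vO_divM prP); [rewrite divff //; apply: vO1 | apply: IHN].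
have fixO y : H y -> vO P y -> s y = y.
  move=> Hy Oy; apply: contrapT => /eqP; rewrite -subr_eq0 => nz_z.
  have [j] := vO_separated prP pr_p Pp nz_z; apply.
  have [k k_gt0 Ok] := vM_nilpotent_mod_p prP pr_p Mpi.
  have nz_pikj : pi ^+ (k * j) != 0 by rewrite expf_neq0.
  apply: (vO_div_trans prP nz_pikj); first exact: claim.
  by rewrite exprM -expr_div_n; apply: vOX.
move=> x Hx; have [j Oj] := vO_archimedean prP pr_p Pp x.
have nz_pj : p%:R ^+ j != 0 :> algC by rewrite expf_neq0 ?(p_neq0 pr_p).
apply: (mulfI nz_pj); rewrite -[RHS]fixO ?rmorphM ?rmorphXn ?rmorph_nat //.
by apply/(subfieldM sfH)=> //; apply/(subfieldX sfH)/(subfield_nat sfH).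
Qed.

End Inertia.

Section RamificationIndex.
Variables (P K : algC -> Prop) (p : nat).
Hypotheses (prP : prime_ideal P) (pr_p : prime p) (Pp : P p%:R).

(** A rational relation becomes integral after clearing denominators; all its coefficients are then
    divisible by p, and dividing by p is a descent on the sum of their absolute values. *)
Lemma independent_mod_p_dim (F : algC -> Prop) d m (x : 'I_m -> algC) :
    dimQ_le F d -> (forall i, F (x i)) ->
    (forall c : 'I_m -> int, vO P ((\sum_i (c i)%:~R * x i) / p%:R) -> forall i, (p %| c i)%Z) ->
  (m <= d)%N.
Proof.
move=> dimF Fx indep; apply: dimF Fx _ => c.
have indZ n (b : 'I_m -> int) : (\sum_i `|b i|%N < n)%N ->
  \sum_i (b i)%:~R * x i = 0 -> forall i, b i = 0.
  elim: n b => // n IHn b; rewrite ltnS => le_n b0 i.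
  have [b'0 | nz_b] := boolP [forall i, b i == 0]; first exact/eqP/(forallP b'0).
  have /indep pb : vO P ((\sum_i (b i)%:~R * x i) / p%:R) by rewrite b0 mul0r; apply: vO0.
  have Db j : b j = (b j %/ p)%Z * p by rewrite divzK.
  suffices q0 : forall i, (b i %/ p)%Z = 0 by rewrite Db q0 mul0r.
  apply: IHn.
    apply: leq_trans le_n; have /forallPn[j nz_bj] := nz_b.
    have lebp k : (`|(b k %/ p)%Z| <= `|b k|)%N.
      by rewrite [b k in X in (_ <= X)%N]Db abszM leq_pmulr ?prime_gt0.
    rewrite (bigD1 j) //= [X in (_ < X)%N](bigD1 j) //= -addSn leq_add ?leq_sum //.
    rewrite [b j in X in (_ < X)%N]Db abszM ltn_Pmulr ?prime_gt1 //.
    by rewrite absz_gt0; apply: contraNneq nz_bj => q0; rewrite Db q0 mul0r.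
  apply: (mulIf (p_neq0 pr_p)); rewrite mul0r -[RHS]b0 mulr_suml.
  by apply: eq_bigr => k _; rewrite [in RHS]Db intrM; ring.
move=> c0 i; pose D := \prod_j denq (c j).
have nz_D : D != 0 by apply/prodf_neq0 => j _; apply: denq_neq0.
pose b j := numq (c j) * \prod_(k | k != j) denq (c k).
have Db j : ratr (b j)%:~R = ratr D%:~R * ratr (c j) :> algC.
  by rewrite -rmorphM; congr ratr; rewrite /D (bigD1 j) //= /b !intrM numqE; ring.
have /(_ i) bi0 : forall i, b i = 0.
  apply: (indZ (\sum_i `|b i|%N).+1) => //.
  rewrite -[RHS](mulr0 (ratr D%:~R)) -[in RHS]c0 mulr_sumr.
  by apply: eq_bigr => j _; rewrite mulrA -Db ratr_int.
apply: (fmorph_inj (ratr : {rmorphism rat -> algC})); rewrite rmorph0.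
apply: (@mulfI _ (ratr D%:~R)); first by rewrite fmorph_eq0 intr_eq0.
by rewrite mulr0 -Db bi0 !rmorph0.
Qed.

(** If e exceeded d, the d + 1 powers 1, ..., pi^d would be independent modulo p. Indeed, in a
    relation whose coefficients before the i-th are divisible by p, everything but c_i pi^i is
    divisible by pi^(i+1), so p divides c_i too. *)
Lemma ramification_index_bound d pi :
    is_subfield K -> dimQ_le K d -> K pi -> pi != 0 -> vM P pi ->
    (forall y, K y -> vM P y -> vO P (y / pi)) ->
  exists e, [/\ (0 < e <= d)%N, vO P (p%:R / pi ^+ e) & vO P (pi ^+ e / p%:R)].
Proof.
move=> sfK dimK Kpi nz_pi Mpi unif; have Opi := vM_O prP Mpi.
have nz_piX n : pi ^+ n != 0 by rewrite expf_neq0.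
have nz_p := p_neq0 pr_p.
have [e [Oe O'e]] : exists e, vO P (p%:R / pi ^+ e) /\ ~ vO P (p%:R / pi ^+ e.+1).
  apply: contrapT => /forallNP noe.
  have Oall n : vO P (p%:R / pi ^+ n).
    elim: n => [|n IHn]; first by rewrite divr1; apply: vO_nat.
    by apply: contrapT => O'n; apply: (noe n).
  have [k k_gt0 Ok] := vM_nilpotent_mod_p prP pr_p Mpi.
  apply: (vM_V prP nz_pi Mpi); rewrite -div1r.
  have -> : 1 / pi = pi ^+ k / p%:R * (p%:R / pi ^+ k.+1).
    by rewrite mulrA divfK // exprS invfM mulrCA divff // mulr1 div1r.
  exact: vOM.
have M'u : ~ vM P (p%:R / pi ^+ e).
  move/unif=> Ou; apply: O'e; rewrite exprSr invfM mulrA; apply: Ou.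
  by apply: subfield_div => //; [apply: subfield_nat | apply: subfieldX].
exists e; split=> //; last by rewrite -invf_div; apply: vO_unitV.
apply/andP; split.
  by case: e M'u {Oe O'e} => //; rewrite divr1 => -[]; apply: vM_ideal.
rewrite leqNgt; apply/negP=> lt_d_e.
suffices : (d.+1 <= d)%N by rewrite ltnn.
apply: (@independent_mod_p_dim K d d.+1 (fun i => pi ^+ i)) => // [i|c Oc].
  exact: subfieldX.
have OpX n : (n <= d.+1)%N -> vO P (p%:R / pi ^+ n).
  move=> le_n; rewrite -[pi ^+ n](mulKf (nz_piX (e - n)%N)) -exprD subnK; last by lia.
  by rewrite invfM invrK mulrCA; apply: vOM => //; apply: vOX.
suffices pc n (i : 'I_d.+1) : (i < n)%N -> (p %| c i)%Z by move=> i; apply: (pc d.+1).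
elim: n i => // n IHn i; rewrite ltnS => le_i_n.
apply/(vM_int prP pr_p Pp); have: vO P ((c i)%:~R * pi ^+ i / pi ^+ i.+1).
  have -> : (c i)%:~R * pi ^+ i = \sum_j (c j)%:~R * pi ^+ j - \sum_(j | j != i) (c j)%:~R * pi ^+ j.
    by rewrite [X in X - _](bigD1 i) //= addrK.
  apply: (vO_divB prP); first by apply: (vO_div_trans prP nz_p) => //; apply: OpX.
  rewrite mulr_suml; apply: (vO_sum prP) => j ne_ji.
  have [lt_ij | ] := ltnP i j.
    apply: (vO_divMl prP); first exact: vO_int.
    by rewrite -{1}(subnKC lt_ij) exprD mulrAC divff // mul1r; apply: vOX.
  rewrite leq_eqVlt (inj_eq val_inj) (negPf ne_ji) /= => lt_ji.
  have /dvdzP[q ->] := IHn j (leq_trans lt_ji le_i_n).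
  rewrite intrM -mulrA; apply: (vO_divMl prP); first exact: vO_int.
  rewrite [_%:~R * _]mulrC; apply: (vO_divMl prP); first exact: vOX.
  by apply: OpX; apply: ltn_ord.
rewrite exprSr invfM mulrA mulfK // => Oci.
by rewrite -(divfK nz_pi (_ %:~R)); apply: vMMl.
Qed.

End RamificationIndex.

(** * P-adic closure of a number field *)

(** Stands for the algebraic numbers lying in the completion of [F] at [P]: approximation modulo
    every power of p replaces limits, and everything stays inside [algC]. *)
Definition vhat (P : algC -> Prop) (p : nat) (F : algC -> Prop) (x : algC) : Prop :=
  forall N, exists2 y, F y & vO P ((x - y) / p%:R ^+ N).

Section Closure.
Variables (P F : algC -> Prop) (p : nat).
Hypotheses (prP : prime_ideal P) (pr_p : prime p) (Pp : P p%:R) (sfF : is_subfield F).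

Lemma ppow_neq0 n : p%:R ^+ n != 0 :> algC.
Proof. by rewrite expf_neq0 ?(p_neq0 pr_p). Qed.

Lemma vO_ppow_le m n : (m <= n)%N -> vO P (p%:R ^+ n / p%:R ^+ m).
Proof.
by move=> le_mn; rewrite -(subnK le_mn) exprD mulfK ?ppow_neq0 //; apply/vOX/vO_nat.
Qed.

Lemma vO_ppowW x m n : (m <= n)%N -> vO P (x / p%:R ^+ n) -> vO P (x / p%:R ^+ m).
Proof. by move=> le_mn Ox; apply: (vO_div_trans prP (ppow_neq0 n)) => //; apply: vO_ppow_le. Qed.

Lemma sub_vhat x : F x -> vhat P p F x.
Proof. by move=> Fx N; exists x; rewrite // subrr mul0r; apply: vO0. Qed.

Lemma subfield_vhat : is_subfield (vhat P p F).
Proof.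
split; [exact: (sub_vhat (subfield0 sfF)) | exact: (sub_vhat (subfield1 sfF)) | | |].
- move=> x x' hx hx' N; have [[y Fy Oy] [y' Fy' Oy']] := (hx N, hx' N).
  exists (y - y'); first exact: subfieldB.
  by have -> : x - x' - (y - y') = (x - y) - (x' - y') by [ring]; apply: vO_divB.
- move=> x x' hx hx' N.
  have [[i Oi] [i' Oi']] := (vO_archimedean prP pr_p Pp x, vO_archimedean prP pr_p Pp x').
  pose j := maxn i i'; have le_ij : (i <= j)%N := leq_maxl i i'.
  have le_i'j : (i' <= j)%N := leq_maxr i i'.
  have Ojx : vO P (p%:R ^+ j * x).
    by rewrite -(subnK le_ij) exprD -mulrA; apply: (vOM prP) => //; apply/vOX/vO_nat.
  have Ojx' : vO P (p%:R ^+ j * x').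
    by rewrite -(subnK le_i'j) exprD -mulrA; apply: (vOM prP) => //; apply/vOX/vO_nat.
  have [[y Fy Oy] [y' Fy' Oy']] := (hx (N + j)%N, hx' (N + j)%N).
  exists (y * y'); first exact: subfieldM.
  have Ojy' : vO P (p%:R ^+ j * y').
    have -> : p%:R ^+ j * y' = p%:R ^+ j * x' - p%:R ^+ j * p%:R ^+ (N + j) * ((x' - y') / p%:R ^+ (N + j)).
      by field; rewrite ppow_neq0.
    apply: (vOB prP) => //; apply: (vOM prP) => //.
    by apply: (vOM prP); apply/vOX/vO_nat.
  have -> : (x * x' - y * y') / p%:R ^+ N = (p%:R ^+ j * x) * ((x' - y') / p%:R ^+ (N + j))
      + ((x - y) / p%:R ^+ (N + j)) * (p%:R ^+ j * y').
    by rewrite exprD; field; rewrite !ppow_neq0.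
  by apply: (vOD prP); apply: (vOM prP).
move=> x hx N; have [-> | nz_x] := eqVneq x 0.
  by exists 0; [exact: subfield0 | rewrite invr0 subrr mul0r; apply: vO0].
have [j Oj] := vO_archimedean prP pr_p Pp x^-1.
(* In 1/x - 1/y = (y - x) / (x y), each of the two denominators costs p^j at most; the extra factor
   p makes y / x a unit. *)
have [y Fy Oy] := hx (N + j + j).+1%N.
exists y^-1; first exact: subfieldV.
set z := (x - y) / _ in Oy.
have Mw : vM P ((x - y) / x).
  have -> : (x - y) / x = p%:R * (p%:R ^+ (N + j) * z * (p%:R ^+ j * x^-1)).
    by rewrite /z exprS !exprD; field; rewrite nz_x !ppow_neq0 (p_neq0 pr_p).
  apply: (vMMr prP); first exact: vM_p.
  by do 2!apply: (vOM prP) => //; apply/vOX/vO_nat.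
have M'yx : ~ vM P (y / x).
  move=> Myx; apply: (vM1 prP); have -> : 1 = (x - y) / x + y / x by field.
  exact: vMD.
have nz_y : y != 0 by apply: contraNneq (vM_neq0 prP M'yx) => ->; rewrite mul0r.
have -> : (x^-1 - y^-1) / p%:R ^+ N = - (p%:R * z * (p%:R ^+ j * x^-1) * (p%:R ^+ j * x^-1) * (y / x)^-1).
  by rewrite /z exprS !exprD; field; rewrite nz_x nz_y !ppow_neq0 (p_neq0 pr_p).
apply: (vON prP); apply: (vOM prP); last exact: vO_unitV.
by do 3!apply: (vOM prP) => //; apply: vO_nat.
Qed.

Lemma vhat_idem x : vhat P p (vhat P p F) x -> vhat P p F x.
Proof.
move=> hx N; have [y hy Oy] := hx N; have [z Fz Oz] := hy N; exists z => //.
by have -> : x - z = (x - y) + (y - z) by [ring]; apply: vO_divD.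
Qed.

End Closure.

(** * Teichmueller representatives and expansions in a uniformizer *)

Section Teichmuller.
Variables (P E : algC -> Prop) (p : nat).
Hypotheses (prP : prime_ideal P) (pr_p : prime p) (Pp : P p%:R) (sfE : is_subfield E).
Variables (pi : algC) (e M : nat).
Hypotheses (Epi : E pi) (nz_pi : pi != 0) (Mpi : vM P pi).
Hypothesis unif : forall y, E y -> vM P y -> vO P (y / pi).
Hypotheses (e_gt0 : (0 < e)%N) (Ope : vO P (p%:R / pi ^+ e)) (Oep : vO P (pi ^+ e / p%:R)).
Let q := (p ^ M)%N.
Hypotheses (M_gt0 : (0 < M)%N) (res : forall y, E y -> vO P y -> vM P (y ^+ q - y)).

Lemma teich_Aint t : t ^+ q = t -> t \in Aint.
Proof.
have q_gt1 : (1 < q)%N by rewrite -{1}(expn0 p) ltn_exp2l ?prime_gt1.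
have [-> // | nz_t] := eqVneq t 0.
move=> tq; apply: (@Aint_unity_root q.-1); first by rewrite -ltnS prednK // ltnW.
apply/unity_rootP/(mulfI nz_t); rewrite -exprS prednK ?tq ?mulr1 //.
exact: ltnW.
Qed.

Lemma teich_unit t : t ^+ q = t -> t != 0 -> ~ vM P t.
Proof.
move=> tq nz_t Mt; apply: (vM1 prP).
have q_gt1 : (1 < q)%N by rewrite -{1}(expn0 p) ltn_exp2l ?prime_gt1.
have -> : 1 = t ^+ q.-1 by apply: (mulfI nz_t); rewrite -exprS prednK ?tq ?mulr1 // ltnW.
by apply: (vMX prP) => //; rewrite -ltnS prednK // ltnW.
Qed.

(** Some factor of y^q - y, the product of all y - t with t^q = t, is in the maximal ideal. As this
    [t] may lie outside E, [unif] is applied not to y - t but to y^q - y = (y - t) g, where g is a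
    unit, being -1 modulo P. *)
Lemma residue_teich y : E y -> vO P y -> exists t, [/\ t ^+ q = t & vO P ((y - t) / pi)].
Proof.
move=> Ey Oy; have Mq := res Ey Oy.
have q_gt1 : (1 < q)%N by rewrite -{1}(expn0 p) ltn_exp2l ?prime_gt1.
pose f : {poly algC} := 'X^q - 'X.
have lf : lead_coef f = 1.
  by rewrite /f lead_coefDl ?lead_coefXn // size_polyN size_polyX size_polyXn.
have [r Dr] := closed_field_poly_normal f; rewrite lf scale1r in Dr.
have fE z : f.[z] = z ^+ q - z by rewrite /f !hornerE.
have /(vM_prod_seq prP)[t rt Mt] : vM P (\prod_(t <- r) (y - t)).
  have := Mq; rewrite -fE Dr horner_prod; congr (vM P _).
  by apply: eq_bigr => t _; rewrite !hornerE.
have tq : t ^+ q = t.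
  have : root f t by rewrite Dr root_prod_XsubC.
  by rewrite /root fE subr_eq0 => /eqP.
have Ot := vO_Aint prP (teich_Aint tq).
exists t; split=> //.
pose g := \sum_(i < q) y ^+ (q.-1 - i) * t ^+ i - 1.
have Dg : y ^+ q - y = (y - t) * g.
  by rewrite /g mulrBr -subrXX tq; ring.
have Mexp k : vM P (y ^+ k - t ^+ k).
  rewrite subrXX; apply: (vMMr prP) => //; apply: (vO_sum prP) => i _.
  by apply: (vOM prP); apply: (vOX prP).
have M'g : ~ vM P g.
  move=> Mg; apply: (vM1 prP).
  have -> : 1 = \sum_(i < q) y ^+ (q.-1 - i) * t ^+ i - g by rewrite /g; ring.
  apply: (vMB prP) => //.
  have -> : \sum_(i < q) y ^+ (q.-1 - i) * t ^+ i =
      \sum_(i < q) t ^+ i * (y ^+ (q.-1 - i) - t ^+ (q.-1 - i)) + q%:R * t ^+ q.-1.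
    rewrite -[q in q%:R]card_ord -sum1_card natr_sum mulr_suml -big_split /=.
    apply: eq_bigr => i _; rewrite mulrBr -exprD subnKC ?mul1r; first by rewrite subrK mulrC.
    by rewrite -ltnS prednK // ltnW.
  apply: (vMD prP).
    by apply: (vM_sum prP) => i _; apply: (vMMl prP) => //; apply: (vOX prP).
  apply: (vMMr prP); last exact: (vOX prP).
  by apply/(vM_nat prP pr_p Pp); rewrite /q -(prednK M_gt0) expnS dvdn_mulr.
have nz_g := vM_neq0 prP M'g.
have -> : (y - t) / pi = (y ^+ q - y) / pi * g^-1 by rewrite Dg; field; rewrite nz_g.
apply: (vOM prP); last exact: vO_unitV.
by apply: unif => //; apply/(subfieldB sfE) => //; apply: (subfieldX sfE).
Qed.

(** Subtracting the digit [t] could lead out of E. Its substitute s = y^(q^R) stays in E, and agrees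
    with t = t^(q^R) to high precision because p-th powers improve congruences. *)
Lemma teich_lift y R : E y -> vO P y ->
  exists t s, [/\ t ^+ q = t, E s, vO P s, vO P ((y - s) / pi) & vO P ((s - t) / pi ^+ R)].
Proof.
move=> Ey Oy; have [t [tq Ot]] := residue_teich Ey Oy.
have tqX n : t ^+ (p ^ (M * n)) = t.
  by elim: n => [|n IHn]; rewrite ?muln0 // mulnS expnD exprM -/q tq.
pose s := y ^+ (p ^ (M * R)); exists t, s.
have Opi := vM_O prP Mpi.
have Op : vO P (p%:R / pi) by apply: unif; [apply: (subfield_nat sfE) | apply: vM_p].
have Ost : vO P ((s - t) / pi ^+ (M * R).+1).
  rewrite -[t in X in vO P X](tqX R).
  by apply: (vO_exp_ppow_congr prP pr_p) => //; apply/(vO_Aint prP)/teich_Aint.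
have Ostn n : (n <= (M * R).+1)%N -> vO P ((s - t) / pi ^+ n).
  move=> le_n; apply: (vO_div_trans prP _ Ost); first by rewrite expf_neq0.
  by rewrite -{1}(subnK le_n) exprD mulfK ?expf_neq0 //; apply: vOX.
split=> //; [exact: subfieldX | exact: vOX | | ].
  have -> : y - s = (y - t) - (s - t) by ring.
  by apply: (vO_divB prP) => //; apply: (Ostn 1%N).
by apply: Ostn; rewrite ltnW // ltnS leq_pmull.
Qed.

Lemma teich_expansion y R k : E y -> vO P y ->
  exists (t : nat -> algC) y', [/\ forall i, t i ^+ q = t i, E y', vO P y' &
     vO P ((y - (\sum_(i < k) t i * pi ^+ i + pi ^+ k * y')) / pi ^+ R)].
Proof.
move=> Ey Oy; elim: k => [|k [t [y' [tq Ey' Oy' Ot]]]].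
  exists (fun=> 0), y; split=> // [i|]; first by rewrite expr0n expn_eq0 eqn0Ngt prime_gt0.
  by rewrite big_ord0 add0r mul1r subrr mul0r; apply: vO0.
have [u [s [uq Es Os Oys Osu]]] := teich_lift R Ey' Oy'.
exists (fun i => if i == k then u else t i), ((y' - s) / pi); split=> //.
- by move=> i; case: eqP.
- by apply/(subfield_div sfE)=> //; apply: (subfieldB sfE).
rewrite big_ord_recr /= eqxx; set S := \sum_(i < k) _; set S' := \sum_(i < k) _ in Ot.
have -> : S = S' by apply: eq_bigr => i _; rewrite ltn_eqF.
have -> : y - (S' + u * pi ^+ k + pi ^+ k.+1 * ((y' - s) / pi)) =
    (y - (S' + pi ^+ k * y')) + pi ^+ k * (s - u) by rewrite exprS; field.
apply: (vO_divD prP) => //; apply: (vO_divMl prP) => //; apply/(vOX prP)/(vM_O prP Mpi).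
Qed.

(** Truncated Teichmueller expansions. For M > 0 they form a finite set depending on p, M and N, but
    neither on P nor on E. *)
Definition digits N (a : algC) : Prop :=
  exists2 t : nat -> algC, (forall j, t j ^+ q = t j) & a = \sum_(j < N) p%:R ^+ j * t j.

(** The pi-adic expansion is regrouped as a polynomial in [pi] of degree less than e: its remainder
    pi^e y' is p y1 with y1 = (pi^e / p) y' in E, and expanding y1 in turn gives the next p-adic
    digit of each coefficient. *)
Lemma digits_expansion N y : E y -> vO P y ->
  exists2 a : nat -> algC, (forall i, digits N (a i)) &
    vO P ((y - \sum_(i < e) a i * pi ^+ i) / p%:R ^+ N).
Proof.
elim: N y => [|N IHN] y Ey Oy.
  exists (fun=> 0) => [i|].
    exists (fun=> 0); last by rewrite big_ord0.
    by move=> _; rewrite expr0n expn_eq0 eqn0Ngt prime_gt0.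
  rewrite divr1; apply: (vOB prP) => //; apply: (vO_sum prP) => i _; rewrite mul0r.
  exact: vO0.
have [t [y' [tq Ey' Oy' Ot]]] := teich_expansion (e * N.+1) e Ey Oy.
pose y1 := pi ^+ e / p%:R * y'.
have Ey1 : E y1.
  by do 2!apply/(subfieldM sfE) => //; [apply: (subfieldX sfE) | apply/(subfieldV sfE)/(subfield_nat sfE)].
have Oy1 : vO P y1 by apply: vOM.
have [a Da Oa] := IHN y1 Ey1 Oy1.
exists (fun i => t i + p%:R * a i) => [i|].
  have [u uq ->] := Da i; exists (fun j => if j is j'.+1 then u j' else t i); first by case.
  rewrite big_ord_recl mul1r mulr_sumr; congr (_ + _); apply: eq_bigr => j _.
  by rewrite exprS mulrA.
have -> : y - \sum_(i < e) (t i + p%:R * a i) * pi ^+ i =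
   (y - (\sum_(i < e) t i * pi ^+ i + pi ^+ e * y')) + p%:R * (y1 - \sum_(i < e) a i * pi ^+ i).
  rewrite (eq_bigr (fun i : 'I_e => t i * pi ^+ i + p%:R * (a i * pi ^+ i))); last by move=> i _; ring.
  by rewrite big_split -mulr_sumr /= /y1; field; rewrite (p_neq0 pr_p).
apply: (vO_divD prP).
  apply: (vO_div_trans prP _ Ot); first by rewrite expf_neq0.
  by rewrite exprM -expr_div_n; apply: vOX.
by rewrite exprS; apply: (vO_divM prP) => //; rewrite divff ?(p_neq0 pr_p) //; apply: vO1.
Qed.

End Teichmuller.

(** * Valuations measured by a uniformizer, and Newton's iteration *)

Section Valuation.
Variables (P : algC -> Prop) (p : nat).
Hypotheses (prP : prime_ideal P) (pr_p : prime p) (Pp : P p%:R).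
Variables (pi : algC) (nz_pi : pi != 0) (Mpi : vM P pi).

Definition has_val x k := [/\ x != 0, vO P (x / pi ^+ k) & vO P (pi ^+ k / x)].

Lemma has_valM x y k l : has_val x k -> has_val y l -> has_val (x * y) (k + l).
Proof.
move=> [nzx Ox Ox'] [nzy Oy Oy']; rewrite /has_val mulf_neq0 // exprD.
by split=> //; apply: vO_divM.
Qed.

Lemma has_valX x k n : has_val x k -> has_val (x ^+ n) (k * n).
Proof.
move=> vx; elim: n => [|n IHn]; last by rewrite exprS mulnS; apply: has_valM.
by rewrite muln0 /has_val !expr0 oner_neq0 divr1; split=> //; apply: vO1.
Qed.

Lemma has_val_unit x : vO P x -> ~ vM P x -> has_val x 0.
Proof.
move=> Ox M'x; rewrite /has_val expr0 divr1 div1r; split=> //; last exact: vO_unitV.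
exact: vM_neq0 M'x.
Qed.

Lemma has_valN x k : has_val x k -> has_val (- x) k.
Proof. by move=> [nz Ox Ox']; rewrite /has_val oppr_eq0 mulNr invrN mulrN; split=> //; apply: vON. Qed.

Lemma has_val_pi : has_val pi 1.
Proof. by rewrite /has_val expr1 divff //; split=> //; apply: vO1. Qed.

Lemma has_val_nat e n : has_val p%:R e -> (0 < n)%N -> exists k, has_val n%:R (e * k).
Proof.
move=> vp n_gt0; have [m p'm ->] := pfactor_coprime pr_p n_gt0.
exists (logn p n); rewrite natrM natrX -[(e * _)%N]add0n; apply/has_valM/has_valX => //.
apply: has_val_unit; first exact: vO_nat.
by move/(vM_nat prP pr_p Pp); apply/negP; rewrite -prime_coprime.
Qed.

(** By the ultrametric inequality, a sum of terms with pairwise distinct valuations has the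
    valuation of its least term, hence at most that of any nonzero term. *)
Lemma vO_sum_distinct_val n (c : 'I_n -> algC) (k : 'I_n -> nat) i0 :
    c i0 != 0 -> (forall i, c i != 0 -> has_val (c i) (k i)) ->
    (forall i j, c i != 0 -> c j != 0 -> k i = k j -> i = j) ->
  \sum_i c i != 0 /\ vO P (c i0 / \sum_i c i).
Proof.
move=> nz0 valc injk; have Opi := vM_O prP Mpi.
case: (@arg_minnP _ i0 (fun i => c i != 0) k nz0) => i nz_i min_i.
have [_ Oci Oci'] := valc i nz_i.
have nz_piX m : pi ^+ m != 0 by rewrite expf_neq0.
have Mothers : vM P ((\sum_(j | j != i) c j) / c i).
  rewrite mulr_suml; apply: (vM_sum prP) => j ne_ji.
  have [-> | nz_j] := eqVneq (c j) 0; first by rewrite mul0r; apply: vM0.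
  have lt_ij : (k i < k j)%N.
    rewrite ltn_neqAle min_i // andbT; apply: contra_neqN ne_ji => /eqP eq_k.
    by apply: injk.
  have [_ Ocj _] := valc j nz_j.
  have -> : c j / c i = pi * (c j / pi ^+ k j * (pi ^+ (k j - (k i).+1) * (pi ^+ k i / c i))).
    have -> : pi ^+ k j = pi ^+ (k j - (k i).+1) * pi ^+ k i * pi.
      by rewrite -mulrA -exprSr -exprD subnK.
    by field; rewrite nz_i !nz_piX nz_pi.
  apply: (vMMr prP) => //; apply: (vOM prP) => //; apply: (vOM prP) => //.
  exact: vOX.
have DS : \sum_j c j = c i * (1 + (\sum_(j | j != i) c j) / c i).
  by rewrite mulrDr mulr1 mulrCA divff // mulr1 [LHS](bigD1 i).
have M'u : ~ vM P (1 + (\sum_(j | j != i) c j) / c i).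
  by move=> Mu; apply: (vM1 prP); rewrite -(addrK ((\sum_(j | j != i) c j) / c i) 1); apply: vMB.
have nz_u := vM_neq0 prP M'u.
split; first by rewrite DS mulf_neq0.
rewrite DS invfM mulrA; apply: (vOM prP); last exact: vO_unitV.
have [_ Oc0 _] := valc i0 nz0.
have -> : c i0 / c i = c i0 / pi ^+ k i0 * (pi ^+ (k i0 - k i) * (pi ^+ k i / c i)).
  have -> : pi ^+ k i0 = pi ^+ (k i0 - k i) * pi ^+ k i by rewrite -exprD subnK // min_i.
  by field; rewrite nz_i !nz_piX.
by apply: (vOM prP) => //; apply: (vOM prP) => //; apply: vOX.
Qed.

End Valuation.

Section Taylor.
Variables (P : algC -> Prop) (prP : prime_ideal P).

Lemma taylor2_vO (f : {poly algC}) x y : (forall i, vO P f`_i) -> vO P x -> vO P y ->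
  exists2 g, vO P g & f.[x] = f.[y] + f^`().[y] * (x - y) + (x - y) ^+ 2 * g.
Proof.
move=> Of Ox Oy; elim/poly_ind: f Of => [|f c IHf] Of.
  by exists 0; rewrite ?deriv0 ?horner0; [apply: vO0 | ring].
have Of' i : vO P f`_i by have := Of i.+1; rewrite coefD coefMX coefC addr0.
have [g Og Dg] := IHf Of'.
exists (f^`().[y] + x * g).
  apply: (vOD prP); last exact: vOM.
  rewrite horner_coef; apply: (vO_sum prP) => i _; rewrite coef_deriv -mulr_natr.
  by apply: (vOM prP); [apply: (vOM prP) => //; apply: vO_nat | apply: vOX].
rewrite derivD derivM derivX derivC !hornerE Dg; ring.
Qed.

Lemma deriv_congr_vO (f : {poly algC}) x y : (forall i, vO P f`_i) -> vO P x -> vO P y ->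
  exists2 g, vO P g & f^`().[x] - f^`().[y] = (x - y) * g.
Proof.
move=> Of Ox Oy; have Of' i : vO P f^`()`_i.
  by rewrite coef_deriv -mulr_natr; apply: (vOM prP) => //; apply: vO_nat.
have [g Og ->] := taylor2_vO Of' Ox Oy.
exists (f^`()^`().[y] + (x - y) * g); last by ring.
apply: (vOD prP); last by apply: (vOM prP) => //; apply: vOB.
rewrite horner_coef; apply: (vO_sum prP) => i _; rewrite coef_deriv -mulr_natr.
by apply: (vOM prP); [apply: (vOM prP) => //; apply: vO_nat | apply: vOX].
Qed.

(* Newton's iteration: an approximate root [rho] of [f] close to [x] is
   improved as soon as it is closer to [x] than the bound [b] on f'(x). *)
Lemma newton_step (F : algC -> Prop) (p : nat) (f : {poly algC}) (x rho b : algC) j :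
    is_subfield F -> prime p -> P p%:R ->
    (forall i, F f`_i) -> (forall i, vO P f`_i) -> vO P x -> F rho -> b != 0 -> vO P b ->
    f^`().[x] != 0 -> vO P (b / f^`().[x]) -> (0 < j)%N ->
    vO P (f.[x] / (b ^+ 2 * p%:R ^+ j.+1)) -> vO P ((x - rho) / (b * p%:R ^+ j)) ->
  exists2 rho', F rho' & vO P ((x - rho') / (b * p%:R ^+ j.+1)).
Proof.
move=> sfF pr_p Pp Ff Of Ox Frho nz_b Ob nz_f' Ob' j_gt0 Ofx Oxr.
have nz_p := p_neq0 pr_p; have nz_pX n : p%:R ^+ n != 0 :> algC by rewrite expf_neq0.
set z := (x - rho) / _ in Oxr.
have Dz : x - rho = b * p%:R ^+ j * z by rewrite /z mulrC divfK // mulf_neq0.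
have Orho : vO P rho.
  have -> : rho = x - b * p%:R ^+ j * z by rewrite -Dz; ring.
  apply: (vOB prP) => //; do 2!apply: (vOM prP) => //. by apply: (vOX prP); apply: (vO_nat prP).
have [g Og Dg] := taylor2_vO Of Ox Orho.
have [h Oh Dh] := deriv_congr_vO Of Ox Orho.
have M'u : ~ vM P (f^`().[rho] / f^`().[x]).
  move=> Mu; apply: (vM1 prP).
  have -> : 1 = f^`().[rho] / f^`().[x] + p%:R ^+ j * (z * h * (b / f^`().[x])).
    have -> : f^`().[rho] = f^`().[x] - (x - rho) * h by rewrite -Dh; ring.
    by rewrite Dz; field.
  apply: (vMD prP) => //; apply: (vMMr prP); first by apply: (vMX prP) => //; apply: vM_p.
  by do 2!apply: (vOM prP) => //.
have nz_f'r : f^`().[rho] != 0 by apply: contraNneq (vM_neq0 prP M'u) => ->; rewrite mul0r.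
have Ob'r : vO P (b / f^`().[rho]).
  have -> : b / f^`().[rho] = b / f^`().[x] * (f^`().[rho] / f^`().[x])^-1.
    by field; rewrite nz_f' nz_f'r.
  by apply: (vOM prP) => //; apply: vO_unitV.
have Fh (k : {poly algC}) : (forall i, F k`_i) -> F k.[rho].
  move=> Fk; rewrite horner_coef; apply: (subfield_sum sfF) => i _.
  by apply: (subfieldM sfF) => //; apply: (subfieldX sfF).
exists (rho - f.[rho] / f^`().[rho]).
  apply: (subfieldB sfF) => //; apply: (subfield_div sfF); apply: Fh => // i.
  by rewrite coef_deriv -mulr_natr; apply: (subfieldM sfF) => //; apply: subfield_nat.
have -> : (x - (rho - f.[rho] / f^`().[rho])) / (b * p%:R ^+ j.+1) =
    f.[x] / (b ^+ 2 * p%:R ^+ j.+1) * (b / f^`().[rho]) - p%:R ^+ j.-1 * (z ^+ 2 * g * (b / f^`().[rho])).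
  have -> : f.[rho] = f.[x] - f^`().[rho] * (x - rho) - (x - rho) ^+ 2 * g by rewrite Dg; ring.
  have -> : x - (rho - (f.[x] - f^`().[rho] * (x - rho) - (x - rho) ^+ 2 * g) / f^`().[rho]) =
     (f.[x] - (x - rho) ^+ 2 * g) / f^`().[rho] by field.
  rewrite Dz; have -> : p%:R ^+ j.+1 = p%:R * p%:R ^+ j :> algC by rewrite exprS.
  have -> : p%:R ^+ j = p%:R * p%:R ^+ j.-1 :> algC by rewrite -exprS prednK.
  have := nz_pX j.-1; set pj := p%:R ^+ j.-1 => nz_pj; field.
  by rewrite nz_f'r nz_b nz_pj nz_p.
apply: (vOB prP); first exact: vOM.
apply: (vOM prP); first by apply/(vOX prP)/vO_nat.
by do 2!apply: (vOM prP) => //; apply: vOX.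
Qed.

End Taylor.

(** The Eisenstein-type polynomial whose vanishing at [pi] expresses the expansion of pi^e / p in 1,
    pi, ..., pi^(e-1). With truncated digits a_i, [pi] is an approximate root. *)
Definition digit_poly (p e : nat) (a : nat -> algC) : {poly algC} :=
  'X^e - \sum_(i < e) (p%:R * a i) *: 'X^i.

Lemma coef_digit_poly p e a i :
  (digit_poly p e a)`_i = (i == e)%:R - (if (i < e)%N then p%:R * a i else 0).
Proof.
rewrite coefB coefXn coef_sum; congr (_ - _); case: ltnP => [lt_ie | le_ei].
  rewrite (bigD1 (Ordinal lt_ie)) //= coefZ coefXn eqxx mulr1 big1 ?addr0 // => j ne_ji.
  by rewrite coefZ coefXn eq_sym -[_ == _]/(j == Ordinal lt_ie) (negPf ne_ji) mulr0.
by rewrite big1 // => j _; rewrite coefZ coefXn gtn_eqF ?mulr0 // (leq_trans (ltn_ord j)).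
Qed.

Lemma size_digit_poly p e a : size (digit_poly p e a) = e.+1.
Proof.
apply/eqP; rewrite eqn_leq; apply/andP; split.
  apply/leq_sizeP => i lt_ei; rewrite coef_digit_poly gtn_eqF // ltnNge ltnW //= subrr //.
rewrite ltnNge; apply/negP=> /leq_sizeP/(_ e (leqnn e))/eqP.
by rewrite coef_digit_poly eqxx ltnn subr0 oner_eq0.
Qed.

Lemma monic_digit_poly p e a : digit_poly p e a \is monic.
Proof. by rewrite monicE lead_coefE size_digit_poly coef_digit_poly eqxx ltnn subr0. Qed.

(** The factor x of largest valuation works. Applied to the differences between [pi] and the roots
    of a polynomial, this turns a small value at [pi] into a nearby root. *)
Lemma vO_max_factor P (r : seq algC) c : prime_ideal P -> r != [::] -> c != 0 ->
  vO P ((\prod_(z <- r) z) / c) -> exists2 x, x \in r & vO P (x ^+ size r / c).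
Proof.
move=> prP nil'r nz_c Orc; have [r0 | r'0] := boolP (0 \in r).
  exists 0 => //; rewrite expr0n size_eq0 (negPf nil'r) mul0r; exact: vO0.
have [x rx maxx] : exists2 x, x \in r & forall z, z \in r -> vO P (x / z).
  elim: r nil'r r'0 {Orc} => // y r IHr _; rewrite inE negb_or eq_sym => /andP[nz_y r'0].
  have [-> | nil'r] := eqVneq r [::].
    by exists y; rewrite ?mem_head // => z; rewrite inE => /eqP->; rewrite divff //; apply: vO1.
  have [x rx maxx] := IHr nil'r r'0.
  have nz_x : x != 0 by apply: contraNneq r'0 => <-.
  have [Oxy | ] := vO_total prP (x / y).
    by exists x; [rewrite inE rx orbT | move=> z; rewrite inE => /predU1P[-> | /maxx]].
  rewrite invf_div => /(vM_O prP) Oyx; exists y; first exact: mem_head.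
  move=> z; rewrite inE => /predU1P[-> | /maxx Oxz]; first by rewrite divff //; apply: vO1.
  exact: (vO_div_trans prP nz_x).
exists x => //.
have -> : x ^+ size r / c = (\prod_(z <- r) (x / z)) * ((\prod_(z <- r) z) / c).
  rewrite mulrA -big_split /=; congr (_ / _).
  rewrite (eq_big_seq (fun=> x)); last first.
    by move=> z rz /=; rewrite divfK //; apply: contraNneq r'0 => <-.
  by rewrite big_const_seq count_predT -Monoid.iteropE.
apply: (vOM prP) => //; rewrite big_seq; exact: vO_prod.
Qed.

(** * Approximating a field of bounded local type within a fixed number field *)

Section LocalData.
Variables (P E F : algC -> Prop) (p : nat).
Hypotheses (prP : prime_ideal P) (pr_p : prime p) (Pp : P p%:R).
Hypotheses (sfE : is_subfield E) (sfF : is_subfield F).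
Variables (pi : algC) (e M d : nat).
Hypotheses (Epi : E pi) (nz_pi : pi != 0) (Mpi : vM P pi).
Hypothesis unif : forall y, E y -> vM P y -> vO P (y / pi).
Hypotheses (e_gt0 : (0 < e)%N) (le_ed : (e <= d)%N).
Hypotheses (Ope : vO P (p%:R / pi ^+ e)) (Oep : vO P (pi ^+ e / p%:R)).
Let q := (p ^ M)%N.
Hypotheses (M_gt0 : (0 < M)%N) (res : forall y, E y -> vO P y -> vM P (y ^+ q - y)).

Let val_p : has_val P pi p%:R e.
Proof. by split=> //; apply: p_neq0. Qed.

Lemma digits_vO N a : digits p M N a -> vO P a.
Proof.
move=> [t tq ->]; apply: (vO_sum prP) => j _; apply: (vOM prP); first exact/(vOX prP)/(vO_nat prP).
by apply: (vO_Aint prP); apply: (teich_Aint pr_p M_gt0).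
Qed.

(** Nonzero Teichmueller representatives are units, so the first nonzero digit decides, and the
    valuation is that of a power of p. *)
Lemma digits_val N a : digits p M N a -> a != 0 -> exists k, has_val P pi a (e * k).
Proof.
elim: N a => [|N IHN] a [t tq ->]; first by rewrite big_ord0 eqxx.
rewrite big_ord_recl mul1r; set a' := \sum_(i < N) p%:R ^+ i * t i.+1.
have Da' : digits p M N a' by exists (fun j => t j.+1).
have -> : \sum_(i < N) p%:R ^+ (lift ord0 i) * t (lift ord0 i) = p%:R * a'.
  by rewrite mulr_sumr; apply: eq_bigr => i _; rewrite exprS mulrA.
have [-> | nz_t0] := eqVneq (t 0%N) 0; last first.
  have Mpa : vM P (p%:R * a') by apply: (vMMr prP); [apply: (vM_p prP) | apply: (digits_vO Da')].
  have Ot0 : vO P (t 0%N) by apply: (vO_Aint prP); apply: (teich_Aint pr_p M_gt0).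
  exists 0%N; rewrite muln0; apply: (has_val_unit prP); first exact/(vOD prP)/(vM_O prP).
  move=> Ms; apply: (teich_unit prP pr_p M_gt0 (tq 0%N) nz_t0).
  by rewrite -(addrK (p%:R * a') (t 0%N)); apply: vMB.
rewrite add0r mulf_eq0 (negPf (p_neq0 pr_p)) /= => /(IHN _ Da')[k va'].
by exists k.+1; rewrite mulnS; apply: has_valM.
Qed.

(** Multiplied by [pi], the derivative becomes the sum of e pi^e and of the - p i a_i pi^i for 0 < i
    < e. Since e divides the valuations of p, of integers and of digits, the valuations of the
    nonzero terms are distinct modulo e: nothing cancels, and the derivative is at worst as small as
    e pi^(e-1). *)
Lemma digit_poly_deriv N a : (forall i, digits p M N (a i)) ->
  (digit_poly p e a)^`().[pi] != 0 /\
  vO P (e%:R * pi ^+ e.-1 / (digit_poly p e a)^`().[pi]).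
Proof.
move=> Da; set f' := _.[pi].
pose c (i : 'I_e) := if i == 0%N :> nat then e%:R * pi ^+ e else - (p%:R * (i%:R * a i * pi ^+ i)).
have Df' : f' * pi = \sum_i c i.
  have -> : f' = e%:R * pi ^+ e.-1 - \sum_(i < e) p%:R * a i * (pi ^+ i.-1 *+ i).
    rewrite /f' derivB derivXn hornerD hornerN hornerMn hornerXn mulr_natl; congr (_ - _).
    rewrite linear_sum /= horner_sum; apply: eq_bigr => i _.
    by rewrite derivZ derivXn hornerZ hornerMn hornerXn.
  rewrite mulrBl -mulrA -exprSr prednK // mulr_suml.
  rewrite (bigD1 (Ordinal e_gt0)) //= mulr0n mulr0 mul0r add0r -sumrN.
  rewrite [RHS](bigD1 (Ordinal e_gt0)) //=; congr (_ + _); apply: eq_bigr => i ne_i0.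
  have i_gt0 : (0 < i)%N by rewrite lt0n.
  rewrite /c -[_ == _]/(i == Ordinal e_gt0) (negPf ne_i0) -[in RHS](prednK i_gt0) exprSr prednK //.
  by rewrite -mulr_natr; ring.
have vc i : exists k, c i != 0 -> has_val P pi (c i) (e * k + i).
  rewrite /c; case: (eqVneq (i : nat) 0%N) => [i0 | ne_i0].
    have [k vk] := has_val_nat prP pr_p Pp val_p e_gt0.
    exists k.+1 => _; rewrite i0 addn0 mulnSr; apply: (has_valM prP) => //.
    by have := has_valX prP e (has_val_pi prP nz_pi); rewrite mul1n.
  have [-> | nz_ai] := eqVneq (a i) 0; first by exists 0%N; rewrite mulr0 mul0r mulr0 oppr0 eqxx.
  have [k vk] := has_val_nat prP pr_p Pp val_p (n := i) ltac:(by rewrite lt0n).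
  have [l vl] := digits_val (Da i) nz_ai.
  exists (k + l).+1 => _; apply: (has_valN prP); rewrite mulnS -addnA; apply: (has_valM prP) => //.
  rewrite mulnDr; apply: (has_valM prP); first exact: (has_valM prP).
  by have := has_valX prP i (has_val_pi prP nz_pi); rewrite mul1n.
have [k vk] := choice vc.
have nz_c0 : c (Ordinal e_gt0) != 0.
  by rewrite /c /= mulf_neq0 ?expf_neq0 // pnatr_eq0 -lt0n.
have [|nzS OS] := vO_sum_distinct_val prP nz_pi Mpi nz_c0 vk.
  move=> i j _ _ eq_k; apply/val_inj; have := congr1 (modn^~ e) eq_k.
  by rewrite !(mulnC e) !modnMDl !modn_small.
have nz_f' : f' != 0 by apply: contraNneq nzS; rewrite -Df' => ->; rewrite mul0r.
have De : pi ^+ e = pi ^+ e.-1 * pi by rewrite -exprSr prednK.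
split=> //; move: OS; rewrite -Df' /c /= De mulrA.
by rewrite -mulf_div divff // mulr1.
Qed.

Lemma vO_ppow_div_nat n : (0 < n <= d)%N -> vO P (p%:R ^+ d / n%:R).
Proof.
case/andP=> n_gt0 le_nd; have [m p'm Dn] := pfactor_coprime pr_p n_gt0.
have M'm : ~ vM P m%:R by move/(vM_nat prP pr_p Pp); apply/negP; rewrite -prime_coprime.
have le_ld : (logn p n <= d)%N by rewrite (leq_trans _ le_nd) // ltnW // ltn_logl.
have -> : p%:R ^+ d / n%:R = p%:R ^+ (d - logn p n) / m%:R :> algC.
  have -> : n%:R = m%:R * p%:R ^+ logn p n :> algC by rewrite {1}Dn natrM natrX.
  have -> : p%:R ^+ d = p%:R ^+ (d - logn p n) * p%:R ^+ logn p n :> algC by rewrite -exprD subnK.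
  by rewrite -mulf_div divff ?mulr1 // expf_neq0 ?(p_neq0 pr_p).
by apply: (vOM prP); [apply/(vOX prP)/(vO_nat prP) | apply: vO_unitV].
Qed.

Hypothesis Fteich : forall t, t ^+ q = t -> F t.
Hypothesis Froots : forall a, (forall i, digits p M (d * d.+2) (a i)) ->
  forall rho, root (digit_poly p e a) rho -> F rho.

(** A true root of one digit polynomial of fixed precision, which is in F, gives a first
    approximation. Newton's steps then use digit polynomials of growing precision; their
    coefficients are in F, so the approximations never leave F although the polynomial changes at
    each step. *)
Lemma uniformizer_vhat : vhat P p F pi.
Proof.
have nz_pX n : p%:R ^+ n != 0 :> algC by rewrite expf_neq0 ?(p_neq0 pr_p).
have Opi := vM_O prP Mpi.
have approx N : exists2 a, (forall i, digits p M N (a i)) &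
    vO P ((digit_poly p e a).[pi] / p%:R ^+ N.+1).
  have [||a Da Oa] := digits_expansion prP pr_p Pp sfE Epi nz_pi Mpi unif Oep M_gt0 res N (y := pi ^+ e / p%:R) => //.
    by apply/(subfield_div sfE); [apply: subfieldX | apply: subfield_nat].
  exists a => //.
  have -> : (digit_poly p e a).[pi] = p%:R * (pi ^+ e / p%:R - \sum_(i < e) a i * pi ^+ i).
    rewrite /digit_poly hornerD hornerN hornerXn horner_sum mulrBr mulrCA divff ?(p_neq0 pr_p) // mulr1.
    by rewrite mulr_sumr; congr (_ - _); apply: eq_bigr => i _; rewrite hornerZ hornerXn mulrA.
  by rewrite exprS; apply: (vO_divM prP) => //; rewrite divff ?(p_neq0 pr_p) //; apply: vO1.
(* A uniform bound for the derivative at [pi]: p^d is divisible by e since e <= d, and one more p by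
   pi^(e-1). *)
pose b : algC := p%:R ^+ d.+1.
(* The precision d (d + 2) is chosen so that (pi - rho)^e, for the closest root rho, is divisible by
   p^(e (d + 2)), and hence pi - rho by b p = p^(d+2). *)
have base : exists2 rho, F rho & vO P ((pi - rho) / (b * p%:R ^+ 1)).
  have [a Da Oa] := approx (d * d.+2)%N; set f := digit_poly p e a in Oa.
  have [r Dr] := closed_field_poly_normal f.
  rewrite (monicP (monic_digit_poly _ _ _)) scale1r in Dr.
  have sz_r : size r = e by have := size_digit_poly p e a; rewrite -/f Dr size_prod_XsubC => -[].
  have : vO P ((\prod_(z <- [seq pi - rho | rho <- r]) z) / p%:R ^+ (d * d.+2).+1).
    move: Oa; rewrite Dr horner_prod big_map; congr (vO P (_ / _)).
    by apply: eq_bigr => z _; rewrite hornerXsubC.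
  case/(vO_max_factor prP) => [|//|]; first by rewrite -size_eq0 size_map sz_r -lt0n.
  move=> _ /mapP[rho rrho ->]; rewrite size_map sz_r => Orho.
  exists rho; first by apply: (Froots Da); rewrite -/f Dr root_prod_XsubC.
  apply: (vO_rootX prP e_gt0); rewrite expr_div_n -exprD -exprM.
  by apply: (vO_ppowW prP pr_p _ Orho); nia.
have step j : (0 < j)%N -> exists2 rho, F rho & vO P ((pi - rho) / (b * p%:R ^+ j)).
  elim: j => // -[|j] IHj _; first exact: base.
  have [rho Frho Orho] := IHj isT.
  have [a Da Oa] := approx (d.+1 + d.+1 + j.+1)%N; set f := digit_poly p e a in Oa.
  have [nz_f' Of'] := digit_poly_deriv Da.
  have Ob' : vO P (b / f^`().[pi]).
    have -> : b / f^`().[pi] = p%:R ^+ d / e%:R * (p%:R / pi ^+ e * pi) * (e%:R * pi ^+ e.-1 / f^`().[pi]).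
      rewrite /b -(prednK e_gt0) !exprS prednK //; field.
      by rewrite nz_f' nz_pi expf_neq0 // pnatr_eq0 -lt0n e_gt0.
    apply: (vOM prP) => //; apply: (vOM prP); last exact: (vOM prP).
    by apply: vO_ppow_div_nat; rewrite e_gt0.
  have Fa i : F (a i).
    have [t tq ->] := Da i; apply: (subfield_sum sfF) => k _.
    by apply: (subfieldM sfF); [apply/(subfieldX sfF)/(subfield_nat sfF) | apply: Fteich].
  apply: (newton_step prP sfF pr_p Pp (f := f) (b := b)) Orho => // [i|i|||].
  - rewrite coef_digit_poly; apply: (subfieldB sfF); first exact: subfield_nat.
    by case: ifP => _; [apply: (subfieldM sfF) => //; apply: subfield_nat | apply: subfield0].
  - rewrite coef_digit_poly; apply: (vOB prP); first exact: vO_nat.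
    by case: ifP => _; [apply: (vOM prP); [apply: vO_nat | apply: digits_vO (Da i)] | apply: vO0].
  - exact: nz_pX.
  - by apply/(vOX prP)/(vO_nat prP).
  - by rewrite -exprM -exprD; apply: (vO_ppowW prP pr_p _ Oa); lia.
move=> N; have [//|rho Frho Orho] := step N.+1; exists rho => //.
by move: Orho; rewrite /b -exprD; apply: (vO_ppowW prP pr_p); lia.
Qed.

Lemma sub_local_vhat y : E y -> vhat P p F y.
Proof.
have sfFh := subfield_vhat prP pr_p Pp sfF.
move=> Ey; have [j Oj] := vO_archimedean prP pr_p Pp y.
have nz_pj : p%:R ^+ j != 0 :> algC by rewrite expf_neq0 ?(p_neq0 pr_p).
rewrite -(mulKf nz_pj y); apply: (subfieldM sfFh).
  by apply/(subfieldV sfFh)/(subfieldX sfFh)/(subfield_nat sfFh).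
apply: (vhat_idem prP) => N.
have Epy : E (p%:R ^+ j * y) by apply: (subfieldM sfE) => //; apply/(subfieldX sfE)/(subfield_nat sfE).
have [a Da Oa] := digits_expansion prP pr_p Pp sfE Epi nz_pi Mpi unif Oep M_gt0 res N Epy Oj.
exists (\sum_(i < e) a i * pi ^+ i) => //.
apply: (subfield_sum sfFh) => i _; apply: (subfieldM sfFh); last first.
  by apply: (subfieldX sfFh); apply: uniformizer_vhat.
apply: (sub_vhat p prP); have [t tq ->] := Da i; apply: (subfield_sum sfF) => k _.
by apply: (subfieldM sfF); [apply/(subfieldX sfF)/(subfield_nat sfF) | apply: Fteich].
Qed.

End LocalData.

Lemma number_field_of_seq (s : seq algC) :
  exists F D, [/\ is_subfield F, dimQ_le F D & forall x, x \in s -> F x].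
Proof.
have [Qs [QsC [s1 Ds1 _]]] := num_field_exists s.
exists (fun x => exists y, QsC y = x), (\dim {:Qs}); split.
- split; first by exists 0; rewrite rmorph0.
  + by exists 1; rewrite rmorph1.
  + by move=> _ _ [x <-] [y <-]; exists (x - y); rewrite rmorphB.
  + by move=> _ _ [x <-] [y <-]; exists (x * y); rewrite rmorphM.
  + by move=> _ [x <-]; exists x^-1; rewrite fmorphV.
- move=> m x Fx indep; have [y Dy] := choice Fx.
  have : free [tuple y i | i < m].
    apply/freeP => c c0; apply: indep.
    transitivity (QsC (\sum_(i < m) c i *: [tuple y i | i < m]`_i)); last by rewrite c0 rmorph0.
    rewrite rmorph_sum; apply: eq_bigr => i _.
    by rewrite rmorphZ_num -tnth_nth tnth_mktuple Dy.
  by rewrite /free size_tuple => /eqP <-; apply/dimvS/subvf.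
- by rewrite -Ds1 => _ /mapP[y _ ->]; exists y.
Qed.

(** F depends on p, M, d and N only: there are finitely many digits, hence finitely many digit
    polynomials of degree at most d, and their roots generate a number field with the digits. The
    guard excludes p^M = 1, for which every t would be a digit. *)
Lemma digit_number_field p M d N : exists F D, [/\ is_subfield F, dimQ_le F D,
  forall t : algC, t ^+ (p ^ M) = t -> (1 < p ^ M)%N -> F t &
  forall e a, (e <= d)%N -> (forall i, digits p M N (a i)) -> (1 < p ^ M)%N ->
    forall rho, root (digit_poly p e a) rho -> F rho].
Proof.
set q := (p ^ M)%N; pose roots (f : {poly algC}) := sval (closed_field_poly_normal f).
have mem_roots f x : f != 0 -> root f x -> x \in roots f.
  rewrite /roots; case: (closed_field_poly_normal f) => r /= Dr nz_f.
  by rewrite {1}Dr rootZ ?lead_coef_eq0 // root_prod_XsubC.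
pose T := roots ('X^q - 'X).
pose dig (g : {ffun 'I_N -> 'I_(size T)}) : algC := \sum_(j < N) p%:R ^+ j * T`_(g j).
pose pol e (h : {ffun 'I_e -> {ffun 'I_N -> 'I_(size T)}}) : {poly algC} :=
  'X^e - \sum_(i < e) (p%:R * dig (h i)) *: 'X^i.
pose S := T ++ flatten [seq flatten [seq roots (pol e h) | h : {ffun 'I_e -> {ffun 'I_N -> 'I_(size T)}}] | e <- iota 0 d.+1].
have [F [D [sfF dimF FS]]] := number_field_of_seq S.
have memT t : t ^+ q = t -> (1 < q)%N -> t \in T.
  move=> tq q_gt1; apply: mem_roots; last by rewrite /root !hornerE tq subrr.
  by rewrite -size_poly_eq0 size_polyDl ?size_polyXn // size_polyN size_polyX.
exists F, D; split=> // [t tq q_gt1|e a le_ed Da q_gt1 rho]; first by apply: FS; rewrite mem_cat memT.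
have Ddig i : exists g, a i = dig g.
  have [t tq ->] := Da i.
  have ltT j : (index (t j) T < size T)%N by rewrite index_mem memT.
  exists [ffun j : 'I_N => Ordinal (ltT j)]; apply: eq_bigr => j _.
  by rewrite ffunE /= nth_index // memT.
have [g Dg] := choice Ddig.
have -> : digit_poly p e a = pol e [ffun i : 'I_e => g i].
  by congr (_ - _); apply: eq_bigr => i _; rewrite ffunE Dg.
move=> fr; apply: FS; rewrite mem_cat; apply/orP; right.
apply/flattenP; eexists; first by apply/mapP; exists e; [rewrite mem_iota add0n ltnS | reflexivity].
apply/flattenP; eexists; first by apply/mapP; exists [ffun i : 'I_e => g i]; [rewrite mem_enum | reflexivity].
apply: mem_roots => //; apply: monic_neq0.
have -> : pol e [ffun i : 'I_e => g i] = digit_poly p e a; last exact: monic_digit_poly.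
by congr (_ - _); apply: eq_bigr => i _; rewrite ffunE Dg.
Qed.

(** * Powers modulo p^2 in a number field *)

Section FiniteResidues.
Variables (P F : algC -> Prop) (p D : nat).
Hypotheses (prP : prime_ideal P) (pr_p : prime p) (Pp : P p%:R).
Hypotheses (sfF : is_subfield F) (dimF : dimQ_le F D).

Let indep_mod_p r (g : 'I_r -> algC) :=
  forall c : 'I_r -> int, vO P ((\sum_i (c i)%:~R * g i) / p%:R) -> forall i, (p %| c i)%Z.

(** Take a family that is independent modulo p and of maximal length, which D bounds. Adding y
    creates a relation in which the coefficient of y is prime to p; a Bezout inverse [u] of it
    solves for y modulo p. *)
Lemma residue_generators : exists r (g : 'I_r -> algC),
  [/\ (r <= D)%N, forall i, F (g i) /\ vO P (g i) &
      forall y, F y -> vO P y ->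
        exists c : {ffun 'I_r -> 'I_p}, vO P ((y - \sum_i (c i)%:R * g i) / p%:R)].
Proof.
pose has_indep r := `[< exists g : 'I_r -> algC, (forall i, F (g i) /\ vO P (g i)) /\ indep_mod_p g >].
have h0 : exists r, has_indep r.
  by exists 0%N; apply/asboolP; exists (fun=> 0); split=> [i|c _ i]; have := ltn_ord i.
have hD r : has_indep r -> (r <= D)%N.
  by move=> /asboolP[g [Fg ig]]; apply: (independent_mod_p_dim prP pr_p dimF _ ig) => i; case: (Fg i).
have [r /asboolP[g [Fg ig]] maxr] := ex_maxnP h0 hD.
exists r, g; split=> // [|y Fy Oy]; first by apply: (independent_mod_p_dim prP pr_p dimF _ ig) => i; case: (Fg i).
pose g' (i : 'I_r.+1) := if unlift ord0 i is Some j then g j else y.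
have nig : ~ indep_mod_p g'.
  move=> ig'; suffices /maxr : has_indep r.+1 by rewrite ltnn.
  apply/asboolP; exists g'; split=> // i.
  by rewrite /g'; case: unliftP => // j _; apply: Fg.
have {nig}[c [Oc [i p'ci]]] : exists c : 'I_r.+1 -> int,
    vO P ((\sum_i (c i)%:~R * g' i) / p%:R) /\ exists i, ~~ (p %| c i)%Z.
  apply: contrapT => /forallNP nc; apply: nig => c Oc i.
  by apply: contrapT => /negP p'ci; apply: (nc c); split=> //; exists i.
have g'0 : g' ord0 = y by rewrite /g' unlift_none.
have g'S j : g' (lift ord0 j) = g j by rewrite /g' liftK.
move: Oc; rewrite big_ord_recl g'0.
under eq_bigr do rewrite g'S.
move=> Oc; have p'c0 : ~~ (p %| c ord0)%Z.
  apply/negP=> pc0; have /ig pc : vO P ((\sum_i (c (lift ord0 i))%:~R * g i) / p%:R).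
    have := vO_divB prP Oc (b := (c ord0)%:~R * y); rewrite addrAC subrr add0r; apply.
    have /dvdzP[k ->] := pc0; rewrite intrM mulrAC mulfK ?(p_neq0 pr_p) //.
    by apply: (vOM prP) => //; apply: vO_int.
  move: p'ci; case: (unliftP ord0 i) => [j -> | ->]; last by rewrite pc0.
  by rewrite pc.
have [u [v Duv]] : exists u v : int, u * c ord0 + v * p = 1.
  have [u [v Duv]] := Bezoutz (c ord0) p; exists u, v; rewrite Duv.
  apply/eqP; rewrite -[_ == 1]/(coprimez (c ord0) p) coprimez_sym.
  by rewrite /coprimez /gcdz /= -[_ == 1]/(coprime p `|c ord0|) prime_coprime.
have p_gt0 := prime_gt0 pr_p.
pose b j := (- u * c (lift ord0 j))%R.
have ltb j : (`|(b j %% p)%Z| < p)%N.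
  by rewrite -ltz_nat gez0_abs ?modz_ge0 ?ltz_pmod // -lt0n.
exists [ffun j => Ordinal (ltb j)].
have Db j : (b j)%:~R = (b j %/ p)%Z%:~R * p%:R + (absz (b j %% p)%Z)%:R :> algC.
  rewrite {1}(divz_eq (b j) p) intrD intrM; congr (_ + _).
  by rewrite -[RHS]/((absz (b j %% p)%Z)%:~R) gez0_abs // modz_ge0 // -lt0n.
have -> : y - \sum_i ([ffun j => Ordinal (ltb j)] i)%:R * g i =
    u%:~R * ((c ord0)%:~R * y + \sum_i (c (lift ord0 i))%:~R * g i)
    + p%:R * (v%:~R * y + \sum_i (b i %/ p)%Z%:~R * g i).
  have -> : \sum_i ([ffun j => Ordinal (ltb j)] i)%:R * g i =
     \sum_i (b i)%:~R * g i - p%:R * \sum_i (b i %/ p)%Z%:~R * g i.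
    rewrite mulr_sumr -sumrB; apply: eq_bigr => j _; rewrite ffunE Db /=; ring.
  have -> : \sum_i (b i)%:~R * g i = - (u%:~R * \sum_i (c (lift ord0 i))%:~R * g i).
    by rewrite mulr_sumr -sumrN; apply: eq_bigr => j _; rewrite /b intrM rmorphN /=; ring.
  have D1 : y = (u%:~R * (c ord0)%:~R + v%:~R * p%:R) * y.
    by rewrite -[p%:R]/(p%:~R) -!intrM -intrD Duv mul1r.
  by rewrite {1}D1; ring.
apply: (vO_divD prP); first by apply: (vO_divMl prP) => //; apply: vO_int.
rewrite mulrC mulKf ?(p_neq0 pr_p) //; apply: (vOD prP).
  by apply: (vOM prP) => //; apply: vO_int.
by apply: (vO_sum prP) => j _; apply: (vOM prP); [apply: vO_int | case: (Fg j)].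
Qed.

(** Expanding an element modulo p, and then the remainder divided by p, leaves at most p^(2D)
    classes modulo p^2, fewer than the powers considered. *)
Lemma residue_power_coincidence y : F y -> vO P y ->
  exists i j, (i < j <= p ^ (D + D))%N /\ vO P ((y ^+ j - y ^+ i) / p%:R ^+ 2).
Proof.
have [r [g [le_rD Fg gen]]] := residue_generators => Fy Oy.
have nz_p := p_neq0 pr_p.
have expand z : exists cc : {ffun 'I_r -> 'I_p} * {ffun 'I_r -> 'I_p}, F z -> vO P z ->
    vO P ((z - \sum_i (cc.1 i)%:R * g i - p%:R * \sum_i (cc.2 i)%:R * g i) / p%:R ^+ 2).
  have gt0 := prime_gt0 pr_p; have c0 : {ffun 'I_r -> 'I_p} by exact: [ffun=> Ordinal gt0].
  have [[Fz Oz] | nz] := pselect (F z /\ vO P z); last by exists (c0, c0) => Fz Oz; case: nz.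
  have [c Oc] := gen z Fz Oz.
  have Fgc : F (\sum_i (c i)%:R * g i).
    by apply: (subfield_sum sfF) => i _; apply: (subfieldM sfF); [apply: subfield_nat | case: (Fg i)].
  have [|b Ob] := gen _ _ Oc.
    by apply: (subfield_div sfF); [apply: (subfieldB sfF) | apply: subfield_nat].
  exists (c, b) => _ _ /=; set S := \sum_i _ in Ob *; set S' := \sum_i _ in Ob *.
  by have -> : (z - S - p%:R * S') / p%:R ^+ 2 = ((z - S) / p%:R - S') / p%:R by field.
have [cc Dcc] := choice expand.
pose h (k : 'I_(p ^ (D + D)).+1) := cc (y ^+ k).
have /injectivePn[i [j ne_ij hij]] : ~~ injectiveb h.
  apply/negP=> /injectiveP/leq_card; rewrite card_prod !card_ffun !card_ord -expnD.
  by rewrite leqNgt ltnS leq_pexp2l ?prime_gt0 // leq_add.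
wlog lt_ij : i j ne_ij hij / (i < j)%N.
  by move=> IH; case: (ltngtP i j) => [|/(IH j i)|/ord_inj/eqP]; [exact: IH | rewrite eq_sym; exact | rewrite (negPf ne_ij)].
exists i, j; split; first by rewrite lt_ij -ltnS ltn_ord.
have Oyk k := Dcc (y ^+ k) (subfieldX sfF k Fy) (vOX prP k Oy).
have := vO_divB prP (Oyk j) (Oyk i); rewrite -/(h i) -/(h j) hij.
by congr (vO P (_ / _)); ring.
Qed.

(** The pair (i, j) depends on y, but A is at least i and A! is a multiple of j - i, so these two
    exponents serve for every y and every P. *)
Lemma residue_power_period y (A := (p ^ (D + D))%N) : F y -> vO P y ->
  vO P ((y ^+ (A + A`!) - y ^+ A) / p%:R ^+ 2).
Proof.
move=> Fy Oy; have [i [j [/andP[lt_ij le_jA] Oij]]] := residue_power_coincidence Fy Oy.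
have /dvdnP[k Dk] : (j - i %| A`!)%N by apply: dvdn_fact; rewrite subn_gt0 lt_ij (leq_trans (leq_subr _ _)).
have -> : y ^+ (A + A`!) - y ^+ A = y ^+ (A - i) * (y ^+ i * (y ^+ (A`!) - 1)).
  by rewrite mulrA -exprD subnK; [rewrite exprD; ring | lia].
apply: (vO_divMl prP); first exact: vOX.
rewrite Dk mulnC exprM subrX1 mulrA.
have -> : y ^+ i * (y ^+ (j - i) - 1) = y ^+ j - y ^+ i.
  by rewrite mulrBr -exprD subnKC ?mulr1 // ltnW.
rewrite [X in X / _]mulrC; apply: (vO_divMl prP) => //.
by apply: (vO_sum prP) => l _; rewrite -exprM; apply: vOX.
Qed.

End FiniteResidues.

(** The completion of E at P has ramification index e <= d over Q_p, and its residue field lies in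
    the one with p^M elements. *)
Definition bounded_local (P : algC -> Prop) (p d M : nat) (E : algC -> Prop) : Prop :=
  is_subfield E /\ exists pi e,
   [/\ [/\ E pi, pi != 0, vM P pi & forall y, E y -> vM P y -> vO P (y / pi)],
       (0 < e <= d)%N, vO P (p%:R / pi ^+ e), vO P (pi ^+ e / p%:R) &
       forall y, E y -> vO P y -> vM P (y ^+ (p ^ M) - y)].

Lemma compositum_subfield (H : nat -> algC -> Prop) : is_subfield (compositum H).
Proof.
split=> [F sfF HF | F sfF HF | x y Lx Ly F sfF HF | x y Lx Ly F sfF HF | x Lx F sfF HF].
- exact: subfield0.
- exact: subfield1.
- by apply: (subfieldB sfF); [apply: Lx | apply: Ly].
- by apply: (subfieldM sfF); [apply: Lx | apply: Ly].
- by apply: (subfieldV sfF); apply: Lx.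
Qed.

(** The field F, hence a and b, is chosen before P and the H n. As [vhat P p F] is a field
    containing each H n, it contains their compositum; an x there is close enough to an element of F
    to inherit its congruence. *)
Theorem local_power_congruence (p d M : nat) : prime p -> (0 < M)%N ->
  exists a b, (a < b)%N /\ forall P, prime_ideal P -> P p%:R ->
    forall H, (forall n, bounded_local P p d M (H n)) ->
    forall x, compositum H x -> vO P x -> vO P ((x ^+ b - x ^+ a) / p%:R ^+ 2).
Proof.
move=> pr_p M_gt0; have q_gt1 : (1 < p ^ M)%N by rewrite -{1}(expn0 p) ltn_exp2l ?prime_gt1.
have [F [D [sfF dimF Fteich Froots]]] := digit_number_field p M d (d * d.+2).
pose A := (p ^ (D + D))%N; exists A, (A + A`!)%N; split; first by rewrite -[X in (X < _)%N]addn0 ltn_add2l fact_gt0.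
move=> P prP Pp H locH x Lx Ox.
have Fx : vhat P p F x.
  apply: Lx; first exact: subfield_vhat.
  move=> n y Hy; have [sfH [pi [e [[Hpi nz_pi Mpi unif] /andP[e_gt0 le_ed] Ope Oep res]]]] := locH n.
  apply: (sub_local_vhat prP pr_p Pp sfH sfF Hpi nz_pi Mpi unif e_gt0 le_ed Ope Oep M_gt0 res) => //.
    by move=> t tq; apply: Fteich.
  by move=> a Da; apply: Froots.
have [y Fy Oxy] := Fx 2%N.
have Oy : vO P y.
  have -> : y = x - p%:R ^+ 2 * ((x - y) / p%:R ^+ 2) by field; rewrite (p_neq0 pr_p).
  by apply: (vOB prP) => //; apply: (vOM prP) => //; apply/(vOX prP)/(vO_nat prP).
have -> : x ^+ (A + A`!) - x ^+ A = (x ^+ (A + A`!) - y ^+ (A + A`!)) - (x ^+ A - y ^+ A)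
   + (y ^+ (A + A`!) - y ^+ A) by ring.
apply: (vO_divD prP); last exact: (residue_power_period prP pr_p sfF dimF).
by apply: (vO_divB prP); apply: (vO_expB_div prP) => //.
Qed.

(** * Galois number fields *)

Lemma splitting_num_field (s : seq algC) :
  exists (L : splittingFieldType rat) (iota : {rmorphism L -> algC}),
    galois 1 {:L} /\ forall x, x \in s -> exists y, iota y = x.
Proof.
pose g : {poly rat} := \prod_(x <- s) minQpoly x.
pose r := flatten [seq conjugates x | x <- s].
have Dg : map_poly ratr g = \prod_(z <- r) ('X - z%:P) :> {poly algC}.
  rewrite /g /r; elim: (s) => [|x s' IHs] /=; first by rewrite !big_nil rmorph1.
  rewrite big_cons big_cat rmorphM /= IHs; congr (_ * _).
  rewrite /minQpoly /conjugates; case: (minCpolyP x) => q /= [<- _] _.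
  case: (closed_field_poly_normal _) => t /= {1}->.
  by rewrite (monicP (minCpoly_monic x)) scale1r.
have [Qs [QsC [s1 Ds1 gens1]]] := num_field_exists r.
pose p : {poly Qs} := map_poly (in_alg Qs) g.
have Dp : p = \prod_(y <- s1) ('X - y%:P).
  apply: (map_poly_inj QsC); rewrite rmorph_prod /= -(eq_bigr _ (fun y _ => esym (map_polyXsubC _ y))).
  rewrite -map_poly_comp -(eq_map_poly (f := ratr)) ?Dg -?Ds1 ?big_map //.
  by move=> a /=; rewrite rmorphZ_num rmorph1 mulr1.
have Q_p : p \is a polyOver 1%AS.
  by apply/polyOverP=> i; rewrite coef_map /= memvZ ?mem1v.
have split_p : splittingFieldFor 1 p {:Qs} by exists s1; rewrite // -Dp eqpxx.
have Qs_ax : FieldExt_isSplittingField _ Qs by constructor; exists p.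
exists (HB.pack_for (splittingFieldType rat) Qs Qs_ax), QsC; split.
  rewrite /galois sub1v normalFieldf andbT /=.
  by apply/separableP => y _; apply: pcharf0_separable => k; rewrite pchar_lalg pchar_num.
move=> x sx; suffices: x \in r by rewrite -Ds1 => /mapP[y _ ->]; exists y.
apply/flattenP; exists (conjugates x); first exact: map_f.
have := root_minCpoly x; rewrite /conjugates.
case: (closed_field_poly_normal _) => t /= ->.
by rewrite (monicP (minCpoly_monic x)) scale1r root_prod_XsubC.
Qed.

Lemma aut_of_conjugate (x z : algC) : root (minCpoly x) z ->
  exists s : {rmorphism algC -> algC}, s x = z.
Proof.
move=> xz; have [L [iota [galL mem_L]]] := splitting_num_field [:: x; z].
have [x' Dx] := mem_L x (mem_head _ _).
have [z' Dz] : exists z', iota z' = z by apply: mem_L; rewrite !inE eqxx orbT.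
have pz' : root (minPoly 1 x') z'.
  have [a Da] := choice (fun i => vlineP _ _ (polyOverP (minPolyOver 1%AS x') i)).
  pose r : {poly rat} := \poly_(i < size (minPoly 1 x')) a i.
  have Dr : map_poly iota (minPoly 1 x') = map_poly ratr r.
    apply/polyP=> i; rewrite !coef_map coef_poly /=; case: ltnP => [_ | le_i].
      by rewrite Da alg_num_field fmorph_rat.
    by rewrite nth_default // !rmorph0.
  rewrite -(fmorph_root iota) Dr Dz.
  have := root_minPoly 1 x'; rewrite -(fmorph_root iota) Dr Dx.
  have [q [Dq _] ->] := minCpolyP x; rewrite Dq in xz => /dvdpP[k ->].
  by rewrite rmorphM rootM xz orbT.
have [g _ Dg] := normalField_root_minPoly (sub1v _) (normalFieldf 1) (memvf x') pz'.
have [s Ds] := extend_algC_subfield_aut iota g.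
by exists s; rewrite -Dx -Dz -Dg; apply/esym/Ds.
Qed.

(** * The height inequality *)

Section HeightGap.
Variable x : algC.
Let s := conjugates x.
Let c := minZlead x.

Lemma minCpoly_conjugates : minCpoly x = \prod_(z <- s) ('X - z%:P).
Proof.
rewrite /s /conjugates; case: (closed_field_poly_normal _) => t /= {1}->.
by rewrite (monicP (minCpoly_monic x)) scale1r.
Qed.

Lemma size_conjugates : size s = alg_degree x.
Proof. by rewrite /alg_degree minCpoly_conjugates size_prod_XsubC. Qed.

Lemma minZlead_gt0 : (0 < c)%N.
Proof.
rewrite /c /minZlead; apply: (big_ind (fun m => 0 < m)%N) => // [m n|q _].
  by rewrite lcmn_gt0 => -> ->.
by rewrite absz_gt0 denq_neq0.
Qed.

Lemma minZpoly_exists : exists f : {poly int}, map_poly intr f = c%:R *: minCpoly x.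
Proof.
pose q := minQpoly x; have Dq : minCpoly x = map_poly ratr q.
  by rewrite /q /minQpoly; case: (minCpolyP x) => r /= [].
have int_cq i : exists m : int, m%:~R = c%:R * q`_i.
  have [lt_i | le_i] := ltnP i (size q); last by exists 0; rewrite nth_default // mulr0.
  have /dvdnP[k Dk] : (`|denq q`_i| %| c)%N.
    rewrite /c /minZlead -/q (big_rem q`_i) /=; first exact: dvdn_lcml.
    exact: mem_nth.
  exists (k%:Z * numq q`_i); rewrite Dk intrM numqE natrM -[(absz _)%:R]/((absz _)%:~R).
  by rewrite absz_denq; ring.
have [m Dm] := choice int_cq.
exists (\poly_(i < size q) m i); apply/polyP=> i; rewrite coefZ Dq !coef_map coef_poly /=.
case: ltnP => [_ | le_i]; last by rewrite nth_default // !rmorph0 mulr0.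
have -> : (m i)%:~R = ratr (m i)%:~R :> algC by rewrite ratr_int.
by rewrite Dm rmorphM /= ratr_nat.
Qed.
Hypothesis x_neq0 : x != 0.

Lemma conjugates_aut z : z \in s -> exists t : {rmorphism algC -> algC}, t x = z.
Proof. by move=> sz; apply: aut_of_conjugate; rewrite minCpoly_conjugates root_prod_XsubC. Qed.

Lemma companion_exists (h : {poly int}) m : h \is monic -> size h = m.+2 ->
  exists A : 'M[int]_m.+1, char_poly A = h.
Proof.
move=> mon_h sz_h; have := companionmxK mon_h; move: (companionmx h).
by rewrite sz_h /= => A DA; exists A.
Qed.

(* This is the determinant of c * minCpoly x evaluated at the companion matrix of h. *)
Lemma conjugates_resultant_int (h : {poly int}) m : h \is monic -> size h = m.+2 ->
  c%:R ^+ m.+1 * \prod_(z <- s) (map_poly intr h).[z] \is a Num.int.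
Proof.
move=> mon_h sz_h; have [A DA] := companion_exists mon_h sz_h.
have [f Df] := minZpoly_exists.
pose B : 'M[algC]_m.+1 := map_mx intr A.
have Dh z : (map_poly intr h).[z] = (-1) ^+ m.+1 * \det (B - z%:M).
  rewrite -DA map_char_poly -/B /char_poly -horner_evalE -det_map_mx.
  rewrite -detZ scaleN1r opprB; congr (\det _); apply/matrixP=> i j.
  by rewrite !mxE /= horner_evalE !hornerE /= hornerMn hornerX.
have -> : c%:R ^+ m.+1 * \prod_(z <- s) (map_poly intr h).[z] =
    (-1) ^+ (m.+1 * size s) * \det (horner_mx B (map_poly intr f)).
  rewrite (eq_bigr _ (fun z _ => Dh z)) big_split /= big_const_seq count_predT.
  rewrite Df linearZ /= detZ minCpoly_conjugates rmorph_prod /=.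
  have -> : \det (\prod_(z <- s) horner_mx B ('X - z%:P)) = \prod_(z <- s) \det (B - z%:M).
    elim: s => [|z t IHt]; first by rewrite !big_nil det1.
    by rewrite !big_cons -IHt -det_mulmx rmorphB /= horner_mx_X horner_mx_C.
  rewrite exprM iter_mulr_1; ring.
rewrite rpredM ?rpredX ?rpredN ?rpred1 //.
have -> : horner_mx B (map_poly intr f) = map_mx intr (horner_mx A f).
  by rewrite map_horner_mx.
by rewrite det_map_mx intr_int.
Qed.

End HeightGap.

Lemma prime_ideal_over (p : nat) : prime p -> exists2 P, prime_ideal P & P p%:R.
Proof.
move=> pr_p; have [||P prP SP] := @prime_ideal_exists (fun x => x = p%:R); last by exists P; last exact: SP.
  by move=> x ->; rewrite rpred_nat.
case=> s Ps D1; have nz_p := p_neq0 pr_p.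
have {}D1 : p%:R^-1 = \sum_(u <- s) u.1.
  apply: (mulIf nz_p); rewrite mulVf // [LHS]D1 mulr_suml !big_seq.
  by apply: eq_bigr => u /Ps[_ ->].
have Ap : p%:R^-1 \in Aint by rewrite D1 big_seq rpred_sum // => u /Ps[].
have /Cint_rat_Aint/(_ Ap)/intrP[m Dm] : p%:R^-1 \in Crat.
  by apply/CratP; exists p%:R^-1; rewrite fmorphV rmorph_nat.
have /eqP : (m * p%:Z)%:~R = 1%:~R :> algC by rewrite intrM -Dm mulVf.
rewrite eqr_int => /eqP/(congr1 absz); rewrite abszM /= => /eqP.
by rewrite muln_eq1 => /andP[_ /eqP p1]; rewrite p1 in pr_p.
Qed.

Lemma vO_int_ppow_dvd (P : algC -> Prop) (p : nat) (r : int) m :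
  prime_ideal P -> prime p -> P p%:R -> vO P (r%:~R / p%:R ^+ m) -> ((p ^ m)%N %| r)%Z.
Proof.
move=> prP pr_p Pp; have nz_p := p_neq0 pr_p.
elim: m r => [|m IHm] r; first by rewrite dvd1z.
move=> Or; have /dvdzP[r1 Dr] : (p %| r)%Z.
  apply/(vM_int prP pr_p Pp).
  have -> : r%:~R = r%:~R / p%:R ^+ m.+1 * p%:R ^+ m.+1 :> algC by rewrite divfK ?expf_neq0.
  by apply: (vMMl prP) => //; apply: (vMX prP) => //; apply: vM_ideal.
have /IHm/dvdzP[k Dk] : vO P (r1%:~R / p%:R ^+ m).
  by move: Or; rewrite Dr intrM exprSr -mulf_div divff ?mulr1.
by apply/dvdzP; exists k; rewrite Dr Dk expnSr PoszM mulrA.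
Qed.

Lemma ler1_max (y : algC) : 1 <= Num.max 1 `|y| /\ `|y| <= Num.max 1 `|y|.
Proof.
rewrite /Num.max /Order.max; case: ifP => [/ltW // | /negbT].
by rewrite -real_leNgt // ?normr_real.
Qed.

(** * From the power congruence to a gap for the height *)

Section HeightBound.
Variables (L : algC -> Prop) (p a b : nat).
Hypotheses (pr_p : prime p) (lt_ab : (a < b)%N) (sfL : is_subfield L).
Hypothesis local : forall P, prime_ideal P -> P p%:R -> forall x, L x -> vO P x ->
  vO P ((x ^+ b - x ^+ a) / p%:R ^+ 2).

(** Let R be c^(a+b) times the product of z^b - z^a over the n conjugates z. It is c^a times a
    resultant, hence an integer, and is nonzero as x is not a root of unity. The congruences make it
    divisible by p^(2n), whereas its absolute value is at most 2^n times the Mahler measure to the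
    power a + b. *)
Lemma mahler_lower_bound x : L x -> x != 0 -> ~ root_of_unity x ->
  (p ^ 2)%:R ^+ alg_degree x <= 2 ^+ alg_degree x * mahler x ^+ (a + b).
Proof.
move=> Lx nz_x nroot_x; have [P prP Pp] := prime_ideal_over pr_p.
set s := conjugates x; set c := minZlead x; set n := alg_degree x.
have sz_s : size s = n := size_conjugates x.
have nz_p2 : p%:R ^+ 2 != 0 :> algC by rewrite expf_neq0 ?(p_neq0 pr_p).
have nz_z z : z \in s -> z != 0.
  by move=> /(conjugates_aut (x := x))[t <-]; rewrite fmorph_eq0.
pose S := [seq z <- s | ~~ `[< vO P z >]]; pose T := [seq z <- s | `[< vO P z >]].
(* For z not integral at P, the congruence is used for 1/z, and z^b - z^a = z^(a+b) (z^(-a) -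
   z^(-b)). The stray powers z^(a+b) are absorbed by c^(a+b), because c times the product of these z
   is integral. *)
pose phi z := if `[< vO P z >] then z ^+ b - z ^+ a else z^-1 ^+ a - z^-1 ^+ b.
have Ophi z : z \in s -> vO P (phi z / p%:R ^+ 2).
  move=> /(conjugates_aut (x := x))[t Dz]; rewrite /phi.
  have prPt := prime_ideal_comap prP t.
  have Ppt : P (t p%:R) by rewrite rmorph_nat.
  have tE y : vO (fun w => P (t w)) ((y ^+ b - y ^+ a) / p%:R ^+ 2) ->
      vO P ((t y ^+ b - t y ^+ a) / p%:R ^+ 2).
    by move/vO_comap; rewrite fmorph_div rmorphB !rmorphXn rmorph_nat.
  have O_t y : L y -> vO P (t y) -> vO P ((t y ^+ b - t y ^+ a) / p%:R ^+ 2).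
    move=> Ly Oty; apply/tE/(local prPt) => //.
    have [// | [u [v [Pu Av P'v Dy]]]] := vO_total prPt y.
    have [-> | nz_y] := eqVneq y 0; first exact: vO0.
    have nz_ty : (t y)^-1 != 0 by rewrite invr_eq0 fmorph_eq0.
    case: (@vM_V P prP _ nz_ty); last by rewrite invrK.
    by exists (t u), (t v); rewrite -fmorphV Dy fmorph_div Aint_aut.
  rewrite -Dz; case: asboolP => [Oz | O'z]; first exact: O_t.
  rewrite -opprB mulNr; apply: (vON prP); rewrite -fmorphV; apply: O_t; first exact: subfieldV.
  by case: (vO_total prP (t x)) => // /(vM_O prP); rewrite fmorphV.
have DR : \prod_(z <- s) (z ^+ b - z ^+ a) = (\prod_(z <- S) z) ^+ (a + b) * \prod_(z <- s) phi z.
  have -> : (\prod_(z <- S) z) ^+ (a + b) = \prod_(z <- s) (if ~~ `[< vO P z >] then z ^+ (a + b) else 1).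
    by rewrite /S -prodrXl big_filter big_mkcond.
  rewrite -big_split /=.
  rewrite [LHS]big_seq [RHS]big_seq; apply: eq_bigr => z sz.
  rewrite /phi; case: asboolP => [_ | _] /=; first by rewrite mul1r.
  rewrite exprD !exprVn; field; rewrite !expf_neq0 ?nz_z //.
have AcS : c%:R * \prod_(z <- S) z \in Aint.
  apply: (@Aint_lead_coef_prod _ S T).
  have -> : \prod_(z <- S ++ T) ('X - z%:P) = minCpoly x.
    rewrite minCpoly_conjugates; apply: perm_big; rewrite perm_catC.
    exact: permEl (perm_filterC _ _).
  have [f <-] := minZpoly_exists x.
  by apply/polyOverP=> i; rewrite coef_map /= Aint_int.
set R := c%:R ^+ (a + b) * \prod_(z <- s) (z ^+ b - z ^+ a).
have OR : vO P (R / p%:R ^+ (2 * n)).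
  have -> : R / p%:R ^+ (2 * n) = (c%:R * \prod_(z <- S) z) ^+ (a + b) * \prod_(z <- s) (phi z / p%:R ^+ 2).
    rewrite /R DR big_split /= big_const_seq count_predT iter_mulr_1 sz_s exprMn -exprVn -exprVn -!exprM.
    by rewrite exprVn; ring.
  apply: (vOM prP); first exact/(vOX prP)/(vO_Aint prP).
  by rewrite big_seq; apply: (vO_prod prP).
have /intrP[r Dr] : R \is a Num.int.
  rewrite /R exprD -mulrA rpredM ?rpredX ?rpred_nat //.
  have [b' Db] : exists b', b = b'.+1 by case: (b) lt_ab => // b' _; exists b'.
  pose h : {poly int} := 'X^b - 'X^a.
  have sz_h : size h = b'.+2.
    by rewrite /h size_polyDl ?size_polyXn ?Db // size_polyN size_polyXn ltnS -Db.
  have mon_h : h \is monic.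
    rewrite monicE lead_coefE sz_h /= /h coefB !coefXn -Db eqxx gtn_eqF ?subr0 //.
  have <- : \prod_(z <- s) (map_poly intr h).[z] = \prod_(z <- s) (z ^+ b - z ^+ a).
    by apply: eq_bigr => z _; rewrite rmorphB /= !map_polyXn !hornerE.
  by have := conjugates_resultant_int x mon_h sz_h; rewrite -Db.
have nz_R : R != 0.
  rewrite mulf_neq0 ?expf_neq0 // ?pnatr_eq0 -?lt0n ?minZlead_gt0 //.
  rewrite prodf_seq_neq0; apply/allP=> z sz; have [t Dz] := conjugates_aut sz.
  apply/eqP=> z_root; apply: nroot_x; exists (b - a)%N; split; first by rewrite subn_gt0.
  apply: (fmorph_inj t); rewrite rmorph1 rmorphXn Dz.
  apply: (mulfI (expf_neq0 a (nz_z z sz))); rewrite mulr1 -exprD subnKC ?(ltnW lt_ab) //.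
  by apply/eqP; rewrite -subr_eq0 z_root.
have le_pR : (p ^ 2)%:R ^+ n <= `|R|.
  rewrite Dr in OR nz_R *; have := vO_int_ppow_dvd prP pr_p Pp OR.
  rewrite -natrX -expnM -intr_norm => dv.
  have : (p ^ (2 * n) <= `|r|)%N.
    by rewrite dvdn_leq // absz_gt0; rewrite intr_eq0 in nz_R.
  by rewrite -(ler_nat algC) natr_absz.
apply: le_trans le_pR _; rewrite /R /mahler -/c -/s exprMn normrM normrX normr_nat.
rewrite mulrCA ler_wpM2l ?exprn_ge0 ?ler0n //.
rewrite normr_prod -prodrXl -sz_s -[2 ^+ _]iter_mulr_1 -(count_predT s) -big_const_seq -big_split /=.
apply: ler_prod => z _; rewrite normr_ge0 /=.
have [ge1 gez] := ler1_max z; set m := Num.max _ _ in ge1 gez *.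
apply: le_trans (ler_normB _ _) _; rewrite !normrX mulr_natl mulr2n.
have le_pow k : (k <= a + b)%N -> `|z| ^+ k <= m ^+ (a + b).
  move=> le_k; apply: le_trans (_ : m ^+ k <= _); first by rewrite lerXn2r ?nnegrE ?normr_ge0 // (le_trans ler01 ge1).
  exact: ler_weXn2l.
by rewrite lerD // le_pow ?leq_addl ?leq_addr.
Qed.

Theorem property_B_of_local_congruence : property_B L.
Proof.
have ab_gt0 : (0 < a + b)%N by rewrite addn_gt0 (leq_ltn_trans _ lt_ab) ?orbT.
(* A height at most C would bound the right-hand side of [mahler_lower_bound] by 2^n (3/2)^n = 3^n,
   which is less than 4^n <= p^(2n). *)
pose C : algC := (a + b).-root (3 / 2).
have C_pow : C ^+ (a + b) = 3 / 2 by rewrite rootCK.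
have C_gt1 : 1 < C by rewrite rootC_gt1 // ltr_pdivlMr ?mul1r ?ltr_nat ?ltr0n.
clearbody C; exists C; split=> // x Lx nz_x hxC; apply: contrapT => nroot_x.
have := mahler_lower_bound Lx nz_x nroot_x; set n := alg_degree x.
have n_gt0 : (0 < n)%N by rewrite /n /alg_degree; case: (size _) (size_minCpoly x) => [|[|]].
have mahler_ge0 : 0 <= mahler x.
  rewrite /mahler mulr_ge0 ?ler0n // prodr_ge0 // => z _.
  by have [ge1 _] := ler1_max z; apply: le_trans ler01 ge1.
have C_ge0 : 0 <= C := le_trans ler01 (ltW C_gt1).
rewrite /mult_height -/n in hxC.
have le_M : mahler x <= C ^+ n.
  by rewrite -(rootCK n_gt0 (mahler x)) lerXn2r ?nnegrE ?rootC_ge0.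
move=> le_p; suffices : (4 : algC) ^+ n <= 3 ^+ n.
  by rewrite -!natrX ler_nat leqNgt ltn_exp2r.
have le4 : (4 : algC) ^+ n <= (p ^ 2)%:R ^+ n.
  by rewrite lerXn2r ?nnegrE ?ler0n // ler_nat -[4%N]/(2 ^ 2)%N leq_sqr prime_gt1.
apply: le_trans le4 (le_trans le_p _).
have -> : (3 : algC) ^+ n = 2 ^+ n * (C ^+ n) ^+ (a + b).
  by rewrite -exprM mulnC exprM C_pow -exprMn mulrC divfK // pnatr_eq0.
by rewrite ler_wpM2l ?exprn_ge0 ?ler0n // lerXn2r ?nnegrE // exprn_ge0.
Qed.
End HeightBound.

(** * Lifting homomorphisms modulo primes to group elements *)

Definition domain_axiom (k : comNzRingType) : Prop := forall x y : k, x * y = 0 -> x = 0 \/ y = 0.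

Lemma prime_quotient_exists (R : comNzRingType) (Q : R -> Prop) :
    Q 0 -> (forall x y, Q x -> Q y -> Q (x - y)) -> (forall a x, Q x -> Q (a * x)) -> ~ Q 1 ->
    (forall x y, Q (x * y) -> Q x \/ Q y) ->
  exists (k : comNzRingType) (phi : {rmorphism R -> k}),
    domain_axiom k /\ forall x, phi x = 0 <-> Q x.
Proof.
move=> Q0 QB QM Q1 Qprime; pose I : {pred R} := fun x => `[< Q x >].
have zI : zmod_closed I by split=> [|x y /asboolP Qx /asboolP Qy]; apply/asboolP => //; apply: QB.
have pI : 1 \notin I /\ forall a, {in I, forall u, a * u \in I}.
  by split=> [|a x /asboolP Qx]; [apply/negP=> /asboolP | apply/asboolP/QM].
pose zm := GRing.isZmodClosed.Build R I zI.
pose pm := isProperIdeal.Build R I pI.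
pose J : idealr R := HB.pack I zm pm.
have piE (x : R) : \pi_({ideal_quot J})%qT x = 0 <-> Q x.
  rewrite -[0](rmorph0 (\pi_({ideal_quot J})%qT : {rmorphism _ -> _})).
  split=> [/eqP | Qx]; last apply/eqP; rewrite -Quotient.idealrBE subr0; first by move/asboolP.
  exact/asboolP.
exists {ideal_quot J}, (\pi_({ideal_quot J})%qT : {rmorphism R -> {ideal_quot J}}); split=> //.
move=> x y; rewrite -[x]reprK -[y]reprK -rmorphM => /piE/Qprime[Qx | Qy]; [left | right]; exact/piE.
Qed.

Lemma poly_domain (k : comNzRingType) : domain_axiom k -> forall f g : {poly k}, f * g = 0 -> f = 0 \/ g = 0.
Proof.
move=> domk f g fg0; have [-> | nz_f] := eqVneq f 0; first by left.
have [-> | nz_g] := eqVneq g 0; first by right.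
have lc : lead_coef f * lead_coef g != 0.
  apply/eqP=> /domk[] /eqP; rewrite lead_coef_eq0; exact/negP.
by have := lead_coef_proper_mul lc; rewrite fg0 lead_coef0 => lc0; rewrite -lc0 eqxx in lc.
Qed.

Lemma poly_domain_prod (k : comNzRingType) (I : finType) (f : I -> {poly k}) :
  domain_axiom k -> \prod_i f i = 0 -> exists i, f i = 0.
Proof.
move=> domk; elim: (index_enum I) => [|i r IHr]; first by rewrite big_nil => /eqP; rewrite oner_eq0.
by rewrite big_cons => /(poly_domain domk)[fi0 | /IHr //]; exists i.
Qed.

Section GroupOfEndomorphisms.
Variables (R k : comNzRingType) (I : finType) (tau : I -> {rmorphism R -> R}) (i1 : I).
Variable mulI : I -> I -> I.
Hypotheses (tau1 : forall x, tau i1 x = x) (tauM : forall j i x, tau j (tau i x) = tau (mulI j i) x).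
Hypothesis (mulI_inj : forall j, injective (mulI j)).
Hypothesis domk : domain_axiom k.

Let X (w : I -> R) : {poly R} := \sum_i w i *: 'X^(enum_rank i).

Let coefX w i : (X w)`_(enum_rank i) = w i.
Proof.
rewrite /X coef_sum (bigD1 i) //= coefZ coefXn eqxx mulr1 big1 ?addr0 // => j ne_ji.
by rewrite coefZ coefXn eq_sym (inj_eq val_inj) (inj_eq enum_rank_inj) (negPf ne_ji) mulr0.
Qed.

(** If no i works, the witnesses of failure are packed as the coefficients of one polynomial [X w].
    The product F of the Y - tau_i (X w) has invariant coefficients, on which phi and psi agree, and
    it vanishes at [X w]; applying psi, some psi (X w) - phi (tau_i (X w)) is 0, against the i-th
    witness. *)
Lemma hom_lift (phi psi : {rmorphism R -> k}) :
    (forall x, (forall i, tau i x = x) -> psi x = phi x) ->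
  exists i, forall x, psi x = phi (tau i x).
Proof.
move=> agree; apply: contrapT => /forallNP no.
have /choice[w ne_w] : forall i, exists x, psi x <> phi (tau i x) by move=> i; apply/existsNP/no.
pose F : {poly {poly R}} := \prod_i ('X - (map_poly (tau i) (X w))%:P).
have FtF j : map_poly (map_poly (tau j)) F = F.
  rewrite /F rmorph_prod [RHS](reindex_inj (@mulI_inj j)) /=; apply: eq_bigr => i _.
  rewrite map_polyXsubC /=; congr ('X - _%:P).
  by apply/polyP=> m; rewrite !coef_map /= tauM.
have FphiF : map_poly (map_poly phi) F = map_poly (map_poly psi) F.
  apply/polyP=> l; apply/polyP=> m; rewrite !coef_map /= agree // => j.
  by rewrite -[in RHS](FtF j) !coef_map.
have Froot : F.[X w] = 0.
  rewrite /F horner_prod (bigD1 i1) //= !hornerE.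
  suffices -> : map_poly (tau i1) (X w) = X w by rewrite subrr mul0r.
  by apply/polyP=> m; rewrite coef_map /= tau1.
have := horner_map (map_poly psi) F (X w); rewrite /= Froot rmorph0 -FphiF.
rewrite /F rmorph_prod horner_prod => /(poly_domain_prod domk)[i].
rewrite /= map_polyXsubC !hornerE => /eqP; rewrite subr_eq0 => /eqP /polyP/(_ (enum_rank i)).
by rewrite !coef_map /= coefX => /ne_w.
Qed.

(** Prime avoidance by the same packing: the norm of [X w] has invariant coefficients, which lie in
    A thanks to the factor at [i1]. So phi kills it, and with it one of the factors. *)
Lemma prime_transitivity (phi : {rmorphism R -> k}) (A : R -> Prop) :
    A 0 -> (forall x y, A x -> A y -> A (x + y)) -> (forall a x, A x -> A (a * x)) ->
    (forall x, A x -> (forall i, tau i x = x) -> phi x = 0) ->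
  exists i, forall x, A x -> phi (tau i x) = 0.
Proof.
move=> A0 AD AM Aphi; apply: contrapT => /forallNP no.
have /choice[w Aw] : forall i, exists x, A x /\ phi (tau i x) <> 0.
  by move=> i; have /existsNP[x /not_implyP Ax] := no i; exists x.
pose G := \prod_i map_poly (tau i) (X w).
have GtG j : map_poly (tau j) G = G.
  rewrite /G rmorph_prod [RHS](reindex_inj (@mulI_inj j)) /=; apply: eq_bigr => i _.
  by apply/polyP=> m; rewrite !coef_map /= tauM.
have AX m : A (X w)`_m.
  rewrite /X coef_sum; apply: big_ind => // i _.
  by rewrite coefZ mulrC; apply: AM; case: (Aw i).
have AG m : A G`_m.
  rewrite /G (bigD1 i1) //= mulrC coefM; apply: big_ind => // i _; apply: AM.
  by rewrite coef_map /= tau1.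
have /(poly_domain_prod domk)[i] : \prod_i map_poly phi (map_poly (tau i) (X w)) = 0.
  rewrite -rmorph_prod -/G; apply/polyP=> m; rewrite coef_map coef0 /= Aphi // => j.
  by rewrite -[in RHS](GtG j) coef_map.
move=> /polyP/(_ (enum_rank i)); rewrite !coef_map coefX coef0 /=.
by case: (Aw i).
Qed.

End GroupOfEndomorphisms.

(** * Minkowski's theorem on linear forms *)

Lemma foldr_muln_prod (I : finType) (f : I -> nat) :
  foldr muln 1%N [seq f x | x : I] = (\prod_i f i)%N.
Proof.
rewrite -[RHS]big_enum /= /image_mem; elim: (enum _) => [|x s IHs]; rewrite ?big_nil //.
by rewrite big_cons /= IHs.
Qed.

Lemma card_dffun_ord (I : finType) (m : I -> nat) :
  #|{dffun forall i, 'I_(m i)}| = (\prod_i m i)%N.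
Proof.
rewrite card_dep_ffun (foldr_muln_prod (fun i => #|'I_(m i)|)).
by apply: eq_bigr => i _; apply: card_ord.
Qed.

(** By the Smith normal form, the lattice spanned by the columns of A has index |det A|. The box has
    more integral points than that, so two of them differ by some A c. *)
Lemma int_lattice_pigeonhole n (A : 'M[int]_n) (m : 'I_n -> nat) :
    \det A != 0 -> (absz (\det A) < \prod_i m i)%N ->
  exists2 c : 'cV[int]_n, c != 0 & forall i, (absz ((A *m c) i ord0) < m i)%N.
Proof.
move=> nz_A lt_A; have [X uX [Y uY [d _ DA]]] := int_Smith_normal_form A.
set D := \matrix_(i, j) _ in DA.
have abs_unit (Z : 'M[int]_n) : Z \in unitmx -> absz (\det Z) = 1%N.
  move=> uZ; have /(congr1 determinant)/(congr1 absz)/eqP := mulmxV uZ.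
  by rewrite det_mulmx det1 abszM muln_eq1 => /andP[/eqP].
pose e (i : 'I_n) : int := d`_i.
have DD : D = diag_mx (\row_i e i).
  by apply/matrixP=> i j; rewrite !mxE; case: (i =P j) => [-> | /eqP ne_ij]; rewrite ?eqxx // -[_ == _ :> nat]/(i == j) (negPf ne_ij).
have absA : absz (\det A) = (\prod_i absz (e i))%N.
  rewrite DA !det_mulmx !abszM (abs_unit X) // (abs_unit Y) // muln1 mul1n DD det_diag.
  by rewrite (big_morph absz abszM (erefl _)); apply: eq_bigr => i _; rewrite mxE.
have nz_d i : e i != 0.
  apply: contraNneq nz_A => d0; rewrite -absz_eq0 absA (bigD1 i) //= d0 mul0n //.
pose u (y : {dffun forall i, 'I_(m i)}) : 'cV[int]_n := invmx X *m \col_i (y i : nat)%:Z.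
have lt_mod (y : {dffun forall i, 'I_(m i)}) i : (absz (u y i ord0 %% e i)%Z < absz (e i))%N.
  by rewrite -ltz_nat gez0_abs ?modz_ge0 // abszE ltz_mod.
pose h y : {dffun forall i, 'I_(absz (e i))} := [ffun i => Ordinal (lt_mod y i)].
have /injectivePn[y [y' ne_yy' hyy']] : ~~ injectiveb h.
  apply/negP=> /injectiveP/leq_card.
  by rewrite !card_dffun_ord -absA leqNgt lt_A.
pose v : 'cV[int]_n := \col_i ((u y i ord0 - u y' i ord0) %/ e i)%Z.
have Duv : u y - u y' = D *m v.
  apply/matrixP=> i j; rewrite ord1 DD mul_diag_mx !mxE mulrC divzK // -eqz_mod_dvd.
  have /ffunP/(_ i) := hyy'; rewrite !ffunE => /(congr1 val) /= /(congr1 Posz).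
  by rewrite !gez0_abs ?modz_ge0 // => /eqP; rewrite !mxE.
pose c := invmx Y *m v; exists c; have Ac : A *m c = (\col_i (y i : nat)%:Z) - \col_i (y' i : nat)%:Z.
- by rewrite DA /c mulmxA mulmxK // -mulmxA -Duv mulmxBr !mulKVmx.
- apply: contraNneq ne_yy' => c0; apply/eqP/ffunP=> i; apply/val_inj/eqP.
  have /matrixP/(_ i ord0) := Ac; rewrite c0 mulmx0 !mxE => /esym/eqP.
  by rewrite subr_eq0 eqz_nat.
- by rewrite DA /c mulmxA mulmxK // -mulmxA -Duv mulmxBr !mulKVmx.
move=> i; rewrite Ac !mxE; have := ltn_ord (y i); have := ltn_ord (y' i); lia.
Qed.

Lemma prod_perturbation (n : nat) (x y : 'I_n -> algC) (delta : algC) :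
    0 <= delta -> delta <= 1 -> (forall i, `|x i - y i| <= delta) ->
  `|\prod_i x i - \prod_i y i| <= delta * \prod_i (`|y i| + 2).
Proof.
move=> d_ge0 d_le1; elim: n x y => [|n IHn] x y near.
  by rewrite !big_ord0 subrr normr0 mulr1.
rewrite !big_ord_recl; set X := \prod_(i < n) x _; set Y := \prod_(i < n) y _.
set Q := \prod_(i < n) (_ + 2).
have XY : `|X - Y| <= delta * Q by apply: IHn => i; apply: near.
have YQ : `|Y| <= Q.
  by rewrite /Y normr_prod; apply: ler_prod => i _; rewrite normr_ge0 lerDl ler0n.
have -> : x ord0 * X - y ord0 * Y = x ord0 * (X - Y) + (x ord0 - y ord0) * Y by ring.
have x0 : `|x ord0| <= `|y ord0| + 1.
  have -> : x ord0 = y ord0 + (x ord0 - y ord0) by ring.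
  by apply: le_trans (ler_normD _ _) _; rewrite lerD2l (le_trans (near _)).
apply: le_trans (ler_normD _ _) _; rewrite !normrM.
have -> : delta * ((`|y ord0| + 2) * Q) = (`|y ord0| + 1) * (delta * Q) + delta * Q by ring.
by apply: lerD; apply: ler_pM; rewrite ?normr_ge0.
Qed.

Lemma det_perturbation n (B : 'M[algC]_n) : exists K : nat, forall (A : 'M[algC]_n) (delta : algC),
  0 <= delta -> delta <= 1 -> (forall i j, `|A i j - B i j| <= delta) ->
  `|\det A - \det B| <= delta * K%:R.
Proof.
pose S := \sum_(s : 'S_n) \prod_i (`|B i (s i)| + 2) : algC.
have S_ge0 : 0 <= S by apply: sumr_ge0 => s _; apply: prodr_ge0 => i _; rewrite addr_ge0 ?ler0n.
exists (Num.bound S) => A delta d_ge0 d_le1 near.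
apply: le_trans (_ : delta * S <= _); last by rewrite ler_wpM2l // ltW // archi_boundP.
rewrite /determinant -sumrB; apply: le_trans (ler_norm_sum _ _ _) _.
rewrite mulr_sumr; apply: ler_sum => s _.
rewrite -mulrBr normrM normrX normrN1 expr1n mul1r.
exact: (prod_perturbation (x := fun i => A i (s i)) (y := fun i => B i (s i))).
Qed.

(* The box [m] is chosen so that, at scale R, its volume beats the determinant
   of the integer approximation of R B although all but one of its sides are
   shorter than R by a constant absorbing the rounding errors. *)
Lemma minkowski_linear_forms n (B : 'M[algC]_n.+1) (N : nat) :
    (forall i j, B i j \is Num.real) -> `|\det B| = 1 -> (0 < N)%N ->
  exists2 c : 'cV[int]_n.+1, c != 0 &
    `|(B *m map_mx intr c) ord0 ord0| <= 1 + N%:R^-1 /\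
    forall i, i != ord0 -> `|(B *m map_mx intr c) i ord0| < 1.
Proof.
move=> realB detB N_gt0.
have uB : B \in unitmx by rewrite unitmxE unitfE -normr_eq0 detB oner_neq0.
have [Cd HCd] := det_perturbation B.
pose K0 := \sum_k \sum_i `|invmx B k i|.
have K0_ge0 : 0 <= K0 by do 2!apply: sumr_ge0 => ? _.
pose K := Num.bound K0; have le_K0 : K0 <= K%:R by rewrite ltW // archi_boundP.
(* S bounds the rounding error of each form, T makes up for the n sides shortened by S and for the
   error [Cd] on the determinant, and R dominates them all. *)
pose S := (4 * n.+1 * n.+1 * K)%N; pose T := (n * S + Cd + 1)%N.
pose R := (2 * n.+1 * n.+1 * K + T + S + n * S * T + N * (T + S) + Cd + 1)%N.
have DT : T = (n * S + Cd + 1)%N by [].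
have DS : S = (4 * n.+1 * n.+1 * K)%N by [].
have [hK [hT hS] [hST hN hC]] : [/\ (2 * n.+1 * n.+1 * K <= R)%N, (T <= R)%N /\ (S <= R)%N &
    [/\ (n * S * T < R)%N, (N * (T + S) <= R)%N & (Cd < R)%N]].
  by rewrite /R; split; [lia | split; lia | split; lia].
clearbody R T S.
have R_gt0 : (0 < R)%N by lia.
have R0 : 0 < R%:R :> algC by rewrite ltr0n.
pose A : 'M[int]_n.+1 := \matrix_(i, j) Num.floor (R%:R * B i j).
have nearA i j : `|(A i j)%:~R - R%:R * B i j| <= 1.
  have /real_floor_itv/andP[ge_f lt_f] : R%:R * B i j \is Num.real by rewrite realM ?realn.
  rewrite mxE distrC ger0_norm ?subr_ge0 // lerBlDl ltW //.
  by move: lt_f; rewrite intrD.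
pose A' : 'M[algC]_n.+1 := R%:R^-1 *: map_mx intr A.
have detA' : \det A' = (\det A)%:~R / R%:R ^+ n.+1.
  by rewrite /A' detZ det_map_mx exprVn mulrC.
have near' i j : `|A' i j - B i j| <= R%:R^-1.
  have -> : A' i j - B i j = R%:R^-1 * ((A i j)%:~R - R%:R * B i j).
    by rewrite !mxE mulrBr mulKf // gt_eqF.
  by rewrite normrM ger0_norm ?invr_ge0 ?ler0n // ler_piMr ?invr_ge0 ?ler0n.
have R1 : R%:R^-1 <= 1 :> algC by rewrite invf_le1 // ler1n.
have diff_det : `|\det A' - \det B| <= R%:R^-1 * Cd%:R by apply: HCd; rewrite ?invr_ge0 ?ler0n.
have lt_CdR : R%:R^-1 * Cd%:R < 1 :> algC.
  by rewrite mulrC ltr_pdivrMr // mul1r ltr_nat.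
have nz_A : \det A != 0.
  apply/eqP=> A0; move: diff_det; rewrite detA' A0 mul0r sub0r normrN detB.
  by move/le_lt_trans/(_ lt_CdR); rewrite ltxx.
have ub_A : (absz (\det A) <= R ^ n.+1 + Cd * R ^ n)%N.
  rewrite -(ler_nat algC) natr_absz intr_norm.
  have -> : (\det A)%:~R = R%:R ^+ n.+1 * \det A' :> algC.
    by rewrite detA' mulrC divfK // expf_neq0 // gt_eqF.
  rewrite normrM ger0_norm ?exprn_ge0 ?ler0n //.
  have le1 : `|\det A'| <= 1 + R%:R^-1 * Cd%:R.
    have -> : \det A' = \det B + (\det A' - \det B) by ring.
    by apply: le_trans (ler_normD _ _) _; rewrite detB lerD2l.
  apply: le_trans (ler_wpM2l _ le1) _; first by rewrite exprn_ge0 ?ler0n.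
  have nzR : R%:R != 0 :> algC by rewrite gt_eqF.
  rewrite natrD natrM !natrX.
  suff -> : R%:R ^+ n.+1 * (1 + R%:R^-1 * Cd%:R) = R%:R ^+ n.+1 + Cd%:R * R%:R ^+ n :> algC by [].
  by rewrite exprS; field.
pose m (i : 'I_n.+1) := if i == ord0 then (R + T)%N else (R - S)%N.
have lt_A : (absz (\det A) < \prod_i m i)%N.
  rewrite big_ord_recl /m eqxx (eq_bigr (fun=> (R - S)%N)) // prod_nat_const card_ord.
  apply: leq_ltn_trans ub_A _.
  have bern k : (R ^ k * R <= (R - S) ^ k * R + k * S * R ^ k)%N.
    elim: k => [|k IHk]; first by rewrite !expn0; lia.
    have le_pow : ((R - S) ^ k <= R ^ k)%N.
      by case: k {IHk} => // k; rewrite leq_exp2r // leq_subr.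
    have h1 := leq_mul (leqnn R) IHk; have h2 := leq_mul (leqnn S) (leq_mul le_pow (leqnn R)).
    have h3 : (R * ((R - S) ^ k * R) = (R - S) * ((R - S) ^ k * R) + S * ((R - S) ^ k * R))%N.
      by rewrite -mulnDl subnK.
    rewrite !expnS; lia.
  rewrite -(ltn_pmul2r R_gt0) expnS; have h1 := leq_mul (leqnn (R + T)%N) (bern n).
  have h2 : ((R + T) * (n * S) + Cd * R < T * R)%N.
    have -> : (T * R = n * S * R + Cd * R + R)%N by rewrite {1}DT; lia.
    lia.
  have Rn_gt0 : (0 < R ^ n)%N by rewrite expn_gt0 R_gt0.
  have h3 : (((R + T) * (n * S) + Cd * R) * R ^ n < T * R * R ^ n)%N by rewrite ltn_pmul2r.
  lia.
have [c nz_c small] := int_lattice_pigeonhole nz_A lt_A.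
exists c => //; set b := B *m map_mx intr c.
pose X := \sum_k `|(c k ord0)%:~R : algC|; pose Y := \sum_i `|b i ord0|.
have X_ge0 : 0 <= X by apply: sumr_ge0 => ? _.
have Y_ge0 : 0 <= Y by apply: sumr_ge0 => ? _.
have XK : X <= K%:R * Y.
  apply: le_trans (_ : K0 * Y <= _); last by rewrite ler_wpM2r.
  rewrite /K0 mulr_suml; apply: ler_sum => k _.
  have -> : (c k ord0)%:~R = \sum_i invmx B k i * b i ord0.
    have := mulKmx uB (map_mx (intr : int -> algC) c); rewrite -/b => /matrixP/(_ k ord0).
    by rewrite !mxE => <-.
  apply: le_trans (ler_norm_sum _ _ _) _; rewrite mulr_suml; apply: ler_sum => i _.
  rewrite normrM ler_wpM2l // /Y (bigD1 i) //= lerDl.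
  by apply: sumr_ge0 => ? _.
have Rb i : R%:R * `|b i ord0| <= (absz ((A *m c) i ord0))%:R + X.
  have -> : R%:R * `|b i ord0| = `|R%:R * b i ord0| by rewrite normrM ger0_norm ?ler0n.
  have -> : R%:R * b i ord0 = ((A *m c) i ord0)%:~R
      - \sum_j ((A i j)%:~R - R%:R * B i j) * (c j ord0)%:~R.
    rewrite /b !mxE mulr_sumr rmorph_sum -sumrB; apply: eq_bigr => j _.
    by rewrite !mxE rmorphM /=; ring.
  apply: le_trans (ler_normB _ _) _; rewrite natr_absz intr_norm lerD2l.
  apply: le_trans (ler_norm_sum _ _ _) _; apply: ler_sum => j _.
  by rewrite normrM ler_piMl.
have mS i : (m i <= R + T)%N by rewrite /m; case: ifP => _ //; apply: leq_trans (leq_subr _ _) (leq_addr _ _).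
have le_Rb i : R%:R * `|b i ord0| <= (R + T)%:R + X.
  apply: le_trans (Rb i) _; rewrite lerD2r ler_nat.
  by apply: leq_trans (mS i); apply: ltnW.
have Y4 : Y <= (4 * n.+1)%:R.
  have h1 : R%:R * Y <= (n.+1 * (R + T))%:R + n.+1%:R * (K%:R * Y).
    rewrite mulr_sumr; apply: le_trans (ler_sum _ (fun i _ => le_Rb i)) _.
    rewrite sumr_const card_ord -[X in X <= _]mulr_natl mulrDr -natrM lerD2l.
    by rewrite ler_wpM2l ?ler0n.
  have h2 : (2 * (n.+1 * K))%:R * Y <= R%:R * Y.
    rewrite ler_wpM2r // ler_nat (leq_trans _ hK) // -!mulnA leq_mul2l /= leq_mul2l /=.
    exact: leq_pmull.
  have h3 : (2 * (n.+1 * (R + T)))%:R <= (R * (4 * n.+1))%:R :> algC.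
    rewrite ler_nat (_ : R * (4 * n.+1) = 2 * (n.+1 * (R + R)))%N; last by clear; lia.
    by rewrite !leq_mul2l /= leq_add2l.
  rewrite -(ler_pM2l R0) -natrM.
  have h1' : R%:R * Y + R%:R * Y <= (2 * (n.+1 * (R + T)))%:R + R%:R * Y.
    apply: le_trans (lerD h1 h1) _.
    rewrite [X in X <= _](_ : _ = (2 * (n.+1 * (R + T)))%:R + (2 * (n.+1 * K))%:R * Y); last first.
      by rewrite !natrM; ring.
    by rewrite lerD2l.
  by move: h1'; rewrite lerD2r => h1'; apply: le_trans h1' h3.
have XS : X <= S%:R.
  apply: le_trans XK _; apply: le_trans (ler_wpM2l _ Y4) _; first exact: ler0n.
  by rewrite -natrM ler_nat DS mulnC -[X in (_ <= X)%N]mulnAC leq_pmulr.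
split.
  rewrite -(ler_pM2l R0); apply: le_trans (Rb ord0) _.
  apply: le_trans (lerD (_ : _ <= (R + T)%:R) XS) _.
    by rewrite ler_nat; apply: leq_trans (mS ord0); apply: ltnW.
  rewrite -natrD mulrDr mulr1 -addnA natrD lerD2l.
  have N0 : 0 < N%:R :> algC by rewrite ltr0n.
  by rewrite ler_pdivlMr // -natrM ler_nat mulnC.
move=> i ne_i0; rewrite -(ltr_pM2l R0) mulr1.
apply: le_lt_trans (Rb i) _; apply: le_lt_trans (lerD (lexx _) XS) _.
rewrite -natrD ltr_nat; have := small i; rewrite /m (negPf ne_i0).
move: (absz _) => y; clear - hS; lia.
Qed.

(** * Q has no unramified extension *)

Section UnramifiedOverQ.
Variables (L : splittingFieldType rat) (iota : {rmorphism L -> algC}) (E : {subfield L}).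
Hypothesis galE : galois 1 E.
Local Notation Gam := ('Gal(E / 1))%g.

Definition integral_in (x : L) : Prop := x \in E /\ iota x \in Aint.

Lemma gal_extend (g : gal_of E) : exists s : {rmorphism algC -> algC}, forall x, s (iota x) = iota (g x).
Proof. by have [s Ds] := extend_algC_subfield_aut iota g; exists s => x; rewrite -Ds. Qed.

Lemma gal_integral (g : gal_of E) x : integral_in x -> integral_in (g x).
Proof.
by have [s Ds] := gal_extend g; move=> [Ex Ax]; rewrite /integral_in -Ds Aint_aut memv_gal.
Qed.

Lemma integralM x y : integral_in x -> integral_in y -> integral_in (x * y).
Proof. by move=> [Ex Ax] [Ey Ay]; rewrite /integral_in memvM // rmorphM rpredM. Qed.

Lemma integralD x y : integral_in x -> integral_in y -> integral_in (x + y).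
Proof. by move=> [Ex Ax] [Ey Ay]; rewrite /integral_in memvD // rmorphD rpredD. Qed.

Lemma integral_mulz x (m : int) : integral_in x -> integral_in (x *~ m).
Proof.
by move=> [Ex Ax]; rewrite /integral_in rmorphMz; split; apply: rpredMz.
Qed.

Lemma integral_multiple x : x \in E -> exists2 m : nat, (0 < m)%N & integral_in (x *+ m).
Proof.
move=> Ex; exists (minZlead (iota x)); first exact: minZlead_gt0.
split; first exact: rpredMn.
have [f Df] := minZpoly_exists (iota x).
have := @Aint_lead_coef_root (map_poly intr f) (iota x).
rewrite Df lead_coefZ (monicP (minCpoly_monic _)) mulr1 mulr_natl rmorphMn; apply.
  by rewrite -Df; apply/polyOverP=> i; rewrite coef_map /= Aint_int.
by rewrite /root hornerZ (rootP (root_minCpoly _)) mulr0.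
Qed.

Lemma trace_int x : integral_in x -> \sum_(g in Gam) iota (g x) \is a Num.int.
Proof.
move=> [Ex Ax]; apply: Cint_rat_Aint.
  have /vlineP[a Da] := mem_galTrace galE Ex.
  by rewrite -rmorph_sum -/(galTrace 1 E x) Da alg_num_field fmorph_rat Crat_rat.
by apply: rpred_sum => g _; case: (gal_integral g (conj Ex Ax)).
Qed.

Lemma trace_rat x : x \in E -> \sum_(g in Gam) iota (g x) \in Crat.
Proof.
move=> Ex; have /vlineP[a Da] := mem_galTrace galE Ex.
by rewrite -rmorph_sum -/(galTrace 1 E x) Da alg_num_field fmorph_rat Crat_rat.
Qed.

Lemma norm_int x : integral_in x -> \prod_(g in Gam) iota (g x) \is a Num.int.
Proof.
move=> [Ex Ax]; apply: Cint_rat_Aint.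
  have /vlineP[a Da] := mem_galNorm galE Ex.
  by rewrite -rmorph_prod -/(galNorm 1 E x) Da alg_num_field fmorph_rat Crat_rat.
by apply: rpred_prod => g _; case: (gal_integral g (conj Ex Ax)).
Qed.

Hypothesis unr : forall (P : algC -> Prop) (l : nat), prime_ideal P -> prime l -> P l%:R ->
  forall g, g \in Gam -> g != 1%g -> exists x, integral_in x /\ ~ P (iota (g x) - iota x).

Definition good_family (f : seq (algC * L)) : Prop :=
  forall u, u \in f -> u.1 \in Aint /\ integral_in u.2.

Definition eval_family (f : seq (algC * L)) (g : gal_of E) : algC := \sum_(u <- f) u.1 * iota (g u.2).

(** No prime contains all the g x - x, so 1 is a combination of them with integral coefficients,
    that is, f0(g) - f0(1) for a family f0. The constant f0(g) minus f0 is then the required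
    family. *)
Lemma separate_one g : g \in Gam -> g != 1%g ->
  exists f, [/\ good_family f, eval_family f 1%g = 1 & eval_family f g = 0].
Proof.
move=> Gg ne_g1; pose S y := exists x, integral_in x /\ y = iota (g x) - iota x.
have AS y : S y -> y \in Aint.
  by move=> [x [[Ex Ax] ->]]; rewrite rpredB //; case: (gal_integral g (conj Ex Ax)).
have [y0 Sy0 nz_y0] : exists2 y, S y & y != 0.
  have [x Ex ne_gx] : exists2 x, x \in E & g x != x.
    apply: contrapT => /forall2NP no; case/negP: ne_g1; apply/gal_eqP=> x Ex.
    by rewrite gal_id; case: (no x) => // /negP; rewrite negbK => /eqP.
  have [m m_gt0 Ixm] := integral_multiple Ex.
  exists (iota (g (x *+ m)) - iota (x *+ m)); first by exists (x *+ m).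
  rewrite !rmorphMn -mulrnBl -mulr_natr mulf_neq0 ?pnatr_eq0 -?lt0n //.
  by rewrite subr_eq0 (inj_eq (fmorph_inj _)).
have S1 : in_ideal S 1.
  apply: contrapT => /(prime_ideal_exists AS)[P prP SP].
  (* A prime containing the nonzero [y0] contains a positive integer, hence a rational prime, and
     [unr] applies. *)
  have [c [m [Ac m_gt0 Dm]]] := Aint_nat_multiple (AS _ Sy0) nz_y0.
  have Pm : P m%:R by rewrite -Dm; apply: (prime_idealM prP) => //; apply: SP.
  have [l pr_l Pl] : exists2 l, prime l & P l%:R.
    elim/ltn_ind: m m_gt0 Pm {Dm} => m IHm m_gt0 Pm.
    have [m1 | m_gt1] : m = 1%N \/ (1 < m)%N by lia.
      by case: (prime_ideal1 prP); rewrite m1 in Pm.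
    have Dm : m = (pdiv m * (m %/ pdiv m))%N by rewrite mulnC divnK ?pdiv_dvd.
    have := Pm; rewrite Dm natrM => /(prime_ideal_prime prP)[||Pp|Pk]; rewrite ?rpred_nat //.
      by exists (pdiv m); rewrite ?pdiv_prime.
    apply: (IHm (m %/ pdiv m)%N) => //; first by rewrite ltn_Pdiv ?prime_gt1 ?pdiv_prime.
    by rewrite divn_gt0 ?pdiv_gt0 // dvdn_leq ?pdiv_dvd.
  have [x [Ix P'x]] := unr prP pr_l Pl Gg ne_g1.
  by apply/P'x/SP; exists x.
have [s Ps D1] := S1.
have [f0 Pf0 Df0] : exists2 f, good_family f & 1 = eval_family f g - eval_family f 1%g.
  rewrite D1; elim: s Ps {D1} => [|u s IHs] Ps.
    by exists [::]; rewrite // big_nil /eval_family !big_nil subr0.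
  have [v sv | f Pf Df] := IHs; first by apply: Ps; rewrite inE sv orbT.
  have [Au [x [Ix Dx]]] := Ps u (mem_head _ _).
  exists ((u.1, x) :: f); first by move=> v; rewrite inE => /predU1P[-> | /Pf].
  rewrite big_cons Df /eval_family !big_cons /= Dx gal_id; ring.
pose a := eval_family f0 g.
exists ((a, 1) :: [seq (- v.1, v.2) | v <- f0]); split.
- move=> v; rewrite inE => /predU1P[-> | /mapP[w /Pf0[Aw Iw] ->]].
    split; last by rewrite /integral_in mem1v rmorph1.
    by rewrite /a /eval_family big_seq rpred_sum // => w /Pf0[Aw Iw]; rewrite rpredM //; case: (gal_integral g Iw).
  by rewrite rpredN.
- rewrite /eval_family big_cons big_map /= gal_id rmorph1 mulr1 Df0; congr (_ + _).
  by rewrite -sumrN; apply: eq_bigr => v _; rewrite mulNr.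
rewrite /eval_family big_cons big_map /= !rmorph1 mulr1 /a /eval_family.
by rewrite -[X in _ + X]/(\sum_(v <- f0) - v.1 * iota (g v.2)) -big_split big1_seq // => v _; rewrite /= mulNr subrr.
Qed.

Lemma eval_family_mul f f' g : g \in Gam -> (forall u, u \in f -> u.2 \in E) ->
  eval_family [seq (u.1 * v.1, u.2 * v.2) | u <- f, v <- f'] g = eval_family f g * eval_family f' g.
Proof.
move=> Gg Ef; rewrite /eval_family big_allpairs_dep mulr_suml; apply: eq_bigr => u _.
by rewrite mulr_sumr; apply: eq_bigr => v _; rewrite /= !rmorphM /=; ring.
Qed.

(* Chase-Harrison-Rosenberg: an unramified extension has a separating family
   [sum x_j g(y_j) = (g == 1)], so that its trace form is unimodular. *)
Lemma separating_family : exists2 f, good_family f &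
  forall g, g \in Gam -> eval_family f g = (g == 1%g)%:R.
Proof.
have [f [Pf f1 f0]] : exists f, [/\ good_family f, eval_family f 1%g = 1 &
    forall g, g \in enum Gam -> g != 1%g -> eval_family f g = 0].
  have : all [in Gam] (enum Gam) by apply/allP => g; rewrite mem_enum.
  elim: (enum Gam) => [|h s IHs] /=.
    exists [:: (1, 1)]; split=> //; last by rewrite /eval_family big_seq1 /= gal_id rmorph1 mulr1.
    by move=> u; rewrite inE => /eqP->; rewrite /integral_in /= mem1v rmorph1.
  case/andP=> Gh /[dup] /allP sG /IHs[f [Pf f1 f0]].
  have [-> | ne_h1] := eqVneq h 1%g.
    exists f; split=> // g; rewrite inE => /predU1P[-> | ]; rewrite ?eqxx //; exact: f0.
  have [f' [Pf' f'1 f'h]] := separate_one Gh ne_h1.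
  have Ef u : u \in f -> u.2 \in E by case/Pf=> _ [].
  exists [seq (u.1 * v.1, u.2 * v.2) | u <- f, v <- f']; split.
  - move=> _ /allpairsP[[u v] [/Pf[Au Iu] /Pf'[Av Iv] ->]] /=.
    by rewrite rpredM //; split=> //; apply: integralM.
  - by rewrite eval_family_mul ?group1 // f1 f'1 mulr1.
  move=> g; rewrite inE => /predU1P[-> | sg] ne_g1; rewrite eval_family_mul //.
  + by rewrite f'h mulr0.
  + by rewrite f0 // mul0r.
  by have := sG g sg.
exists f => // g Gg; case: eqP => [-> // | /eqP ne_g1].
by apply: f0; rewrite ?mem_enum.
Qed.

Section Lattice.
Variables (n : nat) (e : 'I_n.+1 -> gal_of E).
Hypotheses (eG : forall i, e i \in Gam) (e_inj : injective e).
Hypothesis e_sum : forall F : gal_of E -> algC, \sum_(g in Gam) F g = \sum_i F (e i).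
Hypothesis e_prod : forall F : gal_of E -> algC, \prod_(g in Gam) F g = \prod_i F (e i).
Hypothesis e_basis : exists w : 'I_n.+1 -> L, (forall k, w k \in E) /\
  \det (\matrix_(i, k) iota (e i (w k)) : 'M_n.+1) != 0.
Hypothesis realE : forall x, x \in E -> iota x \is Num.real.

Definition conj_matrix (w : 'I_n.+1 -> L) : 'M[algC]_n.+1 := \matrix_(i, k) iota (e i (w k)).
Definition conj_col (y : L) : 'cV[algC]_n.+1 := \col_i iota (e i y).
Definition coords w y := invmx (conj_matrix w) *m conj_col y.

Lemma det_Aint m (M : 'M[algC]_m) : (forall i j, M i j \in Aint) -> \det M \in Aint.
Proof.
move=> AM; apply: rpred_sum => s _; rewrite rpredM ?rpredX ?rpredN //.
exact: rpred_prod.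
Qed.

Lemma det_Crat m (M : 'M[algC]_m) : (forall i j, M i j \in Crat) -> \det M \in Crat.
Proof.
move=> AM; apply: rpred_sum => s _; rewrite rpredM ?rpredX ?rpredN //.
exact: rpred_prod.
Qed.

Lemma gram_entry w k l : ((conj_matrix w)^T *m conj_matrix w) k l = \sum_(g in Gam) iota (g (w k * w l)).
Proof. by rewrite e_sum !mxE; apply: eq_bigr => i _; rewrite !mxE -rmorphM -rmorphM. Qed.

Lemma disc_int w : (forall k, integral_in (w k)) -> \det (conj_matrix w) ^+ 2 \is a Num.int.
Proof.
move=> Iw; have -> : \det (conj_matrix w) ^+ 2 = \det ((conj_matrix w)^T *m conj_matrix w).
  by rewrite det_mulmx det_tr expr2.
have Iwkl k l := trace_int (integralM (Iw k) (Iw l)).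
apply: Cint_rat_Aint; [apply: det_Crat | apply: det_Aint] => k l; rewrite gram_entry.
  by have /intrP[z ->] := Iwkl k l; rewrite -ratr_int Crat_rat.
by apply: Aint_Cint.
Qed.

Lemma conj_colE w y : \det (conj_matrix w) != 0 -> conj_col y = conj_matrix w *m coords w y.
Proof. by move=> nz; rewrite /coords mulKVmx // unitmxE unitfE. Qed.

Lemma coords_rat w y k : (forall k, w k \in E) -> \det (conj_matrix w) != 0 -> y \in E ->
  coords w y k ord0 \in Crat.
Proof.
move=> Ew nz Ey; set B := conj_matrix w in nz *.
pose T := B^T *m B.
have nz_T : \det T != 0 by rewrite det_mulmx det_tr mulf_neq0.
have /choice[t0 Dt0] : forall k, exists q : rat, (B^T *m conj_col y) k ord0 = ratr q.
  move=> l; apply/CratP; have -> : (B^T *m conj_col y) l ord0 = \sum_(g in Gam) iota (g (w l * y)).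
    by rewrite e_sum !mxE; apply: eq_bigr => i _; rewrite !mxE -!rmorphM.
  by apply: trace_rat; rewrite memvM.
have /choice[T0 DT0] : forall kl : 'I_n.+1 * 'I_n.+1, exists q : rat, T kl.1 kl.2 = ratr q.
  by move=> [l m]; apply/CratP; rewrite /T gram_entry; apply: trace_rat; rewrite memvM.
pose T1 : 'M[rat]_n.+1 := \matrix_(l, m) T0 (l, m); pose t1 : 'cV[rat]_n.+1 := \col_l t0 l.
have DT : T = map_mx ratr T1 by apply/matrixP=> l m; have /= -> := DT0 (l, m); rewrite !mxE.
have -> : coords w y = map_mx ratr (invmx T1 *m t1).
  rewrite map_mxM map_invmx -DT; have -> : map_mx ratr t1 = B^T *m conj_col y.
    by apply/matrixP=> l j; rewrite ord1 Dt0 !mxE.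
  rewrite (conj_colE _ nz) -/B mulmxA -/T mulKmx //.
  by rewrite unitmxE unitfE.
by rewrite mxE Crat_rat.
Qed.

(** Take an integral family whose discriminant is nonzero and of least absolute value. Were some
    coordinate q of an integral y not an integer, replacing [w k] by y - floor(q) w k would multiply
    the determinant by q - floor(q), which is strictly between 0 and 1. *)
Lemma integral_basis_exists : exists w, [/\ forall k, integral_in (w k),
  \det (conj_matrix w) != 0 & forall y k, integral_in y -> coords w y k ord0 \is a Num.int].
Proof.
pose good w := (forall k, integral_in (w k)) /\ \det (conj_matrix w) != 0.
have good_nat w : good w -> exists N : nat, `|\det (conj_matrix w) ^+ 2| = N%:R.
  by move=> [Iw _]; apply/natrP/natr_norm_int/disc_int.
have [w0 good0] : exists w, good w.
  have [w [Ew nz_w]] := e_basis.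
  have /choice[m Dm] : forall k, exists m : nat, (0 < m)%N /\ integral_in (w k *+ m).
    by move=> k; have [m] := integral_multiple (Ew k); exists m.
  exists (fun k => w k *+ m k); split=> [k|]; first by case: (Dm k).
  have -> : conj_matrix (fun k => w k *+ m k) =
      (\matrix_(i, k) iota (e i (w k))) *m diag_mx (\row_k (m k)%:R).
    by apply/matrixP=> i k; rewrite mul_mx_diag !mxE !rmorphMn /= mulr_natr.
  rewrite det_mulmx mulf_neq0 // det_diag prodf_seq_neq0; apply/allP=> k _ /=.
  by rewrite mxE pnatr_eq0 -lt0n; case: (Dm k).
have exP : exists N : nat, `[< exists2 w, good w & `|\det (conj_matrix w) ^+ 2| = N%:R >].
  by have [N DN] := good_nat _ good0; exists N; apply/asboolP; exists w0.
have [N /asboolP[w [Iw nz_w] DN] minN] := ex_minnP exP.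
exists w; split=> // y k Iy; set q := coords w y k ord0.
have Ew j : w j \in E by case: (Iw j).
have Cq : q \in Crat by apply: coords_rat => //; case: Iy.
have Rq : q \is Num.real by have /CratP[r ->] := Cq; apply: rpred_rat.
pose f := Num.floor q; have /andP[ge_f lt_f] := real_floor_itv Rq; rewrite -/f in ge_f lt_f.
apply: contraT => nZq; have {}ge_f : 0 < q - f%:~R.
  rewrite subr_gt0 lt_neqAle ge_f andbT; apply: contraNneq nZq => <-; exact: intr_int.
have {}lt_f : q - f%:~R < 1 by move: lt_f; rewrite intrD addrC ltrBlDr.
pose w' j := if j == k then y - w k *~ f else w j.
pose C : 'M[algC]_n.+1 := \matrix_(i, j) if j == k then coords w y i ord0 - f%:~R *+ (i == k) else (i == j)%:R.
have DC : conj_matrix w' = conj_matrix w *m C.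
  apply/matrixP=> i j; rewrite !mxE /w' /C; case: (eqVneq j k) => [-> | ne_jk].
    have /matrixP/(_ i ord0) := conj_colE y nz_w; rewrite !mxE => Dy.
    rewrite !rmorphB !rmorphMz /= Dy.
    under [RHS]eq_bigr => l _ do rewrite !mxE eqxx mulrBr.
    rewrite sumrB; congr (_ - _).
      by apply: eq_bigr => l _; rewrite !mxE.
    rewrite (bigD1 k) //= eqxx mulr1n big1 ?addr0 ?mulrzr // => l ne_lk.
    by rewrite (negPf ne_lk) mulr0n mulr0.
  rewrite (bigD1 j) //= !mxE (negPf ne_jk) eqxx mulr1 big1 ?addr0 // => l ne_lj.
  by rewrite !mxE (negPf ne_jk) (negPf ne_lj) mulr0.
have detC : \det C = q - f%:~R.
  rewrite (expand_det_row C k) (bigD1 k) //= big1 ?addr0; last first.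
    by move=> j ne_jk; rewrite mxE (negPf ne_jk) eq_sym (negPf ne_jk) mul0r.
  rewrite mxE !eqxx mulr1n -/q /cofactor addnn -signr_odd odd_double mul1r.
  have -> : row' k (col' k C) = 1%:M; last by rewrite det1 mulr1.
  by apply/matrixP=> i j; rewrite !mxE eq_sym (negPf (neq_lift _ _)) (inj_eq lift_inj).
have Iw' j : integral_in (w' j).
  rewrite /w'; case: eqP => _ //; rewrite -mulrNz; apply: integralD => //.
  exact: integral_mulz.
have good_w' : good w'.
  by split; rewrite // DC det_mulmx detC mulf_neq0 // gt_eqF.
have [N' DN'] := good_nat _ good_w'.
have /minN : `[< exists2 w, good w & `|\det (conj_matrix w) ^+ 2| = N'%:R >].
  by apply/asboolP; exists w'.
rewrite leqNgt => /negP[]; rewrite -(ltr_nat algC) -DN' -DN DC det_mulmx detC exprMn normrM.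
rewrite gtr_pMr ?normr_gt0 ?expf_neq0 // ger0_norm ?exprn_ge0 ?(ltW ge_f) //.
by rewrite exprn_ilt1 // ltW.
Qed.

(** The separating family provides an inverse U of the conjugate matrix B whose entries are
    algebraic integers. The squares of det B and det U are then nonzero integers with product 1. *)
Lemma disc_one w : (forall k, integral_in (w k)) -> \det (conj_matrix w) != 0 ->
  (forall y k, integral_in y -> coords w y k ord0 \is a Num.int) -> `|\det (conj_matrix w)| = 1.
Proof.
move=> Iw nz_w Zw; have [f Pf Df] := separating_family; set B := conj_matrix w.
pose U : 'M[algC]_n.+1 := \matrix_(k, j) \sum_(v <- f) v.1 * coords w ((e j)^-1%g v.2) k ord0.
have BU : B *m U = 1%:M.
  apply/matrixP=> i j; rewrite !mxE.
  have -> : (i == j)%:R = eval_family f ((e j)^-1 * e i)%g.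
    by rewrite Df ?groupM ?groupV // -eq_mulVg1 (inj_eq e_inj) eq_sym.
  under eq_bigr do rewrite [U _ _]mxE mulr_sumr.
  rewrite exchange_big /eval_family /=; rewrite big_seq [RHS]big_seq; apply: eq_bigr => v fv.
  have [_ [Ev _]] := Pf v fv.
  rewrite galM //; have /matrixP/(_ i ord0) := conj_colE ((e j)^-1%g v.2) nz_w.
  rewrite !mxE => ->; rewrite mulr_sumr; apply: eq_bigr => k _.
  by rewrite mulrCA.
have dBU : \det B * \det U = 1 by rewrite -det_mulmx BU det1.
have AU : \det U \in Aint.
  apply: det_Aint => k j; rewrite mxE big_seq rpred_sum // => v /Pf[Av Iv].
  by rewrite rpredM // Aint_Cint // Zw //; apply: gal_integral.
have ZX : \det B ^+ 2 \is a Num.int by apply: disc_int.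
have ZY : \det U ^+ 2 \is a Num.int.
  apply: Cint_rat_Aint; last by rewrite rpredX.
  have -> : \det U ^+ 2 = (\det B ^+ 2)^-1.
    have nzB2 : \det B ^+ 2 != 0 by rewrite expf_neq0.
    by apply: (mulfI nzB2); rewrite mulfV // -exprMn dBU expr1n.
  by have /intrP[z ->] := ZX; apply/CratP; exists (z%:~R)^-1; rewrite fmorphV rmorph_int.
have nzU : \det U ^+ 2 != 0.
  by rewrite expf_neq0 //; apply: contraTneq (oner_neq0 algC) => U0; rewrite -dBU U0 mulr0 eqxx.
have gX := norm_intr_ge1 ZX (expf_neq0 2 nz_w); have gY := norm_intr_ge1 ZY nzU.
have : `|\det B ^+ 2| * `|\det U ^+ 2| = 1 by rewrite -normrM -exprMn dBU expr1n normr1.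
move=> XY; have X1 : `|\det B ^+ 2| = 1.
  by apply/eqP; rewrite eq_le gX andbT -XY ler_peMr ?normr_ge0.
by apply/eqP; rewrite -(@pexpr_eq1 _ _ 2) ?normr_ge0 // -normrX X1.
Qed.

(** Minkowski's theorem gives a nonzero integer z with one conjugate at most 5/4 and the others less
    than 1 in absolute value. The trace of z^2 is an integer less than 2 + n, so the mean of the
    squared conjugates is at most 1, while their product is at least 1. Equality in the
    arithmetic-geometric inequality makes all the squares equal, which is impossible as soon as one
    of them is less than 1. *)
Lemma lattice_rank_one : n = 0%N.
Proof.
apply/eqP; rewrite -leqn0 leqNgt; apply/negP=> n_gt0.
have [w [Iw nz_w Zw]] := integral_basis_exists.
set B := conj_matrix w in nz_w.
have realB i j : B i j \is Num.real by rewrite mxE realE // memv_gal //; case: (Iw j).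
have [c nz_c [le0 lt1]] := minkowski_linear_forms realB (disc_one Iw nz_w Zw) (isT : (0 < 4)%N).
pose z := \sum_k w k *~ c k ord0; pose a i := iota (e i z).
have Bc i : (B *m map_mx intr c) i ord0 = a i.
  rewrite /a /z mxE !rmorph_sum; apply: eq_bigr => k _.
  by rewrite !mxE !rmorphMz /= mulrzr.
have Iz : integral_in z.
  split.
    by apply: rpred_sum => k _; apply: rpredMz; case: (Iw k).
  by rewrite /z rmorph_sum rpred_sum // => k _; case: (integral_mulz (c k ord0) (Iw k)).
have nz_z : z != 0.
  apply: contraNneq nz_c => z0; apply/eqP.
  have Bc0 : B *m map_mx intr c = 0.
    by apply/matrixP=> i j; rewrite ord1 Bc /a z0 !rmorph0 mxE.
  have uB : B \in unitmx by rewrite unitmxE unitfE.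
  have := mulKmx uB (map_mx intr c); rewrite Bc0 mulmx0 => c0.
  by apply/matrixP=> k j; have /matrixP/(_ k j) := c0; rewrite !mxE => /esym/eqP; rewrite intr_eq0 => /eqP.
have Ra i : a i \is Num.real by rewrite realE // memv_gal; case: Iz.
have a2_ge0 i : 0 <= a i ^+ 2 by rewrite real_exprn_even_ge0.
pose S := \sum_i a i ^+ 2.
have ZS : S \is a Num.int.
  have := trace_int (integralM Iz Iz); rewrite e_sum; congr (_ \is a _).
  by apply: eq_bigr => i _; rewrite !rmorphM.
have prod_ge1 : 1 <= \prod_i a i ^+ 2.
  have ZN := norm_int Iz; rewrite e_prod in ZN.
  have nzN : \prod_i a i != 0.
    by rewrite prodf_seq_neq0; apply/allP => i _ /=; rewrite /a !fmorph_eq0.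
  have -> : \prod_i a i ^+ 2 = `|\prod_i a i| ^+ 2.
    by rewrite real_normK ?prodrXl // rpred_prod.
  exact/exprn_ege1/(norm_intr_ge1 ZN nzN).
have a_lt1 i : i != ord0 -> a i ^+ 2 < 1.
  by move=> /lt1; rewrite Bc => lt; rewrite -real_normK // exprn_ilt1.
have a0_lt2 : a ord0 ^+ 2 < 2.
  rewrite Bc in le0; rewrite -real_normK //.
  apply: le_lt_trans (_ : (1 + 4%:R^-1) ^+ 2 < 2).
    by rewrite lerXn2r ?nnegrE ?normr_ge0 // addr_ge0 ?invr_ge0 ?ler0n.
  have -> : (1 + 4%:R^-1) ^+ 2 = 25 / 16 :> algC by field.
  by rewrite ltr_pdivrMr ?ltr0n // -natrM ltr_nat.
have S_lt : S < n.+2%:R.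
  rewrite /S big_ord_recl -[n.+2]add2n natrD ltr_leD //.
  rewrite -[n in X in _ <= X]card_ord -sumr_const; apply: ler_sum => i _.
  by apply/ltW/a_lt1; rewrite eq_sym neq_lift.
have S_ge0 : 0 <= S by apply: sumr_ge0.
have S_le : S <= n.+1%:R.
  have /natrP[s Ds] : S \is a Num.nat by rewrite natrEint ZS.
  by move: S_lt; rewrite Ds ltr_nat ler_nat ltnS.
have := @leif_AGM algC 'I_n.+1 predT (fun i => a i ^+ 2) (fun i _ => a2_ge0 i).
rewrite card_ord -/S => AGM.
have mu_le1 : (S / n.+1%:R) ^+ n.+1 <= 1.
  by rewrite exprn_ile1 ?divr_ge0 ?ler0n // ler_pdivrMr ?ltr0n // mul1r.
have /forall_inP all_eq : [forall i in 'I_n.+1, forall j in 'I_n.+1, a i ^+ 2 == a j ^+ 2].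
  have [le_AGM] := AGM; rewrite /= => <-; rewrite eq_le le_AGM /=.
  exact: le_trans mu_le1 prod_ge1.
have ne_max : (ord_max : 'I_n.+1) != ord0 by rewrite -(inj_eq val_inj) /= -lt0n.
have : \prod_i a i ^+ 2 = (a ord_max ^+ 2) ^+ n.+1.
  rewrite -[n.+1 in RHS]card_ord -prodr_const; apply: eq_bigr => i _.
  by have /forall_inP/(_ ord_max isT)/eqP := all_eq i isT.
move=> Dprod; move: prod_ge1; rewrite Dprod lt_geF //.
by rewrite exprn_ilt1 // a_lt1.
Qed.

End Lattice.

Theorem unramified_totally_real_trivial : (forall x, x \in E -> iota x \is Num.real) ->
  #|Gam| = 1%N.
Proof.
move=> realE; have [n cardG] : exists n, #|Gam| = n.+1.
  by exists #|Gam|.-1; rewrite prednK // cardG_gt0.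
pose e (i : 'I_n.+1) : gal_of E := enum_val (cast_ord (esym cardG) i).
have e_inj : injective e by move=> i j /enum_val_inj/cast_ord_inj.
rewrite cardG; congr _.+1; apply: (@lattice_rank_one n e) => //.
- by move=> i; apply: enum_valP.
- move=> F; rewrite big_enum_val (reindex (cast_ord (esym cardG))) //=.
  by exists (cast_ord cardG) => i _; rewrite ?cast_ordK ?cast_ordKV.
- move=> F; rewrite big_enum_val (reindex (cast_ord (esym cardG))) //=.
  by exists (cast_ord cardG) => i _; rewrite ?cast_ordK ?cast_ordKV.
have [w [Ew _] [uw _ _]] := gal_matrix Gam.
exists (fun k => tnth w (cast_ord (esym cardG) k)); split=> [k|]; first by apply: Ew; apply: mem_tnth.
set M := \matrix_(i, j) _ in uw.
have det_cast m m' (eqm : m = m') (A : 'M[L]_m) : \det (castmx (eqm, eqm) A) = \det A.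
  by case: m' / eqm; rewrite castmx_id.
have -> : \matrix_(i, k) iota (e i (tnth w (cast_ord (esym cardG) k))) = map_mx iota (castmx (cardG, cardG) M).
  by apply/matrixP=> i j; rewrite !mxE castmxE mxE.
by rewrite det_map_mx fmorph_eq0 det_cast -unitfE -unitmxE.
Qed.
End UnramifiedOverQ.

(** * Transfer *)

Section TransferKernel.
Local Open Scope group_scope.
Variables (gT : finGroupType) (G U W : {group gT}).
Hypotheses (sUG : U \subset G) (nWU : U \subset 'N(W)) (abUW : abelian (U / W)).
Let alpha := restrm_morphism nWU (coset_morphism W).

Let abA : abelian (alpha @* U).
Proof. by rewrite morphim_restrm finset.setIid. Qed.

Let V := transfer_morphism G abA.

Let memU g x : (g ^+ #|<[g]> : U :* x|) ^ x^-1 \in U.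
Proof.
have := mulg_exp_card_rcosets U g x; rewrite mem_rcoset => Ux.
by rewrite conjgE invgK mulgA.
Qed.

Let V_expand g X : g \in G -> is_transversal X (rcosets U G :* <[g]>) G ->
  FiniteModule.fmval (V g) = \prod_(x in X) coset W ((g ^+ #|<[g]> : U :* x|) ^ x^-1).
Proof.
move=> Gg trX; rewrite /= (transfer_cycle_expansion sUG abA Gg trX).
rewrite FiniteModule.fmval_sum.
apply: eq_bigr => x Xx; rewrite /restrm /= FiniteModule.fmodK //.
by apply: (mem_morphim alpha); apply: memU.
Qed.

(* [N] is the kernel of the transfer G -> U / W; the last clause is the cycle
   expansion of the transfer of [g]. *)
Lemma transfer_kernel_exists : exists N : {group gT}, [/\ N <| G,
  forall g, g \in G -> (forall x m, x \in G -> (g ^+ m) ^ x^-1 \in U -> (g ^+ m) ^ x^-1 \in W) -> g \in N &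
  forall g, g \in N -> exists X : {set gT}, exists n : gT -> nat,
    [/\ X \subset G, (\sum_(x in X) n x)%N = #|G : U|,
        forall x, x \in X -> (g ^+ n x) ^ x^-1 \in U &
        \prod_(x in X) coset W ((g ^+ n x) ^ x^-1) = 1]].
Proof.
have exX g : g \in G -> exists X, is_transversal X (rcosets U G :* <[g]>) G.
  by move=> Gg; eexists; apply: transversalP; apply: (rcosets_cycle_partition sUG).
exists ('ker V)%G; split; first exact: ker_normal.
- move=> g Gg small; apply/kerP => //; have [X trX] := exX g Gg.
  apply: val_inj; rewrite /= (V_expand Gg trX) big1 // => x Xx.
  have Gx : x \in G by have /fintype.subsetP/(_ x Xx) := transversal_sub trX.
  apply: coset_id; exact: small.
move=> g kg; have Gg : g \in G by apply: (dom_ker kg).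
have [X trX] := exX g Gg; exists X, (fun x => #|<[g]> : U :* x|); split=> //.
- exact: transversal_sub trX.
- exact: (sum_index_rcosets_cycle sUG Gg).
by rewrite -(V_expand Gg trX) (mker kg).
Qed.

End TransferKernel.

(** * Galois action on algebraic integers modulo primes *)

Section IntegralRing.
Variables (L : splittingFieldType rat) (iota : {rmorphism L -> algC}).

Definition integral_pred : {pred L} := fun x => iota x \in Aint.

Fact integral_subring_closed : subring_closed integral_pred.
Proof.
have E x : (x \in integral_pred) = (iota x \in Aint) by [].
by split=> [|x y|x y]; rewrite !E ?rmorph1 ?rpred1 ?rmorphB ?rmorphM //; [apply: rpredB | apply: rpredM].
Qed.
HB.instance Definition _ := GRing.isSubringClosed.Build L integral_pred integral_subring_closed.

Record integral_ring := IntegralElt {integral_val : L; integral_valP : integral_val \in integral_pred}.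
HB.instance Definition _ := [isSub for integral_val].
HB.instance Definition _ := [Choice of integral_ring by <:].
HB.instance Definition _ := [SubChoice_isSubComNzRing of integral_ring by <:].

Fact integral_val0 : integral_val 0 = 0. Proof. by []. Qed.
Fact integral_val1 : integral_val 1 = 1. Proof. by []. Qed.
Fact integral_valB : {morph integral_val : x y / x - y}. Proof. by []. Qed.
Fact integral_valD : {morph integral_val : x y / x + y}. Proof. by []. Qed.
Fact integral_valM : {morph integral_val : x y / x * y}. Proof. by []. Qed.
Fact integral_val_nat n : integral_val n%:R = n%:R. Proof. exact: rmorph_nat (val : {rmorphism integral_ring -> L}) _. Qed.
Fact integral_val_int m : integral_val m%:~R = m%:~R. Proof. exact: rmorph_int (val : {rmorphism integral_ring -> L}) _. Qed.
Fact integral_valX n : {morph integral_val : x / x ^+ n}. Proof. exact: rmorphXn (val : {rmorphism integral_ring -> L}) _. Qed.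
Definition integral_valE := (integral_val0, integral_val1, integral_valB, integral_valD, integral_valM, integral_valX).

Lemma gal_integral_pred (g : gal_of {:L}) x : x \in integral_pred -> g x \in integral_pred.
Proof.
move=> Ax; have [] // := @gal_integral L iota {:L}%AS g x; split; [exact: memvf | exact: Ax].
Qed.

Definition gal_act (g : gal_of {:L}) (x : integral_ring) : integral_ring :=
  IntegralElt (gal_integral_pred g (integral_valP x)).

Fact gal_act_is_zmod_morphism g : zmod_morphism (gal_act g).
Proof. by move=> x y; apply: val_inj; rewrite /= ?integral_valE !rmorphB. Qed.
HB.instance Definition _ g := GRing.isZmodMorphism.Build _ _ (gal_act g) (gal_act_is_zmod_morphism g).
Fact gal_act_is_monoid_morphism g : monoid_morphism (gal_act g).
Proof. by split=> [|x y]; apply: val_inj; rewrite /= ?rmorph1 ?integral_valE ?rmorphM. Qed.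
HB.instance Definition _ g := GRing.isMonoidMorphism.Build _ _ (gal_act g) (gal_act_is_monoid_morphism g).

Lemma residue_exists P : prime_ideal P -> exists (k : comNzRingType) (phi : {rmorphism integral_ring -> k}),
  domain_axiom k /\ forall x, phi x = 0 <-> P (iota (integral_val x)).
Proof.
move=> prP; apply: (@prime_quotient_exists integral_ring (fun x => P (iota (integral_val x)))).
- by rewrite integral_val0 rmorph0; apply: prime_ideal0 prP.
- by move=> x y Px Py; rewrite ?integral_valE rmorphB; apply: prime_idealB.
- by move=> a x Px; rewrite ?integral_valE rmorphM; apply: (prime_idealM prP) => //; apply: (integral_valP a).
- by rewrite ?integral_valE rmorph1; apply: prime_ideal1 prP.
by move=> x y; rewrite ?integral_valE rmorphM; apply: (prime_ideal_prime prP); apply: integral_valP.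
Qed.

Section Subgroup.
Variable N : {group gal_of {:L}}.
Let tau (i : subg_of N) : {rmorphism integral_ring -> integral_ring} := gal_act (sgval i).
Let tau1 x : tau 1%g x = x.
Proof. by apply: val_inj; rewrite /= gal_id. Qed.
Let tauM j i x : tau j (tau i x) = tau (i * j)%g x.
Proof. by apply: val_inj; rewrite /= galM ?memvf. Qed.
Let fixed_tau x : (forall i, tau i x = x) -> forall g, g \in N -> g (integral_val x) = val x.
Proof. by move=> fx g Ng; have := fx (subg N g) => /(congr1 val); rewrite /= subgK. Qed.

Lemma residue_hom_lift (k : comNzRingType) (phi psi : {rmorphism integral_ring -> k}) : domain_axiom k ->
    (forall x, (forall g, g \in N -> g (integral_val x) = val x) -> psi x = phi x) ->
  exists2 g, g \in N & forall x, psi x = phi (gal_act g x).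
Proof.
move=> domk agree; have [|x fx|i Di] := hom_lift tau1 tauM _ domk (phi := phi) (psi := psi).
- by move=> j x y; apply: mulIg.
- by apply/agree/fixed_tau.
by exists (sgval i) => //; apply: valP.
Qed.

Lemma gal_prime_transitivity P1 P2 : prime_ideal P1 -> prime_ideal P2 ->
    (forall x, iota x \in Aint -> (forall g, g \in N -> g x = x) -> P1 (iota x) -> P2 (iota x)) ->
  exists2 g, g \in N & forall x, P1 (iota x) -> P2 (iota (g x)).
Proof.
move=> prP1 prP2 sub12; have [k [phi [domk Dphi]]] := residue_exists prP2.
pose A (x : integral_ring) := P1 (iota (integral_val x)).
have [||||x Ax fx|i Di] := prime_transitivity tau1 tauM _ domk (phi := phi) (A := A).
- by move=> j x y; apply: mulIg.
- by rewrite /A ?integral_valE rmorph0; apply: prime_ideal0 prP1.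
- by move=> x y Ax Ay; rewrite /A ?integral_valE rmorphD; apply: (prime_idealD prP1).
- by move=> a x Ax; rewrite /A ?integral_valE rmorphM; apply: (prime_idealM prP1) => //; apply: (integral_valP a).
- by apply/Dphi; apply: sub12 => //; [exact: (integral_valP x) | exact: fixed_tau].
exists (sgval i) => [|x P1x]; first exact: valP.
have Ax : x \in integral_pred by apply: (prime_ideal_Aint prP1 P1x).
by have /Dphi := Di (IntegralElt Ax) P1x.
Qed.

Lemma congruence_lift P (s : gal_of {:L}) : prime_ideal P ->
    (forall x, iota x \in Aint -> (forall g, g \in N -> g x = x) -> P (iota (s x) - iota x)) ->
  exists2 t, t \in N & forall x, iota x \in Aint -> P (iota (s x) - iota (t x)).
Proof.
move=> prP cong; have [k [phi [domk Dphi]]] := residue_exists prP.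
pose psi : {rmorphism integral_ring -> k} := phi \o gal_act s.
have [x fx|t Nt Dt] := residue_hom_lift domk (phi := phi) (psi := psi).
- apply/eqP; rewrite /= -subr_eq0 -rmorphB; apply/eqP/Dphi; rewrite /= !rmorphB.
  by apply: cong => //; apply: (integral_valP x).
exists t => // x Ax; have := Dt (IntegralElt (Ax : x \in integral_pred)).
by move/eqP; rewrite /= -subr_eq0 -rmorphB => /eqP/Dphi; rewrite /= rmorphB.
Qed.

End Subgroup.

(** Reduction modulo P followed by the p-th power is again a ring morphism. It agrees with reduction
    on the invariants, which are rational integers, so [hom_lift] produces [s]. *)
Lemma frobenius_exists P p : galois 1 {:L} -> prime_ideal P -> prime p -> P p%:R ->
  exists2 s, s \in 'Gal({:L} / 1)%g & forall x, iota x \in Aint -> P (iota (s x) - iota x ^+ p).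
Proof.
move=> galL prP pr_p Pp; have [k [phi [domk Dphi]]] := residue_exists prP.
have chk : p \in [pchar k].
  by rewrite inE pr_p -(rmorph_nat phi) /=; apply/eqP/Dphi; rewrite integral_val_nat rmorph_nat.
pose psi : {rmorphism integral_ring -> k} := pFrobenius_aut chk \o phi.
have [x fx|s Gs Ds] := residue_hom_lift (N := 'Gal({:L} / 1)%G) domk (phi := phi) (psi := psi).
- have /intrP[m Dm] : iota (integral_val x) \is a Num.int.
    have : integral_val x \in fixedField 'Gal({:L} / 1)%g by apply/fixedFieldP; rewrite ?memvf.
    rewrite (galois_fixedField galL) => /vlineP[q Dq].
    apply: Cint_rat_Aint (integral_valP x).
    by rewrite Dq alg_num_field fmorph_rat Crat_rat.
  have -> : x = m%:~R.
    by apply: val_inj; apply: (fmorph_inj iota); rewrite /= integral_val_int rmorph_int.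
  by rewrite !rmorph_int.
exists s => // x Ax; pose y := IntegralElt (Ax : x \in integral_pred).
have /Dphi : phi (gal_act s y - y ^+ p) = 0.
  by have := Ds y; rewrite /= pFrobenius_autE rmorphB rmorphXn => ->; rewrite subrr.
by rewrite integral_valB integral_valX rmorphB rmorphXn.
Qed.

End IntegralRing.

(** * Inertia groups and complex conjugations in a Galois number field *)

Section NormalInertia.
Variables (L : splittingFieldType rat) (iota : {rmorphism L -> algC}).
Local Notation G := 'Gal({:L} / 1)%g.

Lemma mem_gal1 (g : gal_of {:L}) : g \in G.
Proof. by rewrite gal_kHom ?sub1v // k1AHom. Qed.

Lemma gal_restrict (s : {rmorphism algC -> algC}) : exists g : gal_of {:L}, forall x, s (iota x) = iota (g x).
Proof.
have [s0 Ds0] := restrict_aut_to_normal_num_field iota s.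
exists (gal {:L} (linfun_ahom s0)) => x; rewrite -Ds0 galK ?memvf ?subvf //=.
by rewrite lfunE.
Qed.

(** The fixed field E of N is totally real by the second condition. It is unramified by the first:
    an element of Gal(E / Q) inert at P extends to some s congruent modulo P to some t in N, so that
    t^-1 s is inert on the whole of L, and s is in N. Hence E is Q. *)
Lemma normal_subgroup_full (N : {group gal_of {:L}}) : galois 1 {:L} -> (N <| G)%g ->
    (forall P l (g : gal_of {:L}), prime_ideal P -> prime l -> P l%:R ->
      (forall x, iota x \in Aint -> P (iota (g x) - iota x)) -> g \in N) ->
    (forall g : gal_of {:L}, (forall x, iota (g x) = (iota x)^*) -> g \in N) ->
  forall g, g \in N.
Proof.
move=> galL nNG inertia real g; pose E : {subfield L} := fixedField_aspace N.
have galE : galois 1 E by apply: (@normal_fixedField_galois _ _ {:L}%AS 1%AS galL N nNG).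
have fixE x h : x \in E -> h \in N -> h x = x by move=> /(fixedFieldP (memvf _)); apply.
have NE (h : gal_of {:L}) : (forall x, x \in E -> h x = x) -> h \in N.
  move=> fh; rewrite -(gal_fixedField N) gal_kHom ?subvf //; apply/kHomP_tmp; split=> //.
  by move=> x y _ _; rewrite rmorphM.
have card1 : #|'Gal(E / 1)%g| = 1%N.
  apply: (@unramified_totally_real_trivial L iota E galE) => [P l prP pr_l Pl h Gh ne_h1|x Ex].
    apply: contrapT => /forallNP no.
    have [s Gs Ds] : {s | s \in G & {in E, h =1 s}}.
      apply: kHom_to_gal (normalFieldf 1) _; rewrite ?sub1v ?subvf //.
      by rewrite -gal_kHom ?sub1v.
    have [|t Nt Dt] := @congruence_lift L iota N P s prP.
      move=> x Ax fx; have Ex : x \in E by apply/(fixedFieldP (memvf _)).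
      by rewrite -Ds //; apply: contrapT => P'x; apply: (no x).
    have Ns : (t^-1 * s)%g \in N.
      apply: (inertia P l) => // x Ax.
      have At : iota (t^-1%g x) \in Aint by apply: (@gal_integral_pred L iota t^-1%g x).
      have := Dt _ At; rewrite -!galM ?memvf //.
      by rewrite mulVg gal_id.
    have {}Ns : s \in N by move: Ns; rewrite groupMl ?groupV.
    case/eqP: ne_h1; apply/eqP/gal_eqP=> x Ex; rewrite gal_id Ds //; exact: fixE.
  have [h Dh] := gal_restrict Num.conj.
  have Nh : h \in N by apply: real => y; rewrite -Dh.
  by rewrite CrealE /=; apply/eqP; have := Dh x; rewrite fixE.
have dimE : E = 1%AS :> {vspace L}.
  apply/esym/eqP; rewrite eqEdim sub1v dimv1 /=.
  by move: (galois_dim galE); rewrite card1 dimv1 divn1 => ->.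
by rewrite -(gal_fixedField N) -/(E : {vspace L}) dimE mem_gal1.
Qed.

End NormalInertia.

(** * The order of Frobenius in an unramified abelian extension *)

Lemma dimQ_span F D : is_subfield F -> dimQ_le F D -> exists m (x : 'I_m -> algC),
  (forall i, F (x i)) /\ forall y, F y -> exists c : 'I_m -> rat, y = \sum_i ratr (c i) * x i.
Proof.
move=> sfF dimF.
pose free m (x : 'I_m -> algC) := (forall i, F (x i)) /\
  forall c : 'I_m -> rat, \sum_(i < m) ratr (c i) * x i = 0 -> forall i, c i = 0.
have ex0 : exists m, `[< exists x, @free m x >].
  exists 0%N; apply/asboolP; exists (fun=> 0); split=> [i|c _ i]; by case: i.
have [m le_m|m /asboolP[x [Fx free_x]] max_m] := ex_maxnP ex0 (m := D).
  by case/asboolP: le_m => x [Fx free_x]; apply: dimF free_x.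
exists m, x; split=> // y Fy; apply: contrapT => no.
pose x' (i : 'I_m.+1) := oapp x y (unlift ord0 i).
have /max_m : `[< exists x, @free m.+1 x >]; last by rewrite ltnn.
apply/asboolP; exists x'; split=> [i | c].
  by rewrite /x'; case: (unlift _ _) => /=.
rewrite big_ord_recl /= {1}/x' unlift_none /=.
under eq_bigr do rewrite /x' liftK /=.
have [c0 | nz_c0] := eqVneq (c ord0) 0.
  rewrite c0 rmorph0 mul0r add0r => /free_x c_lift i.
  by have [j ->|->] := unliftP ord0 i.
move=> sum0; case: no; exists (fun i => - c (lift ord0 i) / c ord0).
have nz : ratr (c ord0) != 0 :> algC by rewrite fmorph_eq0.
apply: (mulfI nz); rewrite mulr_sumr -[LHS](addrK (\sum_(i < m) ratr (c (lift ord0 i)) * x i)) sum0 sub0r.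
rewrite -sumrN; apply: eq_bigr => i _; rewrite rmorphM rmorphN fmorphV /=; field.
exact: nz.
Qed.

Section SubfieldOf.
Variables (L : splittingFieldType rat) (iota : {rmorphism L -> algC}).

Lemma iotaZ (c : rat) x : iota (c *: x) = ratr c * iota x.
Proof. by rewrite -mulr_algl rmorphM alg_num_field fmorph_rat. Qed.

Lemma subfield_preimage F : is_subfield F -> exists Fs : {subfield L}, forall x, x \in Fs <-> F (iota x).
Proof.
move=> sfF; pose good (V : {vspace L}) := forall x, x \in V -> F (iota x).
have ex0 : exists m, `[< exists2 V, good V & \dim V = m >].
  exists 0%N; apply/asboolP; exists 0%VS; last exact: dimv0.
  by move=> x /[!memv0] /eqP->; rewrite rmorph0; apply: subfield0.
have [m le_m|m /asboolP[V gV dimV] max_m] := ex_maxnP ex0 (m := \dim {:L}).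
  by case/asboolP: le_m => V _ <-; apply: dimvS; apply: subvf.
have memV x : x \in V <-> F (iota x).
  split=> [/gV // | Fx].
  have /max_m : `[< exists2 U, good U & \dim U = \dim (V + <[x]>)%VS >].
    apply/asboolP; exists (V + <[x]>)%VS => // _ /memv_addP[v Vv [_ /vlineP[c ->] ->]].
    by rewrite rmorphD iotaZ; apply: (subfieldD sfF); [apply: gV | apply: (subfieldM sfF) => //; apply: subfield_rat].
  rewrite -dimV => le_dim; have : V == (V + <[x]>)%VS by rewrite eqEdim addvSl.
  by move/eqP->; apply: (subvP (addvSr _ _)); apply: memv_line.
have aV : is_aspace V.
  rewrite /is_aspace has_algid1 /=; last by apply/memV; rewrite rmorph1; apply: subfield1.
  by apply/prodvP=> x y /memV Fx /memV Fy; apply/memV; rewrite rmorphM; apply: (subfieldM sfF).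
by exists (ASpace aV).
Qed.

Lemma mem_gal (Fs : {subfield L}) (g : gal_of {:L}) :
  reflect (forall x, x \in Fs -> g x = x) (g \in 'Gal({:L} / Fs))%g.
Proof.
rewrite gal_kHom ?subvf //; apply: (iffP kHomP_tmp) => [[]|fg] //.
by split=> // x y _ _; rewrite rmorphM.
Qed.

Lemma dim_subfield_le F (Fs : {subfield L}) d : dimQ_le F d -> (forall x, x \in Fs -> F (iota x)) ->
  (\dim Fs <= d)%N.
Proof.
move=> dimF sF; apply: (dimF _ (fun i => iota (vbasis Fs)`_i)) => [i | c].
  by apply/sF/vbasis_mem; rewrite mem_nth // size_tuple.
under eq_bigr do rewrite -iotaZ; rewrite -rmorph_sum => /eqP; rewrite fmorph_eq0 => /eqP.
by move/freeP: (basis_free (vbasisP Fs)); apply.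
Qed.

End SubfieldOf.

Lemma prime_ideal_exp_sub P a b N : prime_ideal P -> a \in Aint -> b \in Aint -> P (a - b) -> P (a ^+ N - b ^+ N).
Proof.
move=> prP Aa Ab Pab; rewrite subrXX mulrC; apply: (prime_idealM prP) => //.
by apply: rpred_sum => i _; rewrite rpredM ?rpredX.
Qed.

Lemma prime_ideal_trace F P : is_subfield F -> prime_ideal P -> is_prime_ideal F (fun x => F x /\ P x).
Proof.
move=> sfF prP; split=> [x [Fx Px] | ]; first by split=> //; apply: (prime_ideal_Aint prP).
split.
- by split; [apply: subfield0 | apply: prime_ideal0].
- by move=> x y [Fx Px] [Fy Py]; split; [apply: subfieldD | apply: prime_idealD].
- by move=> a x [Fa Aa] [Fx Px]; split; [apply: subfieldM | apply: prime_idealM].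
- by case=> _; apply: prime_ideal1.
move=> x y [Fx Ax] [Fy Ay] [_ /(prime_ideal_prime prP Ax Ay)[Px | Py]]; [left | right]; split=> //.
Qed.

Section FrobeniusOrder.
Variables (K H : algC -> Prop).
Hypotheses (sfK : is_subfield K) (extKH : abelian_unramified_ext K H).
Variables (L : splittingFieldType rat) (iota : {rmorphism L -> algC}) (Ks Hs : {subfield L}).
Hypothesis galL : galois 1 {:L}.
Hypotheses (KsE : forall x, x \in Ks <-> K (iota x)) (HsE : forall x, x \in Hs <-> H (iota x)).
Hypothesis embH : forall y, H y -> exists x, iota x = y.
Local Notation U := 'Gal({:L} / Ks)%g.
Local Notation W := 'Gal({:L} / Hs)%g.
Local Notation G := 'Gal({:L} / 1)%g.

Let sfH : is_subfield H. Proof. by case: extKH => [[]]. Qed.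
Let sKH : forall x, K x -> H x. Proof. by case: extKH => [[]]. Qed.

Lemma extend_fixing g : g \in U -> exists s : {rmorphism algC -> algC},
  fixes K s /\ forall x, s (iota x) = iota (g x).
Proof.
move=> /mem_gal Ug; have [s Ds] := gal_extend iota g; exists s; split=> // y Ky.
have [x Dx] := embH (sKH Ky); rewrite -Dx Ds Ug //.
by apply/KsE; rewrite Dx.
Qed.

Lemma gal_stable g x : g \in U -> x \in Hs -> g x \in Hs.
Proof.
move=> Ug /HsE Hx; have [s [fs Ds]] := extend_fixing Ug.
by apply/HsE; rewrite -Ds; case: extKH => [[_ _ _ stab _] _ _]; apply: stab.
Qed.

Lemma gal_commute g h x : g \in U -> h \in U -> x \in Hs -> g (h x) = h (g x).
Proof.
move=> Ug Uh /HsE Hx; have [s [fs Ds]] := extend_fixing Ug; have [t [ft Dt]] := extend_fixing Uh.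
apply: (fmorph_inj iota); rewrite -Ds -!Dt -Ds.
by case: extKH => [[_ _ _ _ comm] _ _]; apply: comm.
Qed.

Lemma gal_norm : U \subset 'N(W)%g.
Proof.
apply/fintype.subsetP=> g Ug; rewrite inE; apply/fintype.subsetP=> _ /imsetP[h /mem_gal Wh ->].
apply/mem_gal=> x Hx; rewrite conjgE !galM ?memvf // Wh; last by rewrite gal_stable ?groupV.
by rewrite -galM ?memvf // mulVg gal_id.
Qed.

Lemma gal_quotient_abelian : abelian (U / W)%g.
Proof.
apply: quotient_cents2r; rewrite gen_subG; apply/fintype.subsetP=> _ /imset2P[g h Ug Uh ->].
apply/mem_gal=> x Hx; set k := (h * g)%g; have Uk : k \in U by rewrite groupM.
have Dx : x = k (k^-1%g x) by rewrite -galM ?memvf // mulVg gal_id.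
have Hx' : k^-1%g x \in Hs by rewrite gal_stable ?groupV.
rewrite {1}Dx -galM ?memvf // -commgC [in RHS]Dx /k !galM ?memvf //.
by rewrite gal_commute // !gal_stable ?groupV ?groupM.
Qed.

Lemma gal_conj_apply (g x : gal_of {:L}) m y : ((g ^+ m) ^ x^-1)%g y = x^-1%g ((g ^+ m)%g (x y)).
Proof. by rewrite conjgE invgK !galM ?memvf. Qed.

Lemma gal_conj_congruence P (g x : gal_of {:L}) m (s : {rmorphism algC -> algC}) N :
    (forall y, s (iota y) = iota (x y)) ->
    (forall y, iota y \in Aint -> P (iota ((g ^+ m)%g y) - iota y ^+ N)) ->
  forall y, iota y \in Aint -> P (s (iota (((g ^+ m) ^ x^-1)%g y) - iota y ^+ N)).
Proof.
move=> Ds cong y Ay; rewrite gal_conj_apply rmorphB rmorphXn /= !Ds -galM ?memvf // mulVg gal_id.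
by apply: cong; apply: (@gal_integral_pred L iota x y).
Qed.

Lemma gal_power_congruence P (g : gal_of {:L}) q m : prime_ideal P ->
    (forall y, iota y \in Aint -> P (iota (g y) - iota y ^+ q)) ->
  forall y, iota y \in Aint -> P (iota ((g ^+ m)%g y) - iota y ^+ (q ^ m)).
Proof.
move=> prP cong; elim: m => [|m IHm] y Ay.
  by rewrite expg0 gal_id subrr; apply: prime_ideal0.
have Agy : iota (g y) \in Aint by apply: (@gal_integral_pred L iota g y).
rewrite expgS galM ?memvf // expnS exprM.
rewrite -(subrK (iota (g y) ^+ (q ^ m)) (iota _)) -addrA; apply: (prime_idealD prP); first exact: IHm.
by apply: prime_ideal_exp_sub => //; [exact: rpredX | exact: cong].
Qed.

Lemma mem_gal_of_fixes (g : gal_of {:L}) (s : {rmorphism algC -> algC}) :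
  (forall x, s (iota x) = iota (g x)) -> (forall y, H y -> s y = y) -> g \in W.
Proof. by move=> Ds fs; apply/mem_gal=> x /HsE Hx; apply: (fmorph_inj iota); rewrite -Ds fs. Qed.

(** The conjugate of the inert element g^m is inert at the prime pulled back along [s]. When it
    fixes K as well, unramifiedness of H / K makes it trivial on H. *)
Lemma inertia_conj P l (g x : gal_of {:L}) m : prime_ideal P -> prime l -> P l%:R ->
    (forall y, iota y \in Aint -> P (iota (g y) - iota y)) ->
  ((g ^+ m) ^ x^-1)%g \in U -> ((g ^+ m) ^ x^-1)%g \in W.
Proof.
move=> prP pr_l Pl inert Uh; set h := (_ ^ _)%g in Uh *.
have [s Ds] := gal_extend iota x; have [t [ft Dt]] := extend_fixing Uh.
apply: (mem_gal_of_fixes Dt) => y Hy.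
have inert_m z : iota z \in Aint -> P (iota ((g ^+ m)%g z) - iota z ^+ 1).
  by rewrite -[1%N](exp1n m); apply: gal_power_congruence => // w; rewrite expr1; apply: inert.
case: extKH => [[_ _ _ stab _] unr _].
apply: (unramified_inertia_trivial (prime_ideal_comap prP s) pr_l _ sfH sKH unr ft _ _ Hy).
- by rewrite rmorph_nat.
- exact: stab.
move=> a Ha Aa; have [z Dz] := embH Ha; rewrite -Dz Dt.
by apply: (gal_conj_congruence Ds inert_m); rewrite Dz.
Qed.

(** For m odd, h is the complex conjugation attached to the embedding [s]: its fixed points are the
    z with s z real. If h fixes K, then s is real on K, hence on H by unramifiedness at infinity. *)
Lemma conjugation_conj (g x : gal_of {:L}) m : (forall y, iota (g y) = (iota y)^*) ->
  ((g ^+ m) ^ x^-1)%g \in U -> ((g ^+ m) ^ x^-1)%g \in W.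
Proof.
move=> Dg Uh; set h := (_ ^ _)%g in Uh *.
have g2 : (g * g)%g = 1%g.
  apply/eqP/gal_eqP=> y _; apply: (fmorph_inj iota).
  by rewrite gal_id galM ?memvf // !Dg conjCK.
have Dgm : (g ^+ m)%g = (g ^+ odd m)%g.
  by rewrite -{1}(odd_double_half m) expgD -muln2 mulnC expgM expgS expg1 g2 expg1n mulg1.
have [odd_m | even_m] := boolP (odd m); last first.
  by rewrite /h Dgm (negPf even_m) expg0 conj1g group1.
have {}Dgm : (g ^+ m)%g = g by rewrite Dgm odd_m expg1.
have [s Ds] := gal_extend iota x.
have fixh z : h z = z <-> s (iota z) \is Num.real.
  rewrite /h gal_conj_apply Dgm Ds CrealE /= -Dg (inj_eq (fmorph_inj iota)).
  have xK w : x^-1%g (x w) = w by rewrite -galM ?memvf // mulgV gal_id.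
  have xVK w : x (x^-1%g w) = w by rewrite -galM ?memvf // mulVg gal_id.
  by split=> [Dz | /eqP-> //]; rewrite -{2}Dz xVK.
apply/mem_gal=> z /HsE Hz; apply/fixh.
case: extKH => [_ _ unr_inf]; apply: (unr_inf s) Hz => y Ky.
have [w Dw] := embH (sKH Ky); rewrite -Dw; apply/fixh.
by move/mem_gal: Uh; apply; apply/KsE; rewrite Dw.
Qed.

Variable p : nat.
Hypothesis pr_p : prime p.
Hypothesis uniq_p : exists P, is_prime_ideal K P /\ P p%:R /\
      forall Q, is_prime_ideal K Q -> Q p%:R -> forall x, Q x <-> P x.

(** Each factor of the trivial transfer of [s0] is replaced by an element of the same class in U / W
    that acts as a power of Frobenius modulo P itself. The product of these elements fixes H and
    acts modulo P as raising to the power p^(sum of the n x), the sum being the index. *)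
Lemma frobenius_index P y : prime_ideal P -> P p%:R -> H y -> y \in Aint ->
  P (y ^+ (p ^ #|G : U|%g) - y).
Proof.
move=> prP Pp Hy Ay.
have sUG : U \subset G by apply/fintype.subsetP=> g _; apply: mem_gal1.
have [N [nNG inN outN]] := transfer_kernel_exists sUG gal_norm gal_quotient_abelian.
have [s0 Gs0 frob] := frobenius_exists iota galL prP pr_p Pp.
have [|X [n [_ sum_n memU prod1]]] := outN s0.
  have full := @normal_subgroup_full L iota N galL nNG; apply: full => [P' l g prP' pr_l P'l inert | g Dg].
    by apply: inN => [|x m _]; [apply: mem_gal1 | apply: inertia_conj P'l inert].
  by apply: inN => [|x m _]; [apply: mem_gal1 | apply: conjugation_conj].
have frobX m := gal_power_congruence m prP frob.
have twist x : x \in X -> exists h, [/\ h \in U, coset W h = coset W ((s0 ^+ n x) ^ x^-1)%g &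
    forall z, iota z \in Aint -> P (iota (h z) - iota z ^+ (p ^ n x))].
  move=> Xx; set k := ((s0 ^+ n x) ^ x^-1)%g; have Uk : k \in U by apply: memU.
  have [s Ds] := gal_extend iota x; have prPs := prime_ideal_comap prP s.
  have [|u Uu Pu] := @gal_prime_transitivity L iota 'Gal({:L} / Ks)%G _ _ prPs prP.
    move=> z Az fz Psz; have Kz : K (iota z).
      apply/KsE; have /galois_fixedField <- : galois Ks {:L}.
        by apply: galoisS galL; rewrite sub1v subvf.
      by apply/fixedFieldP; rewrite ?memvf.
    (* P and its pullback along s have traces on K that are both primes containing p, hence equal;
       so an element u of U carries the pullback to P. *)
    have [P0 [_ [_ uniq]]] := uniq_p.
    have [|P0s _] := uniq _ (prime_ideal_trace sfK prPs) _ (iota z).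
      by split; [apply: subfield_nat | rewrite rmorph_nat].
    have [|_ P0P] := uniq _ (prime_ideal_trace sfK prP) _ (iota z).
      by split; first apply: subfield_nat.
    by have [] := P0P (P0s (conj Kz Psz)).
  (* Conjugation by u in U brings the congruence back to P and does not change the class in U / W,
     which is abelian. *)
  exists (k ^ u)%g; split; first by rewrite groupJ.
    rewrite morphJ ?(fintype.subsetP gal_norm) // conjgE.
    have /centsP/(_ (coset W k))/(_ _ (coset W u))-> := gal_quotient_abelian; rewrite ?mem_quotient //.
    exact: mulKg.
  move=> z Az; set z' := u^-1%g z.
  have Az' : iota z' \in Aint by apply: (@gal_integral_pred L iota u^-1%g z).
  have := gal_conj_congruence Ds (frobX (n x)) Az'; rewrite -/k.
  rewrite -rmorphXn -rmorphB => /Pu; rewrite rmorphB rmorphXn /= rmorphB rmorphXn.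
  by rewrite /z' -!galM ?memvf // mulVg gal_id conjgE.
have steps (r : seq (gal_of {:L})) : {subset r <= X} -> exists h, [/\ h \in U,
    coset W h = (\prod_(x <- r) coset W ((s0 ^+ n x) ^ x^-1))%g &
    forall z, iota z \in Aint -> P (iota (h z) - iota z ^+ (p ^ (\sum_(x <- r) n x)))].
  elim: r => [|x r IHr] sX.
    exists 1%g; rewrite !big_nil morph1 group1; split=> // z Az.
    by rewrite gal_id subrr; apply: prime_ideal0.
  have [|h [Uh Dh cong_h]] := IHr; first by move=> w rw; apply: sX; rewrite inE rw orbT.
  have [|h' [Uh' Dh' cong_h']] := twist x; first by apply: sX; rewrite mem_head.
  exists (h' * h)%g; rewrite groupM // !big_cons morphM ?(fintype.subsetP gal_norm) //= Dh Dh'.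
  split=> // z Az; rewrite galM ?memvf //.
  have Az' : iota (h' z) \in Aint by apply: (@gal_integral_pred L iota h' z).
  rewrite expnD exprM -(subrK (iota (h' z) ^+ (p ^ (\sum_(x <- r) n x))) (iota _)) -addrA.
  apply: (prime_idealD prP); first exact: cong_h.
  by apply: prime_ideal_exp_sub => //; [exact: rpredX | exact: cong_h'].
have [|h [Uh Dh cong_h]] := steps [seq x <- index_enum _ | x \in X]; first by move=> x; rewrite mem_filter => /andP[].
rewrite !big_filter in Dh cong_h.
have {Dh} Wh : h \in W.
  by apply: coset_idr; [apply: (fintype.subsetP gal_norm) | rewrite Dh; apply: prod1].
have [z Dz] := embH Hy; have := cong_h z; rewrite Dz => /(_ Ay).
have -> : h z = z by move/mem_gal: Wh; apply; apply/HsE; rewrite Dz.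
rewrite Dz -sum_n -opprB => /(prime_idealN prP).
by rewrite opprK.
Qed.

End FrobeniusOrder.

(** * Local invariants of an unramified abelian extension, and conclusion *)

Lemma frobenius_order_bound (K H : algC -> Prop) (p d : nat) :
    is_subfield K -> abelian_unramified_ext K H -> dimQ_le K d -> prime p ->
    (exists P, is_prime_ideal K P /\ P p%:R /\
      forall Q, is_prime_ideal K Q -> Q p%:R -> forall x, Q x <-> P x) ->
  exists n, (0 < n <= d)%N /\ forall P, prime_ideal P -> P p%:R ->
    forall y, H y -> y \in Aint -> P (y ^+ (p ^ n) - y).
Proof.
move=> sfK extKH dimK pr_p uniq_p; have [[sfH sKH [D dimH] _ _] _ _] := extKH.
have [m [x [Hx spanH]]] := dimQ_span sfH dimH.
have [L [iota [galL mem_L]]] := splitting_num_field [seq x i | i <- enum 'I_m].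
have /choice[x' Dx'] : forall i, exists y, iota y = x i.
  by move=> i; apply: mem_L; apply: map_f; rewrite mem_enum.
have embH y : H y -> exists z, iota z = y.
  move=> /spanH[c ->]; exists (\sum_i c i *: x' i).
  by rewrite rmorph_sum; apply: eq_bigr => i _; rewrite /= iotaZ Dx'.
have [Ks KsE] := subfield_preimage iota sfK; have [Hs HsE] := subfield_preimage iota sfH.
exists #|'Gal({:L} / 1) : 'Gal({:L} / Ks)|%g; split; last first.
  by move=> P prP Pp y Hy Ay; apply: (frobenius_index sfK extKH galL KsE HsE embH pr_p uniq_p).
rewrite indexg_gt0 /=; have galKs : galois Ks {:L} by apply: galoisS galL; rewrite sub1v subvf.
have sUG : 'Gal({:L} / Ks)%g \subset 'Gal({:L} / 1)%g by apply/fintype.subsetP=> g _; apply: mem_gal1.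
have := dim_fixed_galois galL (G := 'Gal({:L} / Ks)%G) sUG => /= <-.
rewrite dimv1 divn1 (galois_fixedField galKs).
by apply: (dim_subfield_le (iota := iota) dimK) => z /KsE.
Qed.

Lemma prime_ideal_frobenius_iter P (y : algC) q k : prime_ideal P -> y \in Aint ->
  P (y ^+ q - y) -> P (y ^+ (q ^ k) - y).
Proof.
move=> prP Ay Pq; elim: k => [|k IHk]; first by rewrite subrr; apply: prime_ideal0.
rewrite expnS exprM -(subrK (y ^+ (q ^ k)) (_ ^+ _ ^+ _)) -addrA.
apply: (prime_idealD prP) => //; apply: prime_ideal_exp_sub => //; exact: rpredX.
Qed.

Lemma vO_frobenius_congruence P (H : algC -> Prop) q y : prime_ideal P -> is_subfield H ->
    (forall z, H z -> z \in Aint -> P (z ^+ q - z)) -> H y -> vO P y ->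
  vM P (y ^+ q - y).
Proof.
move=> prP sfH frob Hy Oy; have [a [b [[Ha Aa] [Hb Ab] P'b Dy]]] := vO_fraction prP sfH Hy Oy.
have nz_b := prime_ideal_neq0 prP P'b.
exists ((a ^+ q - a) * b - a * (b ^+ q - b)), (b ^+ q.+1); split.
- by apply: (prime_idealB prP); [apply: (prime_idealMr prP) | apply: (prime_idealM prP)] => //; apply: frob.
- exact: rpredX.
- by move/(prime_ideal_root prP Ab).
by rewrite Dy expr_div_n exprS; field; rewrite nz_b expf_neq0.
Qed.

(** The uniformizer comes from K, so that the ramification index is bounded by the degree of K and
    not by that of H. The residue exponent n <= d of [frobenius_order_bound] divides d!, which
    serves for all K of degree at most d. *)
Lemma unramified_abelian_bounded_local (K H : algC -> Prop) (p d : nat) P :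
    is_subfield K -> abelian_unramified_ext K H -> dimQ_le K d -> prime p ->
    (exists P, is_prime_ideal K P /\ P p%:R /\
      forall Q, is_prime_ideal K Q -> Q p%:R -> forall x, Q x <-> P x) ->
    prime_ideal P -> P p%:R ->
  bounded_local P p d d`! H.
Proof.
move=> sfK extKH dimK pr_p uniq_p prP Pp; have [[sfH sKH _ _ _] unr _] := extKH.
have [pi [Kpi nz_pi Mpi unif]] := unramified_uniformizer prP pr_p Pp sfH sKH unr.
have [|e [le_e Oe1 Oe2]] := ramification_index_bound prP pr_p Pp sfK dimK Kpi nz_pi Mpi.
  by move=> y Ky; apply/unif/sKH.
split=> //; exists pi, e; split=> //; first by split=> //; apply: sKH.
move=> y; have [n [/andP[n_gt0 le_nd] frob]] := frobenius_order_bound sfK extKH dimK pr_p uniq_p.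
apply: vO_frobenius_congruence => // z Hz Az.
have /dvdnP[k ->] : (n %| d`!)%N by apply: dvdn_fact; rewrite n_gt0.
by rewrite mulnC expnM; apply: prime_ideal_frobenius_iter => //; apply: frob.
Qed.

Theorem mainTheorem1 (K H : nat -> algC -> Prop) (p : nat) :
  (forall n, is_subfield (K n)) ->
  (exists d : nat, forall n, dimQ_le (K n) d) ->
  prime p ->
  (forall n, exists P, is_prime_ideal (K n) P /\ P p%:R /\
      forall Q, is_prime_ideal (K n) Q -> Q p%:R -> forall x, Q x <-> P x) ->
  (forall n, is_Hilbert_class_field (K n) (H n)) ->
  property_B (compositum H).
Proof.
move=> sfK [d dimK] pr_p uniq_p hilb.
have [a [b [lt_ab cong]]] := local_power_congruence d pr_p (fact_gt0 d).
apply: (property_B_of_local_congruence pr_p lt_ab (compositum_subfield H)) => P prP Pp.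
apply: cong => // n; have [extKH _] := hilb n.
exact: unramified_abelian_bounded_local (sfK n) extKH (dimK n) pr_p (uniq_p n) prP Pp.
Qed.
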